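(* Let $A$, $B$, $C$, and $D$ be finite, non-empty, connected posets such that $\mathcal C(A^C)\cong\mathcal C(B^D)$. Then there exist finite, non-empty, connected posets $E$, $X$, $Y$, and $Z$ such that $A\cong\mathcal C(E^X)$, $B\cong\mathcal C(E^Y)$, $C\cong Y\times Z$, and $D\cong X\times Z$.
   Context: For posets $P$ and $Q$, $P^Q$ denotes the set of order-preserving maps $Q\to P$, ordered pointwise: $f\le g$ iff $f(q)\le g(q)$ in $P$ for all $q\in Q$. For elements $x,y$ of a poset, $x\equiv y$ means $x$ and $y$ lie in the same connected component. $\mathcal D(P^Q)$ is the set of $g\in P^Q$ that are constant on each connected component of $Q$. For $Q\neq\emptyset$, $\mathcal C(P^Q)=\{f\in P^Q\mid f\equiv g \text{ in } P^Q \text{ for some } g\in\mathcal D(P^Q)\}$, viewed as a subposet of $P^Q$. *)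

(* Defs.v *)
From mathcomp Require Import all_boot.
Set Implicit Arguments. Unset Strict Implicit. Unset Printing Implicit Defensive.

Record fposet := FPoset {
  car :> finType;
  ple : rel car;
  ple_refl : reflexive ple;
  ple_anti : antisymmetric ple;
  ple_trans : transitive ple }.

Arguments ple {f}.

Definition cmp (P : fposet) : rel P := fun x y => ple x y || ple y x.
Definition same_comp (P : fposet) (x y : P) : bool := connect (@cmp P) x y.

Definition nonempty (P : fposet) : Prop := exists x : P, True.
Definition connected (P : fposet) : Prop := forall x y : P, same_comp x y.

Definition iso (P Q : fposet) : Prop :=
  exists f : P -> Q, bijective f /\ forall x y : P, ple x y = ple (f x) (f y).

Definition monob (P Q : fposet) (f : {ffun Q -> P}) : bool :=
  [forall x : Q, forall y : Q, ple x y ==> ple (f x) (f y)].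

Definition exp_car (P Q : fposet) := {f : {ffun Q -> P} | monob f}.

Definition exp_le (P Q : fposet) : rel (exp_car P Q) :=
  fun f g => [forall q : Q, ple (val f q) (val g q)].

Lemma exp_le_refl P Q : reflexive (@exp_le P Q).
Proof. by move=> f; apply/forallP=> q; apply: ple_refl. Qed.

Lemma exp_le_anti P Q : antisymmetric (@exp_le P Q).
Proof.
move=> f g /andP[/forallP H1 /forallP H2]; apply: val_inj; apply/ffunP=> q.
by apply: ple_anti; rewrite H1 H2.
Qed.

Lemma exp_le_trans P Q : transitive (@exp_le P Q).
Proof.
move=> g f h /forallP H1 /forallP H2; apply/forallP=> q.
exact: ple_trans (H1 q) (H2 q).
Qed.

Definition exp_poset (P Q : fposet) : fposet :=
  FPoset (@exp_le_refl P Q) (@exp_le_anti P Q) (@exp_le_trans P Q).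

Section Sub.
Variables (P : fposet) (S : pred P).
Definition sub_car := {x : P | S x}.
Definition sub_le : rel sub_car := fun x y => ple (val x) (val y).
Lemma sub_le_refl : reflexive sub_le.
Proof. by move=> x; apply: ple_refl. Qed.
Lemma sub_le_anti : antisymmetric sub_le.
Proof. by move=> x y H; apply: val_inj; apply: ple_anti. Qed.
Lemma sub_le_trans : transitive sub_le.
Proof. by move=> y x z; apply: ple_trans. Qed.
Definition sub_poset : fposet := FPoset sub_le_refl sub_le_anti sub_le_trans.
End Sub.

Definition in_D (P Q : fposet) (g : exp_poset P Q) : bool :=
  [forall q : Q, forall q' : Q, same_comp q q' ==> (val g q == val g q')].

Definition in_C (P Q : fposet) (f : exp_poset P Q) : bool :=
  [exists g : exp_poset P Q, in_D g && same_comp f g].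

Definition C_poset (P Q : fposet) : fposet := sub_poset (@in_C P Q).

Definition prod_le (P Q : fposet) : rel (P * Q)%type :=
  fun x y => ple x.1 y.1 && ple x.2 y.2.
Lemma prod_le_refl P Q : reflexive (@prod_le P Q).
Proof. by move=> x; rewrite /prod_le !ple_refl. Qed.
Lemma prod_le_anti P Q : antisymmetric (@prod_le P Q).
Proof.
move=> [a b] [c d] /andP[/andP[H1 H2] /andP[H3 H4]]; simpl in *.
have -> : a = c by apply: ple_anti; rewrite H1 H3.
have -> : b = d by apply: ple_anti; rewrite H2 H4.
by [].
Qed.
Lemma prod_le_trans P Q : transitive (@prod_le P Q).
Proof.
move=> y x z /andP[H1 H2] /andP[H3 H4]; apply/andP; split;
  [exact: ple_trans H1 H3 | exact: ple_trans H2 H4].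
Qed.
Definition prod_poset (P Q : fposet) : fposet :=
  FPoset (@prod_le_refl P Q) (@prod_le_anti P Q) (@prod_le_trans P Q).

(* Main.v *)
(** For connected C, D write P = C(A^C) = C(B^D); it carries two families of retractions, r_c onto
    the copy A of the constant maps and s_d onto B.  Since C(A^(X x Y)) = C(C(A^X)^Y), induction on
    |C| + |D| reduces everything to indecomposable C and D.

    A covering pair of P changes one coordinate c, hence has a C-label and likewise a D-label.
    Modulo squares, the covering pairs above a point of A form a preorder on which C acts by moving
    an edge to another direction of the cube it comes from; above a common point of A and B both C
    and D act.  For indecomposable C and D two such actions are either independent (type u) or
    identify C with D (type m).  A longest chain of P starts at a common point, as chain lengths
    add up over coordinates, so E, the intersection of A and B, is nonempty.

    One then shows, going along covers of B from E, that every b in B has all r_c b in E, and that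
    each map C -> E so obtained can be moved along covers of E while staying in B.  The obstruction
    is that an edge of P need not be linked by squares to an edge of a cube; this disappears if C
    has a top or a bottom, and otherwise the two maximal (minimal) elements of C and D supply
    enough squares.  If C and D are isomorphic this matches A with B; if not, type m never occurs,
    B = C(E^C), and cancellation of C gives A = C(E^D). *)

Require Import Defs.
From mathcomp Require Import all_boot.
From Stdlib Require Import Classical.
Set Implicit Arguments. Unset Strict Implicit. Unset Printing Implicit Defensive.

(** * Covering pairs *)

(** Squares alone would identify parallel edges and lose the order of [C]. Two stacked edges with a
    forced middle recover it: if their labels differ, the smaller index is the one raised last. So
    edges form a preorder with monotone labels, and this is what lets indecomposability of [C] and
    [D] act. Above a point [b] of [B] outside [E] there is no action of [C]. An edge is then seen
    through its changing coordinate, a cover of [A] above [r c b], which should be a point of [E].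
    The [D]-label measured there ([cross_lab]) need not be the label of the edge; what the argument
    needs is that along the cube of a cover of [B] the measured labels are pairwise distinct
    ([up_inj], [dn_inj]). Under this condition a cover of [B] either moves one coordinate along a
    cover of [E] that is not a cover of [A] (type u), or moves every coordinate along a cover of [A]
    (type m), and such moves stay in [B]. Distinctness holds over [E]. With several maximal and
    minimal elements it is carried along steps of type u; steps of type m are pushed back along the
    path until they lie in [E]. *)

Definition plt (P : fposet) (x y : P) : bool := (x != y) && ple x y.

Section Basics.
Variable P : fposet.
Implicit Types x y z : P.

Lemma plexx x : ple x x. Proof. exact: ple_refl. Qed.
Lemma ple_tr y x z : ple x y -> ple y z -> ple x z. Proof. exact: ple_trans. Qed.
Lemma ple_as x y : ple x y -> ple y x -> x = y.
Proof. by move=> a b; apply: ple_anti; rewrite a b. Qed.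
Lemma pltW x y : plt x y -> ple x y. Proof. by case/andP. Qed.
Lemma plt_neq x y : plt x y -> x <> y. Proof. by case/andP => /eqP. Qed.
Lemma pltxx x : plt x x = false. Proof. by rewrite /plt eqxx. Qed.
Lemma plt_ple_trans y x z : plt x y -> ple y z -> plt x z.
Proof.
move=> /andP[/eqP n xy] yz; apply/andP; split; last exact: ple_tr yz.
by apply/eqP => e; apply: n; apply: ple_as => //; rewrite e.
Qed.
Lemma plt_trans y x z : plt x y -> plt y z -> plt x z.
Proof. by move=> xy /pltW; apply: plt_ple_trans. Qed.
Lemma ple_eqVlt x y : ple x y -> x = y \/ plt x y.
Proof. by move=> xy; case: (eqVneq x y) => [->|n]; [left|right; rewrite /plt n]. Qed.
Lemma plt_nge x y : plt x y -> ple y x = false.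
Proof. by case/andP => /eqP n xy; apply/negP => yx; apply: n; apply: ple_as. Qed.

(** Relative to a subset, because [P], the copies of [A] and [B] in it and their intersection each
    have their own covering relation. *)
Definition cov (S : pred P) x y : bool :=
  [&& S x, S y, plt x y &
      [forall z, S z ==> ple x z ==> ple z y ==> ((z == x) || (z == y))]].

Lemma covP (S : pred P) x y :
  reflect [/\ S x, S y, plt x y & forall z, S z -> ple x z -> ple z y -> z = x \/ z = y]
          (cov S x y).
Proof.
apply: (iffP and4P) => -[Sx Sy xy H]; split => //.
  move=> z Sz xz zy; move/forallP/(_ z)/implyP/(_ Sz)/implyP/(_ xz)/implyP/(_ zy): H.
  by case/orP => /eqP; [left|right].
apply/forallP => z; apply/implyP => Sz; apply/implyP => xz; apply/implyP => zy.
by case: (H z Sz xz zy) => ->; rewrite eqxx ?orbT.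
Qed.

Lemma cov_lt (S : pred P) x y : cov S x y -> plt x y. Proof. by case/covP. Qed.
Lemma cov_le (S : pred P) x y : cov S x y -> ple x y. Proof. by case/covP => _ _ /pltW. Qed.
Lemma cov_l (S : pred P) x y : cov S x y -> S x. Proof. by case/covP. Qed.
Lemma cov_r (S : pred P) x y : cov S x y -> S y. Proof. by case/covP. Qed.
Lemma cov_neq (S : pred P) x y : cov S x y -> x <> y. Proof. by move/cov_lt/plt_neq. Qed.
Lemma cov_mid (S : pred P) x y z : cov S x y -> S z -> ple x z -> ple z y -> z = x \/ z = y.
Proof. by case/covP => _ _ _; apply. Qed.

Lemma cov_up_ex (S : pred P) x y : S x -> S y -> plt x y ->
  exists2 z, cov S x z & ple z y.
Proof.
move=> Sx; have [n] := ubnP #|[set z | ple x z && ple z y]|.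
elim: n y => // n IH y le_n Sy xy.
case: (boolP [exists z, [&& S z, plt x z & plt z y]]) => [/existsP[z /and3P[Sz xz zy]]|H].
  have [|w cw wz] := IH z _ Sz xz; last by exists w => //; apply: ple_tr (pltW zy).
    move: le_n; rewrite ltnS; apply: leq_trans; apply: proper_card; apply/properP; split.
      by apply/subsetP => w; rewrite !inE => /andP[-> /ple_tr]; apply; apply: pltW.
    exists y; rewrite !inE ?plexx ?(pltW xy) //=.
    by rewrite plt_nge.
exists y; last exact: plexx.
apply/covP; split => // z Sz xz zy.
case: (ple_eqVlt xz) => [->|xz']; first by left.
case: (ple_eqVlt zy) => [->|zy']; first by right.
by case/negP: H; apply/existsP; exists z; rewrite Sz xz' zy'.
Qed.

End Basics.

(** * Order duality and induction along covers *)

Definition op (P : fposet) : fposet.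
refine (@FPoset (car P) (fun x y : P => ple y x) _ _ _).
- by move=> x; apply: ple_refl.
- by move=> x y /andP[a b]; apply: ple_as.
- by move=> y x z a b; apply: ple_tr b a.
Defined.

Lemma plt_op (P : fposet) (x y : P) : plt (x : op P) (y : op P) = plt y x.
Proof. by rewrite /plt eq_sym. Qed.

Lemma cov_op (P : fposet) (S : pred P) (x y : P) :
  cov (S : pred (op P)) (x : op P) (y : op P) = cov S y x.
Proof.
apply/covP/covP => -[Sx Sy xy H]; split=> //; rewrite ?plt_op // in xy *.
  by move=> z Sz xz zy; case: (H z Sz zy xz) => ->; auto.
by move=> z Sz xz zy; case: (H z Sz zy xz) => ->; auto.
Qed.

Section Induction.
Variable P : fposet.
Implicit Types x y z : P.

Lemma cov_dn_ex (S : pred P) x y : S x -> S y -> plt x y ->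
  exists2 z, cov S z y & ple x z.
Proof.
move=> Sx Sy xy; have xy' : plt (y : op P) (x : op P) by rewrite plt_op.
have [z cz le_z] := @cov_up_ex (op P) S y x Sy Sx xy'.
by exists z => //; rewrite -cov_op.
Qed.

Lemma cov_ind_up (S : pred P) (Q : P -> Prop) x : S x -> Q x ->
  (forall y z, ple x y -> Q y -> cov S y z -> Q z) ->
  forall y, S y -> ple x y -> Q y.
Proof.
move=> Sx Qx H y Sy xy.
have [n] := ubnP #|[set z | ple x z && ple z y]|.
elim: n y Sy xy => // n IH y Sy xy le_n.
case: (ple_eqVlt xy) => [<- //|xy'].
have [z czy xz] := cov_dn_ex Sx Sy xy'.
apply: (H _ _ xz _ czy); apply: IH => //; first exact: cov_l czy.
move: le_n; rewrite ltnS; apply: leq_trans; apply: proper_card; apply/properP; split.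
  by apply/subsetP => w; rewrite !inE => /andP[-> /ple_tr]; apply; apply: cov_le czy.
by exists y; rewrite !inE ?plexx ?xy //= (plt_nge (cov_lt czy)).
Qed.

(** A function constant along all covers of an interval is constant on it. With a coordinate for
    [phi] this is the standard way below to find an edge with a prescribed label inside an
    interval. *)
Lemma cov_change (X : eqType) (phi : P -> X) x y : ple x y -> phi x != phi y ->
  exists x1 y1, [/\ ple x x1, cov predT x1 y1, ple y1 y & phi x1 != phi y1].
Proof.
move=> xy ne.
pose R := [exists x1, exists y1, [&& ple x x1, cov predT x1 y1, ple y1 y & phi x1 != phi y1]].
have [/existsP[x1 /existsP[y1 /and4P[a b c d]]]|nR] := boolP R; first by exists x1, y1.
suff: ple y y -> phi y = phi x by move=> /(_ (plexx y)) e; rewrite e eqxx in ne.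
apply: (@cov_ind_up predT (fun z => ple z y -> phi z = phi x) x) => // u v xu IH cuv vy.
rewrite -(IH (ple_tr (cov_le cuv) vy)); apply/eqP/idPn => ne'.
by case/negP: nR; apply/existsP; exists u; apply/existsP; exists v; rewrite xu cuv vy eq_sym.
Qed.
End Induction.

Lemma cov_ind_dn (P : fposet) (S : pred P) (Q : P -> Prop) (x : P) : S x -> Q x ->
  (forall y z : P, ple y x -> Q y -> cov S z y -> Q z) ->
  forall y : P, S y -> ple y x -> Q y.
Proof.
move=> Sx Qx H y Sy yx.
apply: (@cov_ind_up (op P) S Q x) => // u v xu Qu; rewrite cov_op.
exact: H.
Qed.

(** * Abstract exponentials *)

(* [r c f] stands for the constant map with value [f c]: this presents a union of components of
   [A^C] with [A] recovered as the common fixed points [fixr r]. *)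
Record root (P C : fposet) (r : C -> P -> P) : Prop := Root {
  r_mono : forall c f g, ple f g -> ple (r c f) (r c g);
  r_abs : forall c c' f, r c (r c' f) = r c' f;
  r_inc : forall c c' f, ple c c' -> ple (r c f) (r c' f);
  r_ext : forall f g, (forall c, ple (r c f) (r c g)) -> ple f g;
  r_up : forall f (a : C -> P), (forall c c', ple c c' -> ple (a c) (a c')) ->
     (forall c c', r c' (a c) = a c) -> (forall c, ple (r c f) (a c)) ->
     exists g, forall c, r c g = a c;
  r_dn : forall f (a : C -> P), (forall c c', ple c c' -> ple (a c) (a c')) ->
     (forall c c', r c' (a c) = a c) -> (forall c, ple (a c) (r c f)) ->
     exists g, forall c, r c g = a c }.

Lemma root_op (P C : fposet) (r : C -> P -> P) :
  root r -> @root (op P) (op C) r.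
Proof.
move=> R; constructor.
- by move=> c f g; apply: (r_mono R).
- exact: (r_abs R).
- by move=> c c' f; apply: (r_inc R).
- by move=> f g; apply: (r_ext R).
- by move=> f a m fx h; apply: (r_dn R (f := f)) => // c c' cc'; apply: m.
- by move=> f a m fx h; apply: (r_up R (f := f)) => // c c' cc'; apply: m.
Qed.

Definition fixr (P C : fposet) (r : C -> P -> P) : pred P :=
  fun f => [forall c, r c f == f].

(* [c0] is only a default value. *)
Definition lab (P C : fposet) (r : C -> P -> P) (c0 : C) (p : P * P) : C :=
  odflt c0 [pick c | r c p.1 != r c p.2].

(** Meaningful once some element is known to have the coordinates [a]; otherwise [x] is returned as
    a default. *)
Definition mk (P C : fposet) (r : C -> P -> P) (x : P) (a : C -> P) : P :=
  odflt x [pick g | [forall c, r c g == a c]].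

Definition upd (P C : fposet) (r : C -> P -> P) (f : P) (c : C) (a : P) : P :=
  mk r f (fun c' => if c' == c then a else r c' f).

(* For a cover [p] of [fixr r], the edge in direction [c] of the cube of the maps C -> {p.1, p.2}. *)
Definition edge (P C : fposet) (r : C -> P -> P) (p : P * P) (c : C) : P * P :=
  (mk r p.1 (fun c' => if plt c c' then p.2 else p.1),
   mk r p.1 (fun c' => if ple c c' then p.2 else p.1)).

Definition coord (P C : fposet) (r : C -> P -> P) (c0 : C) (p : P * P) : P * P :=
  (r (lab r c0 p) p.1, r (lab r c0 p) p.2).

Definition covp (P : fposet) (S : pred P) (p : P * P) := cov S p.1 p.2.

(* A pair stands for a covering edge.  [R1 p q]: opposite sides of a square, [q] on top.
   [R2 p q]: [q] then [p] is a maximal chain of length two whose interval has no other middle. *)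
Definition R1 (P : fposet) (S : pred P) (p q : P * P) : bool :=
  [&& covp S p, covp S q, ple p.1 q.1, ple p.2 q.2 & ~~ ple p.2 q.1].

Definition R2 (P : fposet) (S : pred P) (p q : P * P) : bool :=
  [&& covp S p, covp S q, p.1 == q.2 &
      [forall m, cov S q.1 m ==> cov S m p.2 ==> (m == q.2)]].

Section Root.
Variables (P C : fposet) (r : C -> P -> P) (c0 : C).
Hypothesis H : root r.
Local Notation A := (fixr r).
Local Notation lb := (lab r c0).
Implicit Types (f g x y z : P) (c : C) (p q : P * P).

Lemma fixP x : reflect (forall c, r c x = x) (A x).
Proof. by apply: (iffP forallP) => h c; [apply/eqP|apply/eqP]. Qed.

Lemma fix_r c x : A (r c x).
Proof. by apply/fixP => c'; rewrite (r_abs H). Qed.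

Lemma fixE x c : A x -> r c x = x. Proof. by move/fixP. Qed.

Lemma r_inj f g : (forall c, r c f = r c g) -> f = g.
Proof. by move=> e; apply: ple_as; apply: (r_ext H) => c; rewrite e plexx. Qed.

Lemma fix_ext f x : A x -> (forall c, r c f = x) -> f = x.
Proof. by move=> Ax e; apply: r_inj => c; rewrite e fixE. Qed.

Lemma mkP x a : (exists g, forall c, r c g = a c) -> forall c, r c (mk r x a) = a c.
Proof.
move=> [g eg] c; rewrite /mk; case: pickP => [h /forallP/(_ c)/eqP //|/(_ g)].
by case/negP; apply/forallP => d; rewrite eg.
Qed.

Lemma mk_upP f x a : (forall c c', ple c c' -> ple (a c) (a c')) -> (forall c, A (a c)) ->
  (forall c, ple (r c f) (a c)) -> forall c, r c (mk r x a) = a c.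
Proof.
move=> m fa h; apply: mkP; apply: (r_up H (f := f)) => // c c'.
by rewrite fixE.
Qed.

Lemma mk_dnP f x a : (forall c c', ple c c' -> ple (a c) (a c')) -> (forall c, A (a c)) ->
  (forall c, ple (a c) (r c f)) -> forall c, r c (mk r x a) = a c.
Proof.
move=> m fa h; apply: mkP; apply: (r_dn H (f := f)) => // c c'.
by rewrite fixE.
Qed.

(** [P] stands for a union of components, so [r_up] and [r_dn] realize only families comparable with
    an existing element; hence the comparability of [a] with the old coordinate. *)
Lemma updP f c a : A a -> ple (r c f) a || ple a (r c f) ->
  (forall c', plt c c' -> ple a (r c' f)) -> (forall c', plt c' c -> ple (r c' f) a) ->
  forall c', r c' (upd r f c a) = if c' == c then a else r c' f.
Proof.
move=> Aa cmp up dn.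
have m : forall d d', ple d d' -> ple (if d == c then a else r d f) (if d' == c then a else r d' f).
  move=> d d' dd'; case: (eqVneq d c) => [e|n]; case: (eqVneq d' c) => [e'|n'].
  - exact: plexx.
  - by apply: up; rewrite /plt eq_sym n' -e.
  - by apply: dn; rewrite /plt n -e'.
  - exact: (r_inc H).
have fa : forall d, A (if d == c then a else r d f) by move=> d; case: ifP => // _; apply: fix_r.
case/orP: cmp => cmp.
  by apply: (mk_upP (f := f)) => // d; case: eqP => [->|_]; rewrite ?plexx.
by apply: (mk_dnP (f := f)) => // d; case: eqP => [->|_]; rewrite ?plexx.
Qed.

Lemma upd_upP f c a : A a -> ple (r c f) a -> (forall c', plt c c' -> ple a (r c' f)) ->
  forall c', r c' (upd r f c a) = if c' == c then a else r c' f.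
Proof.
move=> Aa fa up; apply: updP; rewrite ?fa // => c' /pltW /(r_inc H f) h.
exact: ple_tr fa.
Qed.

(** Let [m] be a maximal index at which [f] and [g] differ. Above [m] they agree, so coordinate [m]
    of [f] can be raised to any fixed [z] between the two values; the result lies between [f] and
    [g], hence is one of them. This shows both that the two values at [m] form a cover and that
    nothing else changes. *)
Lemma cov_lab_ex f g : cov predT f g ->
  exists c, cov A (r c f) (r c g) /\ forall c', c' != c -> r c' f = r c' g.
Proof.
move=> cfg; have le := cov_le cfg.
have /existsP[c ne] : [exists c, r c f != r c g].
  apply: contraT => /existsPn e; case: (cov_neq cfg); apply: r_inj => c.
  by apply/eqP/negPn; apply: e.
have [m [Sm cm Hm]] : exists m, [/\ r m f != r m g, ple c m & forall c', plt m c' -> r c' f = r c' g].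
  pose Q m := r m f != r m g.
  have [n] := ubnP #|[set z | ple c z && Q z]|.
  elim: n c ne => // n IH c ne le_n.
  case: (boolP [exists c', plt c c' && Q c']) => [/existsP[d /andP[cd Qd]]|/existsPn no].
    have [|m [Qm dm h]] := IH d Qd.
      move: le_n; rewrite ltnS; apply: leq_trans; apply: proper_card; apply/properP; split.
        by apply/subsetP => w; rewrite !inE => /andP[/(ple_tr (pltW cd)) -> ->].
      by exists c; rewrite !inE ?plexx ?(plt_nge cd).
    by exists m; split => //; apply: ple_tr dm; apply: pltW.
  exists c; split => //; first exact: plexx.
  by move=> c' cc'; apply/eqP/negPn; have := no c'; rewrite cc'.
have rle c' : ple (r c' f) (r c' g) by apply: (r_mono H).
have upm : forall z, A z -> ple (r m f) z -> ple z (r m g) ->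
    forall c', r c' (upd r f m z) = if c' == m then z else r c' f.
  move=> z Az fz zg; apply: upd_upP => // c' mc'; rewrite (Hm _ mc').
  by apply: ple_tr zg _; apply: (r_inc H); apply: pltW.
have between z : A z -> ple (r m f) z -> ple z (r m g) -> upd r f m z = f \/ upd r f m z = g.
  move=> Az fz zg; have e := upm z Az fz zg.
  apply: (cov_mid cfg) => //; apply: (r_ext H) => c'; rewrite e; case: eqP => [->|] // _; exact: plexx.
exists m; split.
  apply/covP; split; try exact: fix_r.
    by rewrite /plt Sm rle.
  move=> z Az fz zg; have e := upm z Az fz zg m; rewrite eqxx in e.
  by case: (between z Az fz zg) => e'; rewrite e' in e; rewrite e; auto.
move=> c' ne'; have e := upm _ (fix_r m g) (rle m) (plexx _).
case: (between _ (fix_r m g) (rle m) (plexx _)) => e'; rewrite e' in e.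
  by move: (e m); rewrite eqxx => /eqP; rewrite (negbTE Sm).
by rewrite (e c') (negbTE ne').
Qed.

Lemma lab_uniq f g c : (forall c', c' != c -> r c' f = r c' g) -> r c f != r c g -> lb (f, g) = c.
Proof.
move=> e ne; rewrite /lab /=; case: pickP => [d /= nd|/(_ c)]; last by rewrite ne.
by apply/eqP; apply/negPn/negP => dc; move: nd; rewrite e ?eqxx.
Qed.
End Root.

(** * Covering edges and their labels *)

Section Edges.
Variables (P C : fposet) (r : C -> P -> P) (c0 : C).
Hypothesis H : root r.
Local Notation A := (fixr r).
Local Notation lb := (lab r c0).
Local Notation co := (coord r c0).
Local Notation ed := (edge r).
Implicit Types (f g x y z : P) (c : C) (p q : P * P).

Lemma lab_cov p : covp predT p ->
  covp A (co p) /\ forall c', c' != lb p -> r c' p.1 = r c' p.2.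
Proof.
case: p => f g; rewrite /covp /= => /(cov_lab_ex H)[c [ca e]].
have el : lb (f, g) = c.
  by apply: lab_uniq => //; apply/eqP; apply: cov_neq ca.
by rewrite /coord el.
Qed.

Lemma lab_neq p : covp predT p -> r (lb p) p.1 != r (lb p) p.2.
Proof. by case/lab_cov => /cov_neq /eqP. Qed.

Lemma lab_eq p c : covp predT p -> r c p.1 != r c p.2 -> lb p = c.
Proof.
move=> cp ne; apply/eqP; apply: contraNT ne => ne; rewrite eq_sym in ne.
by apply/eqP; case: (lab_cov cp) => _; apply.
Qed.

Lemma cov_of_lab f g c : (forall c', c' != c -> r c' f = r c' g) -> cov A (r c f) (r c g) ->
  covp predT (f, g) /\ lb (f, g) = c.
Proof.
move=> e ca; have ne : r c f != r c g by apply/eqP; apply: cov_neq ca.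
split; last exact: lab_uniq.
have lefg : ple f g.
  by apply: (r_ext H) => c'; case: (eqVneq c' c) => [->|/e ->]; [apply: cov_le ca|apply: plexx].
rewrite /covp /=; apply/covP; split => //.
  by rewrite /plt lefg andbT; apply/eqP => efg; rewrite efg eqxx in ne.
move=> z _ fz zg.
have ez c' : c' != c -> r c' z = r c' g.
  move=> n; apply: ple_as; first exact: (r_mono H).
  by rewrite -(e c') //; apply: (r_mono H).
case: (cov_mid ca (fix_r H c z) (r_mono H c fz) (r_mono H c zg)) => ec; [left|right].
  by apply: (r_inj H) => c'; case: (eqVneq c' c) => [->//|n]; rewrite ez ?e.
by apply: (r_inj H) => c'; case: (eqVneq c' c) => [->//|n]; rewrite ez.
Qed.

Lemma lab_above p c : covp predT p -> plt (lb p) c -> ple (co p).2 (r c p.1).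
Proof.
move=> cp lt; have [_ e] := lab_cov cp.
by rewrite (e c) ?(r_inc H) ?(pltW lt) // eq_sym; case/andP: lt.
Qed.

Lemma edgeP p c : covp A p ->
  (forall c', r c' (ed p c).1 = if plt c c' then p.2 else p.1) /\
  (forall c', r c' (ed p c).2 = if ple c c' then p.2 else p.1).
Proof.
move=> cp; have A1 := cov_l cp; have A2 := cov_r cp; have l12 := cov_le cp.
split; apply: (mk_upP H (f := p.1)).
- move=> d d' dd'; case: ifP => [cd|_]; first by rewrite (plt_ple_trans cd dd') plexx.
  by case: ifP; rewrite ?plexx.
- by move=> d; case: ifP.
- by move=> d; rewrite fixE //; case: ifP; rewrite ?plexx.
- move=> d d' dd'; case: ifP => [cd|_]; first by rewrite (ple_tr cd dd') plexx.
  by case: ifP; rewrite ?plexx.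
- by move=> d; case: ifP.
- by move=> d; rewrite fixE //; case: ifP; rewrite ?plexx.
Qed.

Lemma edge1 p c c' : covp A p -> r c' (ed p c).1 = if plt c c' then p.2 else p.1.
Proof. by move=> cp; case: (edgeP c cp). Qed.
Lemma edge2 p c c' : covp A p -> r c' (ed p c).2 = if ple c c' then p.2 else p.1.
Proof. by move=> cp; case: (edgeP c cp). Qed.

Lemma edge_cov p c : covp A p -> covp predT (ed p c).
Proof.
move=> cp; case: (@cov_of_lab (ed p c).1 (ed p c).2 c) => //.
  by move=> c' n; rewrite edge1 // edge2 // /plt eq_sym n.
by rewrite edge1 // edge2 // pltxx plexx.
Qed.

Lemma edge_lab p c : covp A p -> lb (ed p c) = c.
Proof.
move=> cp; case: (@cov_of_lab (ed p c).1 (ed p c).2 c) => //.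
  by move=> c' n; rewrite edge1 // edge2 // /plt eq_sym n.
by rewrite edge1 // edge2 // pltxx plexx.
Qed.

Lemma edge_coord p c : covp A p -> co (ed p c) = p.
Proof.
move=> cp; rewrite /coord edge_lab // edge1 // edge2 // pltxx plexx.
by case: (p).
Qed.

Lemma edge_ge p c : covp A p -> ple p.1 (ed p c).1.
Proof.
move=> cp; apply: (r_ext H) => c'; rewrite edge1 // fixE ?(cov_l cp) //.
by case: ifP; rewrite ?plexx ?(cov_le cp).
Qed.

Lemma edge_le p c : covp A p -> ple (ed p c).2 p.2.
Proof.
move=> cp; apply: (r_ext H) => c'; rewrite edge2 // (fixE (x := p.2)) ?(cov_r cp) //.
by case: ifP; rewrite ?plexx ?(cov_le cp).
Qed.

Lemma coord_cov p : covp predT p -> covp A (co p).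
Proof. by case/lab_cov. Qed.

Lemma coord_ge b p : A b -> ple b p.1 -> ple b (co p).1.
Proof. by move=> Ab h; rewrite -(fixE (lb p) Ab); apply: (r_mono H). Qed.

Lemma coord_le b p : A b -> ple p.2 b -> ple (co p).2 b.
Proof. by move=> Ab h; rewrite -[b in ple _ b](fixE (lb p) Ab); apply: (r_mono H). Qed.

Lemma R1_cov1 (S : pred P) p q : R1 S p q -> covp S p. Proof. by case/and5P. Qed.
Lemma R1_cov2 (S : pred P) p q : R1 S p q -> covp S q. Proof. by case/and5P. Qed.
Lemma R2_cov1 (S : pred P) p q : R2 S p q -> covp S p. Proof. by case/and4P. Qed.
Lemma R2_cov2 (S : pred P) p q : R2 S p q -> covp S q. Proof. by case/and4P. Qed.

Lemma R1_lab p q : R1 predT p q -> lb p = lb q.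
Proof.
case/and5P => cp cq l1 l2 n.
have [_ ep] := lab_cov cp.
symmetry; apply: lab_eq => //; apply/eqP => e.
case/negP: n; apply: (r_ext H) => c; case: (eqVneq c (lb p)) => [->|nc].
  by rewrite e; apply: (r_mono H).
by rewrite -ep //; apply: (r_mono H).
Qed.

Lemma R1_coord p q : R1 predT p q -> R1 A (co p) (co q).
Proof.
move=> h; have e := R1_lab h; case/and5P: h => cp cq l1 l2 n.
have [_ ep] := lab_cov cp.
apply/and5P; split; try exact: coord_cov.
- by rewrite /coord /= -e; apply: (r_mono H).
- by rewrite /coord /= -e; apply: (r_mono H).
apply: contra n => n; apply: (r_ext H) => c; case: (eqVneq c (lb p)) => [->|nc].
  by move: n; rewrite /coord /= -e.
by rewrite -ep //; apply: (r_mono H).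
Qed.

(** The last clause of [R1] can be tested at the common label, where it is a statement about the
    coordinate pairs. *)
Lemma R1_of p q : covp predT p -> covp predT q -> lb p = lb q ->
  co p = co q \/ R1 A (co p) (co q) -> ple p.1 q.1 -> ple p.2 q.2 -> R1 predT p q.
Proof.
move=> cp cq e h l1 l2; apply/and5P; split => //; apply/negP => n.
have le := r_mono H (lb p) n.
have ca := coord_cov cq.
case: h => [e'|/and5P[_ _ _ _ /negP]]; last by apply; rewrite /coord /= -e.
have : ple (co q).2 (co q).1 by rewrite -{1}e' /coord /= -e.
by rewrite (plt_nge (cov_lt ca)).
Qed.

Lemma edge_R1 p q c : R1 A p q -> R1 predT (ed p c) (ed q c).
Proof.
move=> h; have cp := R1_cov1 h; have cq := R1_cov2 h.
case/and5P: (h) => _ _ l1 l2 _.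
have l12 : ple p.1 q.2 by apply: ple_tr l2; apply: cov_le cp.
apply: R1_of; rewrite ?edge_lab ?edge_coord ?edge_cov //; first by right.
  by apply: (r_ext H) => c'; rewrite !edge1 //; case: ifP.
by apply: (r_ext H) => c'; rewrite !edge2 //; case: ifP.
Qed.

Lemma R1_edge_ge p : covp predT p -> forall q, covp A q -> q = co p ->
  ple (ed q (lb p)).1 p.1 -> R1 predT (ed q (lb p)) p.
Proof.
move=> cp q cq e l1; have [_ ep] := lab_cov cp.
apply: R1_of => //; rewrite ?edge_lab ?edge_coord ?edge_cov //; first by left.
apply: (r_ext H) => c; rewrite edge2 //.
case: (eqVneq c (lb p)) => [->|nc]; first by rewrite plexx e plexx.
by rewrite -ep //; move: (r_mono H c l1); rewrite edge1 // /plt eq_sym nc.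
Qed.

(** The changing coordinate moves between [q.1] and [q.2], so its two values are exactly [q]. An
    index can be raised only after all larger ones, so the standard edge is the lowest parallel of
    [p] in the cube. *)
Lemma R1_cube p q : covp A q -> covp predT p -> ple q.1 p.1 -> ple p.2 q.2 ->
  co p = q /\ R1 predT (ed q (lb p)) p.
Proof.
move=> cq cp l1 l2.
have A1 := cov_l cq; have A2 := cov_r cq.
have cc := coord_cov cp.
have lo c : ple q.1 (r c p.1) by rewrite -(fixE c A1); apply: (r_mono H).
have hi c : ple (r c p.2) q.2 by rewrite -[q.2](fixE c A2); apply: (r_mono H).
have mid c f : A f -> ple q.1 f -> ple f q.2 -> f = q.1 \/ f = q.2 by move=> *; apply: (cov_mid cq).
have e : co p = q.
  have l := cov_lt cc.
  have := mid c0 (co p).1 (fix_r H _ _) (lo _) (ple_tr (pltW l) (hi _)).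
  have := mid c0 (co p).2 (fix_r H _ _) (ple_tr (lo _) (pltW l)) (hi _).
  case=> e2 [] e1.
  - by move: l; rewrite e1 e2 pltxx.
  - by move: l; rewrite e1 e2 (_ : plt _ _ = false) //; apply/negP => /pltW; rewrite (plt_nge (cov_lt cq)).
  - by rewrite (surjective_pairing (co p)) e1 e2 -surjective_pairing.
  - by move: l; rewrite e1 e2 pltxx.
split => //; apply: R1_edge_ge => //.
apply: (r_ext H) => c; rewrite edge1 //; case: ifP => // lt.
by rewrite -[q in q.2]e; apply: lab_above.
Qed.

(** If the index changed second is not below the index changed first, the two changes commute, and
    doing them in the other order gives another middle. *)
Lemma lab_swap p q : covp predT p -> covp predT q -> p.1 = q.2 -> ~~ plt (lb p) (lb q) ->
  lb p != lb q -> exists2 m, cov predT q.1 m /\ cov predT m p.2 & m != q.2.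
Proof.
case: p => g h; case: q => f g' /= cp cq e nlt ne; subst g'.
have [cap ep] := lab_cov cp; have [caq eq] := lab_cov cq.
set c := lb (g, h) in nlt ne cap ep; set c' := lb (f, g) in nlt ne caq eq.
rewrite /= in ep eq.
have efg : r c f = r c g by apply: eq.
have egh : r c' g = r c' h by apply: ep; rewrite eq_sym.
have up : forall d, r d (upd r f c (r c h)) = if d == c then r c h else r d f.
  apply: (upd_upP H); rewrite ?(fix_r H) //.
    by rewrite efg; apply: (cov_le cap).
  move=> d cd; rewrite eq; last by apply: contraNneq nlt => <-.
  rewrite ep; last by rewrite eq_sym; case/andP: cd.
  by apply: (r_inc H); apply: pltW.
set m := upd r f c (r c h) in up.
have um := up c; rewrite eqxx in um.
have [cfm lfm] : covp predT (f, m) /\ lb (f, m) = c.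
  apply: cov_of_lab; first by move=> d nd; rewrite up (negbTE nd).
  by rewrite um efg.
have [cmh lmh] : covp predT (m, h) /\ lb (m, h) = c'.
  apply: cov_of_lab; last by rewrite up eq_sym (negbTE ne) -egh.
  move=> d nd; rewrite up; case: eqP => [->//|/eqP nd']; by rewrite eq // ep.
exists m; first by [].
apply/eqP => emg; move/eqP: ne; apply.
by rewrite -/c -lfm emg.
Qed.

(** A forced middle says that the two changes cannot be exchanged. For different labels this needs
    [lb p] below [lb q], and the new value at [lb p] must not fit under the old value at [lb q]; the
    latter is the negative clause of [R1]. *)
Lemma R2_lab p q : R2 predT p q ->
  (lb p = lb q /\ R2 A (co p) (co q)) \/ (plt (lb p) (lb q) /\ R1 A (co p) (co q)).
Proof.
case/and4P => cp cq /eqP e /forallP nomid.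
have no m : cov predT q.1 m -> cov predT m p.2 -> m = q.2.
  by move=> h1 h2; apply/eqP; move: (nomid m); rewrite h1 h2.
have [cap ep] := lab_cov cp; have [caq eq] := lab_cov cq.
case: (eqVneq (lb p) (lb q)) => [el|ne].
  left; split=> //; apply/and4P; split => //.
    by rewrite /coord /= el e.
  apply/forallP => m; apply/implyP => c1; apply/implyP => c2.
  have up : forall d, r d (upd r q.1 (lb q) m) = if d == lb q then m else r d q.1.
    apply: (upd_upP H); first exact: cov_r c1.
      exact: (cov_le c1).
    move=> d ld; rewrite eq; last by rewrite eq_sym; case/andP: ld.
    rewrite -e; apply: ple_tr (lab_above cp _); last by rewrite el.
    exact: (cov_le c2).
  have umq := up (lb q); rewrite eqxx in umq.
  have [cfm _] : covp predT (q.1, upd r q.1 (lb q) m) /\ lb (q.1, upd r q.1 (lb q) m) = lb q.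
    apply: cov_of_lab; first by move=> d nd; rewrite up (negbTE nd).
    by rewrite umq.
  have [cmh _] : covp predT (upd r q.1 (lb q) m, p.2) /\ lb (upd r q.1 (lb q) m, p.2) = lb q.
    apply: cov_of_lab; last by rewrite umq -el.
    by move=> d nd; rewrite up (negbTE nd) eq // -e ep // el.
  by rewrite /coord /= -(no _ cfm cmh) umq.
right; case: (boolP (plt (lb p) (lb q))) => [lt|nlt]; last first.
  have [m [h1 h2] /eqP[]] := lab_swap cp cq e nlt ne; exact: no.
split=> //; apply/and5P; split; try exact: coord_cov.
- rewrite /coord /= e -eq //; exact: (r_inc H) (pltW lt).
- rewrite /coord /= -e ep 1?eq_sym //; exact: (r_inc H) (pltW lt).
apply/negP => bad.
have up : forall d, r d (upd r q.1 (lb p) (co p).2) = if d == lb p then (co p).2 else r d q.1.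
  apply: (upd_upP H); first exact: fix_r.
    by rewrite eq // -e; apply: (cov_le cap).
  move=> d ld; case: (eqVneq d (lb q)) => [->//|nd].
  by rewrite eq // -e; apply: lab_above.
set m := upd _ _ _ _ in up.
have um := up (lb p); rewrite eqxx in um.
have [cfm lfm] : covp predT (q.1, m) /\ lb (q.1, m) = lb p.
  apply: cov_of_lab; first by move=> d nd; rewrite up (negbTE nd).
  by rewrite um eq // -e.
have [cmh lmh] : covp predT (m, p.2) /\ lb (m, p.2) = lb q.
  apply: cov_of_lab.
    move=> d nd; rewrite up; case: eqP => [->//|/eqP nd']; by rewrite eq // -e ep.
  by rewrite up eq_sym (negbTE ne) -ep 1?eq_sym // e.
have em : m = q.2 := no _ cfm cmh.
by move/eqP: ne; apply; rewrite -lfm em; case: (q).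
Qed.
End Edges.

(** Squares count in both directions and stacked pairs in one, so that parallel edges become
    equivalent while labels are still monotone, by [R2_lab]. *)
Definition gen (P : fposet) (b : P) : rel (P * P) := fun p q =>
  [&& ple b p.1, ple b q.1 & [|| R1 predT p q, R1 predT q p | R2 predT p q]].
Definition leE (P : fposet) (b : P) : rel (P * P) := connect (gen b).
Definition over (P : fposet) (b : P) : pred (P * P) := fun p => covp predT p && ple b p.1.

Definition eqv (T : finType) (le : rel T) : rel T := fun x y => le x y && le y x.

(* Equations hold only up to the equivalence generated by the preorder [le]. *)
Record action (T : finType) (V : pred T) (le : rel T) (C : fposet) (lab : T -> C)
    (act : T -> C -> T) : Prop := Action {
  act_V : forall x c, V x -> V (act x c);
  act_lab : forall x c, V x -> lab (act x c) = c;
  act_id : forall x, V x -> eqv le (act x (lab x)) x;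
  act_act : forall x c c', V x -> eqv le (act (act x c) c') (act x c');
  act_le : forall x y c, V x -> V y -> le x y -> le (act x c) (act y c);
  lab_le : forall x y, V x -> V y -> le x y -> ple (lab x) (lab y);
  act_inc : forall x c c', V x -> ple c c' -> le (act x c) (act x c') }.

(** * The action of [C] on the edges above a fixed point *)

Section EdgeAction.
Variables (P C : fposet) (r : C -> P -> P) (c0 : C).
Hypothesis H : root r.
Local Notation A := (fixr r).
Local Notation lb := (lab r c0).
Local Notation co := (coord r c0).
Local Notation ed := (edge r).
Implicit Types (f g x y z : P) (c : C) (p q : P * P).

Lemma over_cov b p : over b p -> covp predT p. Proof. by case/andP. Qed.
Lemma over_le b p : over b p -> ple b p.1. Proof. by case/andP. Qed.

Lemma leE_refl b p : leE b p p. Proof. exact: connect0. Qed.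
Lemma leE_trans b q p p' : leE b p q -> leE b q p' -> leE b p p'. Proof. exact: connect_trans. Qed.
Lemma leE_R1 b p q : ple b p.1 -> ple b q.1 -> R1 predT p q -> leE b p q /\ leE b q p.
Proof. by move=> l1 l2 h; split; apply: connect1; rewrite /gen l1 l2 h ?orbT. Qed.
Lemma leE_R1l b p q : ple b p.1 -> ple b q.1 -> R1 predT p q -> leE b p q.
Proof. by move=> l1 l2 /(leE_R1 l1 l2)[]. Qed.
Lemma leE_R1r b p q : ple b p.1 -> ple b q.1 -> R1 predT q p -> leE b p q.
Proof. by move=> l1 l2 /(leE_R1 l2 l1)[]. Qed.
Lemma leE_R2 b p q : ple b p.1 -> ple b q.1 -> R2 predT p q -> leE b p q.
Proof. by move=> l1 l2 h; apply: connect1; rewrite /gen l1 l2 h ?orbT. Qed.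

Lemma gen_over b p q : gen b p q -> over b p && over b q.
Proof.
by case/and3P; rewrite /over => -> -> /or3P[/and3P[-> -> _]|/and3P[-> -> _]|/and3P[-> -> _]].
Qed.

Lemma leE_ind b (Q : P * P -> P * P -> Prop) p q :
  (forall p, over b p -> Q p p) -> (forall p q p', Q p q -> Q q p' -> Q p p') ->
  (forall p q, over b p -> over b q -> R1 predT p q -> Q p q /\ Q q p) ->
  (forall p q, over b p -> over b q -> R2 predT p q -> Q p q) ->
  over b p -> leE b p q -> over b q /\ Q p q.
Proof.
move=> Q0 Qt Q1 Q2 op /connectP[s]; elim: s p op => [|p' s IH] p op /=.
  by move=> _ ->; split=> //; apply: Q0.
case/andP => g pa e; have /andP[_ op'] := gen_over g.
have [oq Qp'] := IH p' op' pa e; split=> //; apply: Qt Qp'.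
by case/and3P: g => _ _ /or3P[h|h|h]; [case: (Q1 _ _ op op' h)|case: (Q1 _ _ op' op h)|apply: Q2].
Qed.

Lemma leE_lab b p q : over b p -> leE b p q -> ple (lb p) (lb q).
Proof.
move=> op h; have hh : over b q /\ ple (lb p) (lb q); last by case: hh.
apply: (leE_ind (Q := fun p q => ple (lb p) (lb q)) _ _ _ _ op h).
- by move=> *; apply: plexx.
- by move=> a b' c; apply: ple_tr.
- by move=> a b' _ _ /(R1_lab c0 H) ->; rewrite plexx.
- move=> a b' _ _ /(R2_lab c0 H)[[-> _]|[/pltW k _]] //; exact: plexx.
Qed.

Lemma edge_over b p c : covp A p -> ple b p.1 -> over b (ed p c).
Proof. by move=> cp l; rewrite /over (edge_cov c0) //= (ple_tr l) // edge_ge. Qed.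

(** For a chain u < v < w of [A] with forced middle, keep [w] above [c] and [u] at the indices not
    above [c], and let coordinate [c] run through u, v, w. The middle of the chain [F0], [F1], [F2]
    is forced again, and its edges are parallel to the standard edges of (v, w) and (u, v). *)
Lemma edge_R2 b p q c : ple b p.1 -> ple b q.1 -> R2 A p q -> leE b (ed p c) (ed q c).
Proof.
move=> l1 l2 /and4P[cp cq /eqP e /forallP no].
case: p cp e no l1 => v w; case: q cq l2 => u v' /= cq l2 cp e no l1; subst v'.
rewrite /covp /= in cp cq.
have Au := cov_l cq; have Av := cov_l cp; have Aw := cov_r cp.
have uv := cov_le cq; have vw := cov_le cp.
have uw := ple_tr uv vw.
pose F0 := (ed (u, w) c).1; pose F2 := (ed (u, w) c).2.
have inc (a1 a2 : P) : ple a1 a2 -> (forall b1 b2 : bool, (b1 -> b2) -> ple (if b1 then a2 else a1) (if b2 then a2 else a1)).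
  by move=> h [] [] // k; rewrite ?plexx //; move: (k isT).
have eF0 c' : r c' F0 = if plt c c' then w else u.
  apply: (mk_upP H (f := u)) => [d d' dd'||d] /=.
  - by apply: inc => // h; apply: plt_ple_trans dd'.
  - by move=> d; case: ifP.
  - by rewrite fixE //; case: ifP; rewrite ?plexx.
have eF2 c' : r c' F2 = if ple c c' then w else u.
  apply: (mk_upP H (f := u)) => [d d' dd'||d] /=.
  - by apply: inc => // h; apply: ple_tr dd'.
  - by move=> d; case: ifP.
  - by rewrite fixE //; case: ifP; rewrite ?plexx.
have eF1 c' : r c' (upd r F0 c v) = if c' == c then v else r c' F0.
  apply: (upd_upP H) => //; first by rewrite eF0 pltxx.
  by move=> d cd; rewrite eF0 cd.
set F1 := upd _ _ _ _ in eF1.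
have r1c : r c F1 = v by rewrite eF1 eqxx.
have [c01 l01] : covp predT (F0, F1) /\ lb (F0, F1) = c.
  apply: (cov_of_lab _ H); first by move=> d nd; rewrite eF1 (negbTE nd).
  by rewrite r1c eF0 pltxx.
have [c12 l12] : covp predT (F1, F2) /\ lb (F1, F2) = c.
  apply: (cov_of_lab _ H); last by rewrite r1c eF2 plexx.
  by move=> d nd; rewrite eF1 (negbTE nd) eF0 eF2 /plt eq_sym nd.
have co01 : co (F0, F1) = (u, v) by rewrite /coord l01 /= r1c eF0 pltxx.
have co12 : co (F1, F2) = (v, w) by rewrite /coord l12 /= r1c eF2 plexx.
have bF0 : ple b F0.
  apply: (ple_tr l2); apply: (r_ext H) => d; rewrite eF0 fixE //.
  by case: ifP; rewrite ?plexx.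
have bF1 : ple b F1 by apply: ple_tr bF0 (cov_le c01).
have R2F : R2 predT (F1, F2) (F0, F1).
  apply/and4P; split => //=; apply/forallP => m; apply/implyP => h1; apply/implyP => h2.
  have [ca1 e1] := lab_cov c0 H (p := (F0, m)) h1; have [ca2 e2] := lab_cov c0 H (p := (m, F2)) h2.
  have lm : lb (F0, m) = c.
    apply: (lab_eq _ H) => //=; apply/eqP => e.
    have ltuw := plt_ple_trans (cov_lt cq) vw.
    have lm : lb (m, F2) = c.
      by apply: (lab_eq _ H) => //=; rewrite -e eF0 eF2 pltxx plexx; case/andP: ltuw.
    move: ca2; rewrite /covp /coord lm /= -e eF0 eF2 pltxx plexx => ca2.
    case: (cov_mid ca2 Av uv vw) => k; first by case: (cov_neq cq).
    by case: (cov_neq cp).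
  rewrite /coord lm /= in ca1; rewrite lm in e1.
  have lm2 : lb (m, F2) = c.
    apply/eqP; apply: contraT => n; have k := lab_neq c0 H (p := (m, F2)) h2; move/eqP: k; case => /=.
    by rewrite -e1 //= eF0 eF2 /plt eq_sym n.
  rewrite /coord lm2 /= in ca2.
  rewrite eF0 pltxx in ca1; rewrite eF2 plexx in ca2.
  rewrite /covp /= in ca1 ca2.
  have rm : r c m = v by apply/eqP; move: (no (r c m)); rewrite /= ca1 ca2.
  apply/eqP; apply: (r_inj H) => d; rewrite eF1; case: eqP => [->//|/eqP nd].
  by rewrite -e1.
apply: (leE_trans (q := (F1, F2))).
  apply: leE_R1r => //; first exact: over_le (edge_over (p := (v, w)) c cp l1).
  have cvw : covp A (v, w) := cp.
  apply: (R1_of (c0 := c0) H c12 (edge_cov c0 H c cvw)); first (by rewrite l12 edge_lab); first by left; rewrite co12 edge_coord.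
    apply: (r_ext H) => d; rewrite (edge1 H) // eF1 eF0 /=.
    case: eqP => [->|_]; first by rewrite pltxx plexx.
    by case: ifP; rewrite ?plexx.
  apply: (r_ext H) => d; rewrite (edge2 H) // eF2 /=.
  by case: ifP; rewrite ?plexx.
apply: (leE_trans (q := (F0, F1))); first exact: leE_R2.
apply: leE_R1r => //; first exact: over_le (edge_over (p := (u, v)) c cq l2).
have cuv : covp A (u, v) := cq.
apply: (R1_of (c0 := c0) H (edge_cov c0 H c cuv) c01); first (by rewrite l01 edge_lab); first by left; rewrite co01 edge_coord.
  apply: (r_ext H) => d; rewrite (edge1 H) // eF0 /=.
  by case: ifP; rewrite ?plexx.
apply: (r_ext H) => d; rewrite (edge2 H) // eF1 eF0 /=.
case: (eqVneq d c) => [->|n]; first by rewrite !plexx.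
by rewrite /plt eq_sym n /=; case: ifP; rewrite ?plexx.
Qed.

(** Start with everything above [c] except [c'] raised: raising [c'] is the edge [j], parallel to
    the standard edge in direction [c'], and the standard edge in direction [c] is stacked on it. *)
Lemma edge_adj p c c' : covp A p -> cov predT c c' ->
  exists j, [/\ R1 predT (ed p c') j, R2 predT (ed p c) j & ple p.1 j.1].
Proof.
move=> cp cc'; have cc := cov_lt cc'.
have A1 := cov_l cp; have A2 := cov_r cp; have l12 := cov_le cp.
have ec' : c' != c by rewrite eq_sym; case/andP: cc.
pose U d := plt c d && (d != c').
have Uup d d' : ple d d' -> U d -> U d'.
  move=> dd' /andP[cd nd]; rewrite /U (plt_ple_trans cd dd') /=.
  apply/eqP => e; rewrite e in dd'.
  case: (cov_mid cc' (z := d)) => // [|e'|e']; first exact: pltW.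
    by move: cd; rewrite e' pltxx.
  by rewrite e' eqxx in nd.
have eF c1 : r c1 (mk r p.1 (fun d => if U d then p.2 else p.1)) = if U c1 then p.2 else p.1.
  apply: (mk_upP H (f := p.1)) => [d d' dd'||d] /=.
  - case: ifP => [/(Uup _ _ dd') ->|_]; first exact: plexx.
    by case: ifP; rewrite ?plexx.
  - by move=> d; case: ifP.
  - by rewrite fixE //; case: ifP; rewrite ?plexx.
set F := mk _ _ _ in eF.
have [cF lF] : covp predT (F, (ed p c).1) /\ lb (F, (ed p c).1) = c'.
  apply: (cov_of_lab _ H).
    by move=> d nd; rewrite eF (edge1 H) // /U nd andbT.
  by rewrite eF (edge1 H) // /U eqxx andbF cc.
have coF : co (F, (ed p c).1) = p.
  rewrite /coord lF /= eF (edge1 H) // /U eqxx andbF cc.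
  by case: (p).
have bF : ple p.1 F.
  apply: (r_ext H) => d; rewrite eF fixE //.
  by case: ifP; rewrite ?plexx.
exists (F, (ed p c).1); split=> //.
  apply: (R1_of (c0 := c0) H (edge_cov c0 H c' cp) cF); first (by rewrite lF edge_lab); first by left; rewrite coF edge_coord.
    apply: (r_ext H) => d; rewrite (edge1 H) // eF /=; case: ifP => [cd|_].
      rewrite /U (plt_trans cc cd) eq_sym; case/andP: cd => -> _ /=; exact: plexx.
    by case: ifP; rewrite ?plexx.
  apply: (r_ext H) => d; rewrite (edge2 H) // (edge1 H) //=; case: ifP => [cd|_].
    by rewrite (plt_ple_trans cc cd) plexx.
  by case: ifP; rewrite ?plexx.
apply/and4P; split => //=; first exact: (edge_cov c0 H c cp).
apply/forallP => m; apply/implyP => h1; apply/implyP => h2.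
have [ca1 e1] := lab_cov c0 H (p := (F, m)) h1; have [ca2 e2] := lab_cov c0 H (p := (m, (ed p c).2)) h2.
have {}e1 d : d != lb (F, m) -> r d F = r d m := e1 d.
have {}e2 d : d != lb (m, (ed p c).2) -> r d m = r d (ed p c).2 := e2 d.
have rFc : r c F = p.1 by rewrite eF /U pltxx.
have rFc' : r c' F = p.1 by rewrite eF /U eqxx andbF.
have re2 d : r d (ed p c).2 = if ple c d then p.2 else p.1 by rewrite (edge2 H).
have np : p.1 != p.2 by apply/eqP; apply: cov_neq cp.
(* The middle is forced because [c] cannot be raised before [c'] in a monotone map. *)
have lm : lb (F, m) = c'.
  apply/eqP; apply: contraT => n; rewrite eq_sym in n; exfalso.
  have lm2 : lb (m, (ed p c).2) = c'.
    apply: (lab_eq _ H) => //; rewrite -[(m, _).1]/m -[(m, _).2]/(ed p c).2.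
    by rewrite -(e1 _ n) rFc' re2 (pltW cc).
  have e2c : r c m = p.2 by rewrite e2 ?re2 ?plexx // lm2 eq_sym.
  have lm1 : lb (F, m) = c by apply: (lab_eq _ H) => //; rewrite /= e2c rFc.
  have : ple (r c m) (r c' m) by apply: (r_inc H); apply: pltW.
  by rewrite e2c -(e1 c') // rFc' (plt_nge (cov_lt cp)).
apply/eqP; apply: (r_inj H) => d; rewrite (edge1 H) //.
case: (eqVneq d c') => [->|nd]; last by rewrite -e1 ?lm // eF /U nd andbT.
rewrite cc; move: ca1; rewrite /coord lm /= rFc' => ca1.
have hi : ple (r c' m) p.2.
  have := r_mono H c' (cov_le h2); rewrite re2 (pltW cc) //.
case: (cov_mid cp (fix_r H c' m) (cov_le ca1) hi) => // k.
by move: (cov_neq ca1); rewrite k.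
Qed.

Lemma edge_inc_cov b p c c' : covp A p -> ple b p.1 -> cov predT c c' ->
  leE b (ed p c) (ed p c').
Proof.
move=> cp l /(edge_adj cp)[j [h1 h2 lj]].
have oe d := edge_over d cp l; have bj := ple_tr l lj.
apply: (leE_trans (q := j)); first exact: leE_R2 (over_le (oe c)) bj h2.
exact: leE_R1r bj (over_le (oe c')) h1.
Qed.

Lemma edge_inc b p c c' : covp A p -> ple b p.1 -> ple c c' -> leE b (ed p c) (ed p c').
Proof.
move=> cp l; apply: (cov_ind_up (S := predT) (Q := fun d => leE b (ed p c) (ed p d))) => //.
  exact: leE_refl.
by move=> y z _ h cyz; apply: leE_trans h _; apply: edge_inc_cov.
Qed.

(** As [b] is a constant below [p], there is an edge below both [p] and the standard edge: the
    changing pair at [c], its upper value above [c], and [b] at the remaining indices. This is where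
    [b] has to be fixed by [r]. *)
Lemma edge_base b p : A b -> over b p ->
  leE b p (ed (co p) (lb p)) /\ leE b (ed (co p) (lb p)) p.
Proof.
move=> Ab /andP[cp l]; have [ca ep] := lab_cov c0 H cp.
set c := lb p in ca ep *; have cc := coord_cov c0 H cp.
have lc : ple b (r c p.1) by rewrite -(fixE c Ab); apply: (r_mono H).
have lx := cov_le cc.
rewrite /= in lx.
set x := r c p.1 in lc; set y := r c p.2.
have xy : ple x y by apply: (r_mono H); apply: cov_le cp.
have eF d : r d (mk r b (fun d => if plt c d then y else if d == c then x else b)) =
    if plt c d then y else if d == c then x else b.
  apply: (mk_upP H (f := b)) => [d1 d2 dd||d1].
  - case: ifP => [cd|ncd]; first by rewrite (plt_ple_trans cd dd) plexx.
    case: eqP => [e|n].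
      case: ifP => // ncd2; case: eqP => [_|n2]; first exact: plexx.
      by move: ncd2; rewrite /plt -e dd andbT; move/eqP; rewrite e => k; case: n2.
    case: ifP => [_|_]; first exact: ple_tr xy.
    by case: ifP => _ //; apply: plexx.
  - by move=> d1; case: ifP => _; [apply: fix_r|case: ifP => _ //; apply: fix_r].
  - rewrite fixE //; case: ifP => _; first exact: ple_tr xy.
    by case: ifP => _ //; apply: plexx.
set F := mk _ _ _ in eF.
have eG d : r d (upd r F c y) = if d == c then y else r d F.
  apply: (upd_upP H); first exact: fix_r.
    by rewrite eF pltxx eqxx.
  by move=> d' cd; rewrite eF cd plexx.
set G := upd _ _ _ _ in eG.
have Fc : r c F = x by rewrite eF pltxx eqxx.
have Gc : r c G = y by rewrite eG eqxx.
have [cF lF] : covp predT (F, G) /\ lb (F, G) = c.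
  apply: (cov_of_lab _ H); first by move=> d nd; rewrite eG (negbTE nd).
  by rewrite Fc Gc.
have coF : co (F, G) = co p by rewrite /coord lF /= Fc Gc.
have bF : ple b F.
  apply: (r_ext H) => d; rewrite fixE // eF; case: ifP => _; first exact: ple_tr xy.
  by case: ifP => _ //; apply: plexx.
have oe := edge_over c cc lc.
have h1 : R1 predT (F, G) p.
  apply: (R1_of (c0 := c0) H cF cp); first (by []); first by left.
    apply: (r_ext H) => d; rewrite eF; case: ifP => [cd|_].
      exact: (lab_above H cp).
    case: eqP => [->|_]; first exact: plexx.
    by rewrite -(fixE d Ab); apply: (r_mono H).
  apply: (r_ext H) => d; rewrite eG; case: eqP => [->|/eqP n]; first exact: plexx.
  rewrite eF (negbTE n); case: ifP => [cd|_].
    by rewrite -ep //; apply: (lab_above H cp).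
  by rewrite -(fixE d Ab); apply: (r_mono H); apply: ple_tr l (cov_le cp).
have h2 : R1 predT (F, G) (ed (co p) c).
  apply: (R1_of (c0 := c0) H cF (edge_cov c0 H c cc)); first (by rewrite lF edge_lab); first by left; rewrite coF edge_coord.
    apply: (r_ext H) => d; rewrite (edge1 H) // eF /=; case: ifP => _; first exact: plexx.
    by case: ifP => _ //; apply: plexx.
  apply: (r_ext H) => d; rewrite (edge2 H) // eG eF /=.
  case: eqP => [->|/eqP n]; first by rewrite plexx plexx.
  rewrite /plt eq_sym n /=; case: ifP => _; first exact: plexx.
  exact: lc.
have bF1 : ple b (F, G).1 by [].
have [a1 a2] := leE_R1 bF1 l h1.
have [b1 b2] := leE_R1 bF1 (over_le oe) h2.
by split; [apply: leE_trans a2 b1|apply: leE_trans b2 a1].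
Qed.

Lemma edge_action b : A b ->
  action (over b) (leE b) lb (fun p c => ed (co p) c).
Proof.
move=> Ab.
have cV p : over b p -> covp A (co p) /\ ple b (co p).1.
  by case/andP => cp l; split; [apply: coord_cov|apply: coord_ge].
split.
- by move=> p c /cV[cp l]; apply: edge_over.
- by move=> p c /cV[cp l]; rewrite edge_lab.
- by move=> p op; have [h1 h2] := edge_base Ab op; rewrite /eqv h1 h2.
- by move=> p c c' /cV[cp l]; rewrite edge_coord // /eqv leE_refl.
- move=> p q c op _ h; have hh : over b q /\ leE b (ed (co p) c) (ed (co q) c); last by case: hh.
  apply: (leE_ind (Q := fun p q => leE b (ed (co p) c) (ed (co q) c)) _ _ _ _ op h).
  + by move=> *; apply: leE_refl.
  + by move=> a a' a''; apply: leE_trans.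
  + move=> a a' /cV[ca la] /cV[ca' la'] k; apply: leE_R1; try exact: over_le (edge_over c _ _).
    by apply: (edge_R1 c0 H); apply: R1_coord.
  + move=> a a' /cV[ca la] /cV[ca' la'] /(R2_lab c0 H)[[_ k]|[_ k]]; first exact: edge_R2.
    apply: leE_R1l; try exact: over_le (edge_over c _ _).
    exact: (edge_R1 c0 H).
- by move=> p q op _; apply: leE_lab.
- by move=> p c c' /cV[cp l]; apply: edge_inc.
Qed.
End EdgeAction.

(** * Two actions on a preorder *)

Definition indec (C : fposet) : Prop :=
  forall X Y : fposet, iso C (prod_poset X Y) -> #|X| = 1 \/ #|Y| = 1.

Section Strict.
Variables (T : finType) (V : pred T) (le : rel T) (C D : fposet).
Variables (gam : T -> C) (aC : T -> C -> T) (del : T -> D) (aD : T -> D -> T).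
Hypothesis le_refl : forall x, le x x.
Hypothesis le_tr : forall y x z, le x y -> le y z -> le x z.
Arguments le_tr [y x z].
Hypothesis HC : action V le gam aC.
Hypothesis HD : action V le del aD.
Local Notation eq := (eqv le).
Implicit Types (x y z w : T) (c : C) (d : D).

Lemma eqv_sym x y : eq x y -> eq y x.
Proof. by rewrite /eqv andbC. Qed.
Lemma eqv_tr y x z : eq x y -> eq y z -> eq x z.
Proof. by case/andP => a b /andP[c d]; rewrite /eqv (le_tr a c) (le_tr d b). Qed.
Lemma eqv_le x y : eq x y -> le x y. Proof. by case/andP. Qed.
Lemma eqv_ge x y : eq x y -> le y x. Proof. by case/andP. Qed.

Lemma eqv_lab x y : V x -> V y -> eq x y -> gam x = gam y.
Proof. by move=> vx vy /andP[a b]; apply: ple_as; apply: (lab_le HC). Qed.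

Lemma eqv_act x y c : V x -> V y -> eq x y -> eq (aC x c) (aC y c).
Proof. by move=> vx vy /andP[a b]; rewrite /eqv !(act_le HC). Qed.

(** Moving back along the label undoes the move up to equivalence, and the difference of labels is
    absorbed by [act_inc]. *)
Lemma le_of_act x y c : V x -> V y -> ple (gam x) (gam y) -> le (aC x c) (aC y c) -> le x y.
Proof.
move=> vx vy h k.
apply: le_tr (eqv_ge (act_id HC vx)) _.
apply: le_tr (eqv_le (act_id HC vy)).
apply: (le_tr (y := aC y (gam x))); last exact: (act_inc HC).
have := act_le HC (gam x) (act_V HC c vx) (act_V HC c vy) k.
move=> k'; apply: le_tr (eqv_le (act_act HC _ _ vy)).
by apply: le_tr k'; apply: eqv_ge (act_act HC _ _ vx).
Qed.
End Strict.

Section Strict2.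
Variables (T : finType) (V : pred T) (le : rel T) (C D : fposet).
Variables (gam : T -> C) (aC : T -> C -> T) (del : T -> D) (aD : T -> D -> T).
Hypothesis le_refl : forall x, le x x.
Hypothesis le_tr : forall y x z, le x y -> le y z -> le x z.
Arguments le_tr [y x z].
Hypothesis HC : action V le gam aC.
Hypothesis HD : action V le del aD.
Local Notation eq := (eqv le).
Implicit Types (x y z w : T) (c : C) (d : D).
Local Notation eq_tr := (eqv_tr (@le_tr)).
Local Notation eq_sym' := (@eqv_sym _ le _ _).

(** Same orbit under [D]. Orbit and label [del] serve as two coordinates of an element; [mix] takes
    the orbit of its first argument and the label of its second. *)
Definition lamE x y := [forall d, eq (aD x d) (aD y d)].
Definition mix x y := aD x (del y).

Lemma mix_V x y : V x -> V (mix x y). Proof. exact: (act_V HD). Qed.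
Lemma mix_del x y : V x -> del (mix x y) = del y. Proof. exact: (act_lab HD). Qed.
Lemma mix_lam x y : V x -> lamE (mix x y) x.
Proof. by move=> vx; apply/forallP => d; apply: (act_act HD). Qed.
Lemma lamE_sym x y : lamE x y -> lamE y x.
Proof. by move/forallP => h; apply/forallP => d; apply: eq_sym'. Qed.
Lemma lamE_tr y x z : lamE x y -> lamE y z -> lamE x z.
Proof. by move/forallP => h /forallP k; apply/forallP => d; apply: eq_tr (k d). Qed.
Lemma eq_lamE x y : V x -> V y -> eq x y -> lamE x y.
Proof. by move=> vx vy e; apply/forallP => d; apply: (eqv_act HD). Qed.
Lemma lam_eq x y : V x -> V y -> lamE x y -> del x = del y -> eq x y.
Proof.
move=> vx vy /forallP h e; apply: eq_tr (act_id HD vy); apply: eq_tr (eq_sym' (act_id HD vx)) _.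
by rewrite e.
Qed.

Section Fiber.
Variable x : T.
Hypothesis vx : V x.
(** The [C]-orbit of [x], closed under equivalence. *)
Definition fiber : pred T := fun z => V z && [forall c, eq (aC z c) (aC x c)].

Lemma fiberP z : reflect (V z /\ forall c, eq (aC z c) (aC x c)) (fiber z).
Proof.
by apply: (iffP andP) => -[v h]; split=> //; [move/forallP: h|apply/forallP].
Qed.
Lemma fiber_V z : fiber z -> V z. Proof. by case/fiberP. Qed.
Lemma fiber_act c : fiber (aC x c).
Proof. by apply/fiberP; split; [apply: (act_V HC)|move=> c'; apply: (act_act HC)]. Qed.
Lemma fiber_eq z : fiber z -> eq (aC x (gam z)) z.
Proof. by case/fiberP => vz h; apply: eq_tr (act_id HC vz); apply: eq_sym'. Qed.
Lemma fiber_congr z w : V w -> fiber z -> eq w z -> fiber w.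
Proof.
move=> vw /fiberP[vz h] e; apply/fiberP; split=> // c.
by apply: eq_tr (h c); apply: (eqv_act HC).
Qed.

Lemma fiber_convex z w z' : fiber z -> V w -> fiber z' -> le z w -> le w z' -> fiber w.
Proof.
move=> /fiberP[vz h] vw /fiberP[vz' h'] zw wz'; apply/fiberP; split=> // c; apply/andP; split.
  by apply: le_tr (eqv_le (h' c)); apply: (act_le HC).
by apply: le_tr (eqv_ge (h c)) _; apply: (act_le HC).
Qed.

(** Three corners of a square in the coordinates orbit and label determine the fourth, [w]. If [z1]
    and [z2] lie on opposite sides of [z], then [w] lies between them and convexity applies. If both
    lie above [z], the member of the fiber with the [C]-label of [w] is below [w] but above [z1] and
    [z2], which give [w] its orbit and its label; so it is equivalent to [w]. The last case is
    dual. *)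
Lemma fiber_step z z1 z2 : fiber z -> fiber z1 -> fiber z2 -> del z1 = del z -> le z z1 || le z1 z ->
  lamE z2 z -> le z z2 || le z2 z -> fiber (mix z1 z2).
Proof.
move=> Sz S1 S2 e1 k1 l2 k2.
have vz := fiber_V Sz; have v1 := fiber_V S1; have v2 := fiber_V S2.
have vw : V (mix z1 z2) by apply: mix_V.
have id1 : eq (aD z1 (del z)) z1 by rewrite -e1; apply: (act_id HD).
have id2 : eq (aD z (del z2)) z2.
  by apply: eq_tr (act_id HD v2); move/forallP: (lamE_sym l2); apply.
set w := mix z1 z2 in vw *.
have up (a b : T) (va : V a) : ple (del a) (del b) -> le (aD z1 (del a)) (aD z1 (del b)).
  by move=> h; apply: (act_inc HD).
have [m1 m2] : (le z z2 -> le z1 w) /\ (le z2 z -> le w z1).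
  split=> h; have h' := lab_le HD _ _ h.
    by apply: le_tr (eqv_ge id1) _; apply: (act_inc HD) => //; apply: h'.
  by apply: le_tr (eqv_le id1); apply: (act_inc HD) => //; apply: h'.
have [n1 n2] : (le z z1 -> le z2 w) /\ (le z1 z -> le w z2).
  split=> h; first by apply: le_tr (eqv_ge id2) _; apply: (act_le HD).
  by apply: le_tr (eqv_le id2); apply: (act_le HD).
have vx' := fiber_V (fiber_act (gam w)).
have lw : lamE w z1 by apply: mix_lam.
have dw : del w = del z2 by apply: mix_del.
have fib y : fiber y -> eq (aC x (gam w)) (aC y (gam w)) by case/fiberP => _ h; apply: eq_sym'.
case/orP: k1 => k1; case/orP: k2 => k2.
- have a1 := m1 k2; have a2 := n1 k1.
  apply: (fiber_congr vw (fiber_act (gam w))); apply/andP; split; last first.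
    apply: le_tr (eqv_le (fib _ S1)) _; apply: le_tr (eqv_le (act_id HC vw)).
    exact: (act_le HC).
  have b y : fiber y -> le y w -> le y (aC x (gam w)).
    move=> Sy h; apply: le_tr (eqv_ge (fiber_eq Sy)) _; apply: (act_inc HC) => //.
    by apply: (lab_le HC) => //; apply: fiber_V.
  apply: (le_of_act (@le_tr) HD (c := del z)) => //.
    by rewrite dw; apply: (lab_le HD) => //; apply: b.
  move/forallP: lw => /(_ (del z))/eqv_le h; apply: le_tr h _.
  by apply: (act_le HD) => //; apply: b.
- exact: fiber_convex S2 vw S1 (n1 k1) (m2 k2).
- exact: fiber_convex S1 vw S2 (m1 k2) (n2 k1).
- have a1 := m2 k2; have a2 := n2 k1.
  apply: (fiber_congr vw (fiber_act (gam w))); apply/andP; split.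
    apply: le_tr (eqv_ge (fib _ S1)); apply: le_tr (eqv_ge (act_id HC vw)) _.
    exact: (act_le HC).
  have b y : fiber y -> le w y -> le (aC x (gam w)) y.
    move=> Sy h; apply: le_tr (eqv_le (fiber_eq Sy)); apply: (act_inc HC) => //.
    by apply: (lab_le HC) => //; apply: fiber_V.
  apply: (le_of_act (@le_tr) HD (c := del z)) => //.
    by rewrite dw; apply: (lab_le HD) => //; apply: b.
  move/forallP: lw => /(_ (del z))/eqv_ge h; apply: le_tr h.
  by apply: (act_le HD) => //; apply: b.
Qed.

Definition corner c c' := fiber (mix (aC x c) (aC x c')).

Lemma corner_refl c : corner c c.
Proof.
have Sc := fiber_act c; have v := fiber_V Sc.
by apply: fiber_congr Sc (act_id HD v); apply: mix_V.
Qed.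

Lemma corner_cmp c c' : cmp c c' -> corner c c'.
Proof.
have Sc := fiber_act c; have Sc' := fiber_act c'; have v := fiber_V Sc; have v' := fiber_V Sc'.
case/orP => h; have k := act_inc HC vx h; have k' := lab_le HD _ _ k.
  apply: (fiber_convex Sc _ Sc'); first exact: mix_V.
    by apply: le_tr (eqv_ge (act_id HD v)) _; apply: (act_inc HD) => //; apply: k'.
  by apply: le_tr (eqv_le (act_id HD v')); apply: (act_le HD).
apply: (fiber_convex Sc' _ Sc); first exact: mix_V.
  by apply: le_tr (eqv_ge (act_id HD v')) _; apply: (act_le HD).
by apply: le_tr (eqv_le (act_id HD v)); apply: (act_inc HD) => //; apply: k'.
Qed.

Lemma corner_step c1 c2 c1' c2' : corner c1 c2 -> corner c1' c2 -> corner c1 c2' ->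
  cmp c1 c1' -> cmp c2 c2' -> corner c1' c2'.
Proof.
move=> g g1 g2 h1 h2.
have v c := act_V HC c vx.
have Sm := @fiber_step _ _ _ g g1 g2.
have vm1 : V (mix (aC x c1') (aC x c2)) by apply: mix_V.
apply: (fiber_congr _ (Sm _ _ _ _)).
- exact: mix_V.
- by rewrite !mix_del.
- case/orP: h1 => h1; [apply/orP; left|apply/orP; right]; apply: (act_le HD) => //; exact: (act_inc HC).
- apply: lamE_tr (lamE_sym (mix_lam _ _)) => //; exact: mix_lam.
- case/orP: h2 => h2; [apply/orP; left|apply/orP; right]; apply: (act_inc HD) => //;
  apply: (lab_le HD) => //; exact: (act_inc HC).
- rewrite {2}/mix mix_del //; apply: eq_sym'; exact: (act_act HD).
Qed.

(** Induction on the distance: the corner at distance n + 2 completes a square whose other corners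
    have distances n, n + 1 and n + 1. *)
Lemma corner_path (p : nat -> C) m : (forall i, i < m -> cmp (p i) (p i.+1)) ->
  forall n i, i + n <= m -> corner (p i) (p (i + n)) /\ corner (p (i + n)) (p i).
Proof.
move=> hp n; have [k] := ubnP n; elim: k n => // k IH n nk i.
have sym c c' : cmp c c' -> cmp c' c by rewrite /cmp orbC.
case: n nk => [|[|n]] nk im.
- by rewrite addn0; split; apply: corner_refl.
- rewrite addn1 in im *; have h := hp i im; split; apply: corner_cmp => //; exact: sym.
have le1 : i.+1 + n <= m by rewrite addSnnS; apply: leq_trans im; rewrite leq_add2l.
have le2 : i + n.+1 <= m by apply: leq_trans im; rewrite leq_add2l.
have le3 : i.+1 + n.+1 <= m by rewrite addSnnS.
have [a1 a2] := IH n (ltnW (nk : n.+1 < k)) i.+1 le1.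
have [b1 b2] := IH n.+1 nk i le2.
have [c1 c2] := IH n.+1 nk i.+1 le3.
have h1 : cmp (p i) (p i.+1) by apply: hp; apply: leq_trans le3; rewrite addSn ltnS leq_addr.
have h2 : cmp (p (i + n.+1)) (p (i + n.+2)) by rewrite [i + n.+2]addnS; apply: hp; rewrite -addnS.
rewrite !addSnnS in a1 a2 c1 c2.
split.
  exact: corner_step a1 b1 c1 (sym _ _ h1) h2.
exact: corner_step a2 c2 b2 h2 (sym _ _ h1).
Qed.

Hypothesis Ccon : connected C.

Lemma corner_all c c' : corner c c'.
Proof.
have /connectP[s ps ->] := Ccon c c'.
pose p i := nth c (c :: s) i.
have [|g _] := @corner_path p (size s) _ (size s) 0 (leqnn _).
  by move=> i im; apply: (pathP c ps).
by rewrite (last_nth c); move: g; rewrite add0n.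
Qed.

Hypothesis Cind : indec C.

(* The fiber is closed under [mix] (a path of squares is filled one square at a time), so
   [g1] and [g2] below split C as a product; indecomposability kills one factor. *)
Lemma strict_fiber : (forall c c', del (aC x c) = del (aC x c')) \/
  (forall c c', lamE (aC x c) (aC x c')).
Proof.
case: (pickP (@predT C)) => [c0 _|no]; last by left=> c; have := no c.
pose y c := aC x c.
have vy c : V (y c) by apply: (act_V HC).
have gy c : gam (y c) = c by apply: (act_lab HC).
have yS z : fiber z -> eq (y (gam z)) z by apply: fiber_eq.
pose C1 : pred C := fun c => del (y c) == del (y c0).
pose C2 : pred C := fun c => lamE (y c) (y c0).
pose g1 c := gam (mix (y c) (y c0)).
pose g2 c := gam (mix (y c0) (y c)).
have e1 c : eq (y (g1 c)) (mix (y c) (y c0)) by apply/yS/corner_all.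
have e2 c : eq (y (g2 c)) (mix (y c0) (y c)) by apply/yS/corner_all.
have vm c c' : V (mix (y c) (y c')) by apply: mix_V.
have d1 c : del (y (g1 c)) = del (y c0).
  by rewrite (eqv_lab HD _ _ (e1 c)) // mix_del.
have d2 c : del (y (g2 c)) = del (y c).
  by rewrite (eqv_lab HD _ _ (e2 c)) // mix_del.
have l1 c : lamE (y (g1 c)) (y c) by apply: lamE_tr (eq_lamE _ _ (e1 c)) (mix_lam _ _).
have l2 c : lamE (y (g2 c)) (y c0) by apply: lamE_tr (eq_lamE _ _ (e2 c)) (mix_lam _ _).
have in1 c : C1 (g1 c) by apply/eqP.
have in2 c : C2 (g2 c) by apply: l2.
pose f (c : C) : prod_poset (sub_poset C1) (sub_poset C2) :=
  (exist (fun z : C => is_true (C1 z)) _ (in1 c), exist (fun z : C => is_true (C2 z)) _ (in2 c)).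
pose h (u : prod_poset (sub_poset C1) (sub_poset C2)) : C := gam (mix (y (val u.1)) (y (val u.2))).
have eqy c c' : eq (y c) (y c') -> c = c'.
  by move/(eqv_lab HC (vy _) (vy _)); rewrite !gy.
have fh u : f (h u) = u.
  case: u => [[c1 i1] [c2 i2]]; rewrite /f /h /=.
  set c := gam _; have ec : eq (y c) (mix (y c1) (y c2)) by apply/yS/corner_all.
  have lc : lamE (y c) (y c1) by apply: lamE_tr (eq_lamE _ _ ec) (mix_lam _ _).
  have dc : del (y c) = del (y c2) by rewrite (eqv_lab HD _ _ ec) // mix_del.
  have E1 : g1 c = c1.
    apply: eqy; apply: lam_eq => //; first exact: lamE_tr (l1 c) lc.
    by rewrite d1 (eqP i1).
  have E2 : g2 c = c2.
    apply: eqy; apply: lam_eq => //; last by rewrite d2.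
    exact: lamE_tr (l2 c) (lamE_sym i2).
  by congr (_, _); apply: val_inj.
have hf c : h (f c) = c.
  rewrite /h /f /=; apply: eqy.
  apply: eq_tr (yS _ (corner_all _ _)) _.
  apply: lam_eq => //; last by rewrite mix_del // d2.
  exact: lamE_tr (mix_lam _ _) (l1 c).
have mono c c' : ple c c' -> ple (g1 c) (g1 c') /\ ple (g2 c) (g2 c').
  move=> cc'; have k := act_inc HC vx cc'.
  split; apply: (lab_le HC) => //; first exact: (act_le HD).
  by apply: (act_inc HD) => //; apply: (lab_le HD).
have iso12 : iso C (prod_poset (sub_poset C1) (sub_poset C2)).
  exists f; split; first by exists h.
  move=> c c'; apply/idP/idP; first by case/mono => a b; apply/andP; split.
  case/andP => a b; rewrite -[c]gy -[c']gy; apply: (lab_le HC) => //.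
  apply: (le_of_act (@le_tr) HD (c := del (y c))) => //.
    rewrite -[X in ple X _]d2 -[X in ple _ X]d2; apply: (lab_le HD) => //; exact: (act_inc HC).
  move/forallP: (l1 c) => /(_ (del (y c)))/eqv_ge k; apply: le_tr k _.
  move/forallP: (l1 c') => /(_ (del (y c)))/eqv_le k; apply: le_tr k.
  by apply: (act_le HD) => //; apply: (act_inc HC).
have single (Q : fposet) (a b : Q) : #|Q| = 1 -> a = b.
  by move=> k; have /fintype1P[z hz] : #|Q| == 1 by [rewrite k]; rewrite (hz a) (hz b).
case: (Cind iso12) => k.
  right=> c c'; have := single _ (f c).1 (f c').1 k => /(congr1 val) /= e.
  by apply: lamE_tr (lamE_sym (l1 c)) _; rewrite e.
left=> c c'; have := single _ (f c).2 (f c').2 k => /(congr1 val) /= e.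
by rewrite -/(y c) -/(y c') -d2 e d2.
Qed.
End Fiber.
End Strict2.

(** Going down from the top: everything strictly above [d] is fixed, so if [f d] were strictly above
    [d], then [f] would take the same value at [d] and at [f d]. *)
Lemma inflationary_inj (D : fposet) (f : D -> D) : injective f -> (forall d, ple d (f d)) ->
  forall d, f d = d.
Proof.
move=> fi h d; have [n] := ubnP #|[set z | ple d z]|.
elim: n d => // n IH d; rewrite ltnS => le_n.
case: (ple_eqVlt (h d)) => [e|lt]; first by rewrite -e.
apply: fi; apply: IH; apply: leq_trans le_n; apply: proper_card; apply/properP; split.
  by apply/subsetP => z; rewrite !inE; apply: ple_tr; apply: pltW.
by exists d; rewrite !inE ?plexx ?(plt_nge lt).
Qed.

(** Two distinct points are required because a one-point poset satisfies [indec]. *)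
Definition factor (C : fposet) : Prop :=
  [/\ connected C, indec C & exists c c' : C, c != c'].

Section Types.
Variables (T : finType) (V : pred T) (le : rel T) (C D : fposet).
Variables (gam : T -> C) (aC : T -> C -> T) (del : T -> D) (aD : T -> D -> T).
Hypothesis le_refl : forall x, le x x.
Hypothesis le_tr : forall y x z, le x y -> le y z -> le x z.
Arguments le_tr [y x z].
Hypothesis HC : action V le gam aC.
Hypothesis HD : action V le del aD.
Hypotheses (fC : factor C) (fD : factor D).
Let Ccon : connected C. Proof. by case: fC. Qed.
Let Cind : indec C. Proof. by case: fC. Qed.
Let Cbig : exists c c' : C, c != c'. Proof. by case: fC. Qed.
Let Dcon : connected D. Proof. by case: fD. Qed.
Let Dind : indec D. Proof. by case: fD. Qed.
Let Dbig : exists d d' : D, d != d'. Proof. by case: fD. Qed.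
Local Notation eq := (eqv le).
Implicit Types (x y z w : T) (c : C) (d : D).

Definition type_u x := (forall c, del (aC x c) = del x) /\ (forall d, gam (aD x d) = gam x).
Definition type_m x := (forall c, eq (aC x c) (aD x (del (aC x c)))) /\
  (forall d, eq (aD x d) (aC x (gam (aD x d)))).

Let gC x c : V x -> gam (aC x c) = c := fun v => act_lab HC c v.
Let gD x d : V x -> del (aD x d) = d := fun v => act_lab HD d v.
Let vC x c : V x -> V (aC x c) := fun v => act_V HC c v.
Let vD x d : V x -> V (aD x d) := fun v => act_V HD d v.
Let eqg x y (vx : V x) (vy : V y) (e : eq x y) : gam x = gam y := eqv_lab HC vx vy e.
Let eqd x y (vx : V x) (vy : V y) (e : eq x y) : del x = del y := eqv_lab HD vx vy e.

(** [strict_fiber] for each action leaves four combinations. In a mixed one, an orbit along which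
    the other label is constant would contain the whole orbit of the other action, so that other
    poset would have a single point. *)
Lemma types x : V x -> type_u x \/ type_m x.
Proof.
move=> vx.
have U1 : (forall c c', del (aC x c) = del (aC x c')) -> forall c, del (aC x c) = del x.
  by move=> h c; rewrite (h c (gam x)); apply: eqd (act_id HC vx); auto.
have U2 : (forall d d', gam (aD x d) = gam (aD x d')) -> forall d, gam (aD x d) = gam x.
  by move=> h c; rewrite (h c (del x)); apply: eqg (act_id HD vx); auto.
have M1 : (forall c c', lamE le aD (aC x c) (aC x c')) -> forall c, eq (aC x c) (aD x (del (aC x c))).
  move=> h c; have v := vC c vx.
  apply: (lam_eq le_tr HD) => //; [exact: vD| |by rewrite gD].
  apply: (lamE_tr le_tr (h c (gam x))).
  apply: (lamE_tr le_tr (eq_lamE HD _ _ (act_id HC vx))) => //; first exact: vC.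
  by apply/forallP => d; apply: eqv_sym; apply: (act_act HD).
have M2 : (forall d d', lamE le aC (aD x d) (aD x d')) -> forall d, eq (aD x d) (aC x (gam (aD x d))).
  move=> h c; have v := vD c vx.
  apply: (lam_eq le_tr HC) => //; [exact: vC| |by rewrite gC].
  apply: (lamE_tr le_tr (h c (del x))).
  apply: (lamE_tr le_tr (eq_lamE HC _ _ (act_id HD vx))) => //; first exact: vD.
  by apply/forallP => d; apply: eqv_sym; apply: (act_act HC).
have [c1 [c2 /eqP nc]] := Cbig; have [d1 [d2 /eqP nd]] := Dbig.
case: (strict_fiber le_tr HC HD vx Ccon Cind) => [/U1 u1|/M1 m1];
case: (strict_fiber le_tr HD HC vx Dcon Dind) => [/U2 u2|/M2 m2]; [by left| | |by right].
  case: nd; have := eqd (vD d1 vx) (vC _ vx) (m2 d1); have := eqd (vD d2 vx) (vC _ vx) (m2 d2).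
  by rewrite !u1 !gD // => -> ->.
case: nc; have := eqg (vC c1 vx) (vD _ vx) (m1 c1); have := eqg (vC c2 vx) (vD _ vx) (m1 c2).
by rewrite !u2 !gC // => -> ->.
Qed.

Lemma sigK x : V x -> type_m x -> cancel (fun c => del (aC x c)) (fun d => gam (aD x d)).
Proof. by move=> v [m1 m2] c; rewrite -(eqg _ _ (m1 c)) ?gC //; [apply: vC|apply: vD]. Qed.
Lemma sigK' x : V x -> type_m x -> cancel (fun d => gam (aD x d)) (fun c => del (aC x c)).
Proof. by move=> v [m1 m2] c; rewrite -(eqd _ _ (m2 c)) ?gD //; [apply: vD|apply: vC]. Qed.

Lemma sig_le x c c' : V x -> type_m x -> ple (del (aC x c)) (del (aC x c')) -> ple c c'.
Proof.
move=> v m h; rewrite -(sigK v m c) -(sigK v m c'); apply: (lab_le HC); try exact: vD.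
exact: (act_inc HD).
Qed.

Lemma ty_of_const x c : V x -> (forall c', del (aC x c') = del (aC x c)) -> type_u x.
Proof.
move=> v h; case: (types v) => // m; have [c1 [c2 /eqP nc]] := Cbig; case: nc.
by rewrite -(sigK v m c1) -(sigK v m c2) /= h [in RHS]h.
Qed.

Lemma tyu_aC x c : V x -> type_u x -> type_u (aC x c).
Proof.
move=> v [u1 u2]; apply: (@ty_of_const _ c); first exact: vC.
move=> c'; have e k : del (aC (aC x c) k) = del (aC x k).
  by apply: eqd (act_act HC _ _ v); apply: vC => //; apply: vC.
by rewrite !e !u1.
Qed.

Lemma tym_aC x c : V x -> type_m x -> type_m (aC x c).
Proof.
move=> v m; case: (types (vC c v)) => // -[u1 u2].
have e k : del (aC (aC x c) k) = del (aC x k).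
  by apply: eqd (act_act HC _ _ v); apply: vC => //; apply: vC.
have [c1 [c2 /eqP nc]] := Cbig; case: nc.
by rewrite -(sigK v m c1) -(sigK v m c2) /= -!e !u1.
Qed.

(** For two elements of type m, the bijection of [C] with [D] given by the larger one, composed with
    the inverse of the other, is an inflationary injection of [D], hence the identity. For mixed
    types the comparison forces all of [C] onto the one index [cs]. *)
Lemma type_le x y : V x -> V y -> le x y ->
  (type_u x /\ type_u y) \/ [/\ type_m x, type_m y & forall c, del (aC x c) = del (aC y c)].
Proof.
move=> vx vy h.
have hC c : le (aC x c) (aC y c) by apply: (act_le HC).
have hd c : ple (del (aC x c)) (del (aC y c)) by apply: (lab_le HD); auto.
have [c1 [c2 /eqP nc]] := Cbig.
case: (types vx) => tx; case: (types vy) => ty; [by left| | |].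
- case: nc; set cs := gam (aD y (del x)).
  have sc : del (aC y cs) = del x by apply: sigK'.
  suff P c : c = cs by rewrite (P c1) (P c2).
  apply: ple_as; last first.
    by apply: (sig_le vy ty); rewrite sc -(proj1 tx c).
  rewrite -[c](gC c vx) /cs; apply: (lab_le HC); [exact: vC|exact: vD|].
  apply: le_tr (eqv_ge (act_id HD (vC c vx))) _; rewrite (proj1 tx c).
  apply: (le_tr (y := aD (aC y c) (del x))); first by apply: (act_le HD) => //; apply: vC.
  apply: (le_tr (y := aD (aD y (del (aC y c))) (del x))).
    by apply: (act_le HD); [exact: vC|exact: vD|apply: eqv_le (proj1 ty c)].
  exact: eqv_le (act_act HD _ _ vy).
- case: nc; set cs := gam (aD x (del y)).
  have sc : del (aC x cs) = del y by apply: sigK'.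
  suff P c : c = cs by rewrite (P c1) (P c2).
  apply: ple_as; first by apply: (sig_le vx tx); rewrite sc -(proj1 ty c).
  rewrite -[c](gC c vy) /cs; apply: (lab_le HC); [exact: vD|exact: vC|].
  apply: (le_tr (y := aD (aC y c) (del y))); last first.
    by have := eqv_le (act_id HD (vC c vy)); rewrite (proj1 ty c).
  apply: (le_tr (y := aD (aC x c) (del y))); last by apply: (act_le HD) => //; apply: vC.
  apply: (le_tr (y := aD (aD x (del (aC x c))) (del y))).
    exact: eqv_ge (act_act HD _ _ vx).
  by apply: (act_le HD); [exact: vD|exact: vC|apply: eqv_ge (proj1 tx c)].
- right; split=> // c.
  pose f d := del (aC y (gam (aD x d))).
  have fi : injective f.
    move=> d d' e; rewrite -(sigK' vx tx d) -(sigK' vx tx d'); congr (del (aC x _)).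
    by rewrite -(sigK vy ty (gam (aD x d))) -(sigK vy ty (gam (aD x d'))); congr (gam (aD y _)).
  have fle d : ple d (f d) by rewrite -{1}(sigK' vx tx d); apply: hd.
  by rewrite -(inflationary_inj fi fle (del (aC x c))) /f sigK.
Qed.
End Types.

(** * Two exponential structures on one poset *)

Record biroot (P C D : fposet) (r : C -> P -> P) (s : D -> P -> P) : Prop := Biroot {
  bi_r : root r; bi_s : root s; bi_C : factor C; bi_D : factor D }.

Lemma biroot_sym (P C D : fposet) (r : C -> P -> P) (s : D -> P -> P) :
  biroot r s -> biroot s r.
Proof. by case. Qed.

Lemma connected_op (C : fposet) : connected C -> connected (op C).
Proof.
move=> h x y; have := h x y; rewrite /same_comp.
by rewrite (@eq_connect _ (@cmp (op C)) (@cmp C)) // => a b; rewrite /cmp orbC.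
Qed.

Lemma indec_op (C : fposet) : indec C -> indec (op C).
Proof.
move=> h X Y [f [fb fm]]; apply: (h (op X) (op Y)); exists f; split=> // x y.
exact: (fm y x).
Qed.

Lemma factor_op (C : fposet) : factor C -> factor (op C).
Proof. by case=> a b c; split=> //; [apply: connected_op|apply: indec_op]. Qed.

Lemma biroot_op (P C D : fposet) (r : C -> P -> P) (s : D -> P -> P) :
  biroot r s -> @biroot (op P) (op C) (op D) r s.
Proof. by case=> a b c d; split; [apply: root_op|apply: root_op|apply: factor_op|apply: factor_op]. Qed.

(** As a function of [c] this invariant separates the two types of covers of [fixr r] above a common
    fixed point: it is constant or an isomorphism from [C] to [D]. *)
Definition xlab (P C D : fposet) (r : C -> P -> P) (s : D -> P -> P) (d0 : D) (p : P * P) (c : C) : D :=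
  lab s d0 (edge r p c).

(** * Labels of the second structure on the cubes of the first *)

Section Labels.
Variables (P C D : fposet) (r : C -> P -> P) (s : D -> P -> P) (c0 : C) (d0 : D).
Hypotheses (Hr : root r) (Hs : root s).
Local Notation A := (fixr r).
Local Notation dl := (xlab r s d0).
Implicit Types (f g x y z : P) (p q : P * P) (c : C) (d : D).

Lemma dl_R1 p q c : R1 A p q -> dl p c = dl q c.
Proof. by move=> h; apply: (R1_lab _ Hs); apply: (edge_R1 c0 Hr). Qed.

Lemma dl_le p c c' : covp A p -> ple c c' -> ple (dl p c) (dl p c').
Proof.
move=> cp h; have l := plexx p.1.
by apply: (leE_lab (b := p.1) d0 Hs (edge_over c0 Hr c cp l)); apply: (edge_inc c0 Hr).
Qed.

Lemma dl_cube p f g : covp A p -> cov predT f g -> ple p.1 f -> ple g p.2 ->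
  [/\ lab s d0 (f, g) = dl p (lab r c0 (f, g)), coord r c0 (f, g) = p &
     R1 predT (edge r p (lab r c0 (f, g))) (f, g)].
Proof.
move=> cp cfg l1 l2; have [e h] := R1_cube c0 Hr cp (cfg : covp predT (f, g)) l1 l2.
by split=> //; rewrite -(R1_lab d0 Hs h).
Qed.

Lemma cov_change_lab f g d : ple f g -> s d f != s d g ->
  exists x y, [/\ ple f x, cov predT x y, ple y g & lab s d0 (x, y) = d].
Proof.
move=> l ne; have [x [y [a b c n]]] := cov_change (phi := s d) l ne.
by exists x, y; split=> //; apply: (lab_eq d0 Hs (p := (x, y)) b n).
Qed.

(** A change of coordinate [d'] between [p.1] and [p.2] would happen along an edge with label [d'],
    but every edge of this interval has a label occurring in the cube of [p]. *)
Lemma u_other p d d' : covp A p -> (forall c, dl p c = d) -> d' != d -> s d' p.1 = s d' p.2.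
Proof.
move=> cp u n; apply/eqP; apply: contraT => ne.
have [f [g [l1 cfg l2 e]]] := cov_change_lab (cov_le cp) ne.
have [e1 _ _] := dl_cube cp cfg l1 l2.
by rewrite -(u (lab r c0 (f, g))) -e1 e eqxx in n.
Qed.
End Labels.

(** * Types of covers above a common fixed point *)

Section Local.
Variables (P C D : fposet) (r : C -> P -> P) (s : D -> P -> P) (c0 : C) (d0 : D).
Hypothesis RS : biroot r s.
Let Hr : root r := bi_r RS.
Let Hs : root s := bi_s RS.
Local Notation A := (fixr r).
Local Notation B := (fixr s).
Local Notation dl := (xlab r s d0).
Local Notation gl := (xlab s r c0).
Implicit Types (f g x y z : P) (p q : P * P) (c : C) (d : D).
Variable e : P.
Hypotheses (Ae : A e) (Be : B e).

Let aA := edge_action c0 Hr Ae.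
Let aB := edge_action d0 Hs Be.
Let letr (y x z : P * P) := @leE_trans P e y x z.
Let fC := bi_C RS.
Let fD := bi_D RS.

(** The edges of the cube of [p] form one orbit of [C], so the type of any one of them decides for
    the whole cube. *)
Lemma A_types p : covp A p -> ple e p.1 ->
  (exists d, (forall c, dl p c = d) /\ forall c d', gl (coord s d0 (edge r p c)) d' = c) \/
  [/\ injective (dl p), (forall c c', ple (dl p c) (dl p c') -> ple c c'),
      (forall d, exists c, dl p c = d) &
      (forall c c', gl (coord s d0 (edge r p c)) (dl p c') = c')].
Proof.
move=> cp l.
have v c : over e (edge r p c) by apply: (edge_over c0 Hr).
have ec c c' : edge r (coord r c0 (edge r p c)) c' = edge r p c' by rewrite (edge_coord _ Hr).
case: (types letr aA aB fC fD (v c0)) => t.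
  left; exists (dl p c0); have [u1 _] := t; split.
    by move=> c; have := u1 c; rewrite ec.
  move=> c d'; have := tyu_aC letr aA aB fC fD c (v c0) t.
  by rewrite /= ec => -[_ h]; rewrite /xlab h (edge_lab _ Hr).
have k := sigK aA aB (v c0) t; have k' := sigK' aA aB (v c0) t.
have kl := sig_le aA aB (v c0) t.
right; split.
- by move=> c c' h; rewrite -(k c) -(k c') /= !ec; congr (lab r c0 _); rewrite /xlab in h; rewrite h.
- by move=> c c' h; apply: kl; rewrite !ec.
- by move=> d; exists (lab r c0 (edge s (coord s d0 (edge r p c0)) d)); have := k' d; rewrite /= ec.
move=> c c'; have tc := tym_aC letr aA aB fC fD c (v c0) t.
rewrite /= ec in tc; have := sigK aA aB (v c) tc c'; by rewrite /= ec.
Qed.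

Lemma A_leE p q : covp A p -> covp A q -> ple e p.1 -> ple e q.1 -> R2 A p q ->
  ((forall c c', dl p c = dl p c') /\ (forall c c', dl q c = dl q c')) \/
  (injective (dl p) /\ forall c, dl p c = dl q c).
Proof.
move=> cp cq lp lq h.
have vp : over e (edge r p c0) by apply: (edge_over c0 Hr).
have vq : over e (edge r q c0) by apply: (edge_over c0 Hr).
have k := edge_R2 c0 Hr c0 lp lq h.
have ep c : edge r (coord r c0 (edge r p c0)) c = edge r p c by rewrite (edge_coord _ Hr).
have eq c : edge r (coord r c0 (edge r q c0)) c = edge r q c by rewrite (edge_coord _ Hr).
case: (type_le letr aA aB fC fD vp vq k) => [[[u1 _] [u2 _]]|[m1 m2 h12]].
  left; split=> c c'.
    by have := u1 c; have := u1 c'; rewrite !ep /xlab => -> ->.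
  by have := u2 c; have := u2 c'; rewrite !eq /xlab => -> ->.
right; split; last by move=> c; have := h12 c; rewrite ep eq.
move=> c c' h'; have k1 := sigK aA aB vp m1.
by rewrite -(k1 c) -(k1 c') /= !ep; move: h'; rewrite /xlab => ->.
Qed.

Lemma inj_not_const p d : covp A p -> (forall c, dl p c = d) -> injective (dl p) -> False.
Proof. by move=> cp u inj; have [_ _ [c [c' /eqP n]]] := fC; case: n; apply: inj; rewrite !u. Qed.

Lemma u_types p d : covp A p -> ple e p.1 -> (forall c, dl p c = d) ->
  forall c d', gl (coord s d0 (edge r p c)) d' = c.
Proof.
by move=> cp l u; case: (A_types cp l) => [[_ []] //|[inj _ _ _]]; case: (inj_not_const cp u inj).
Qed.

Lemma u_cube p d f g : covp A p -> ple e p.1 -> (forall c, dl p c = d) ->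
  cov predT f g -> ple p.1 f -> ple g p.2 ->
  [/\ covp B (s d f, s d g), forall d', gl (s d f, s d g) d' = lab r c0 (f, g)
    & coord s d0 (f, g) = (s d f, s d g)].
Proof.
move=> cp l u cfg l1 l2; have [e1 e2 h] := dl_cube c0 d0 Hr Hs cp cfg l1 l2.
rewrite u in e1.
have eq1 : coord s d0 (f, g) = (s d f, s d g) by rewrite /coord e1.
have cb : covp B (s d f, s d g) by rewrite -eq1; apply: (coord_cov _ Hs).
split=> // d'.
have h2 := R1_coord d0 Hs h; rewrite eq1 in h2.
by rewrite -(dl_R1 d0 c0 Hs Hr d' h2); apply: (u_types cp l u).
Qed.

(** In the interval of [p], the map [r c] after [s d] changes only along edges with [C]-label [c].
    There are none below the edge in direction [c] and none above it, since coordinate [c] already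
    has its extreme value there. *)
Lemma u_coord p d c : covp A p -> ple e p.1 -> (forall c, dl p c = d) ->
  let q := coord s d0 (edge r p c) in
  [/\ covp B q, q = (s d (edge r p c).1, s d (edge r p c).2),
     r c q.1 = r c (s d p.1) & r c q.2 = r c (s d p.2)].
Proof.
move=> cp l u q.
have ce := edge_cov c0 Hr c cp.
have cq : covp B q by apply: (coord_cov _ Hs).
have el : lab s d0 (edge r p c) = d by apply: u.
have eq : q = (s d (edge r p c).1, s d (edge r p c).2) by rewrite /q /coord /= el.
have le1 := edge_ge Hr c cp; have le2 := edge_le Hr c cp.
have ce' := cov_le ce.
have lp := cov_le cp.
have key f g : ple f g -> ple p.1 f -> ple g p.2 -> r c (s d f) != r c (s d g) ->
    exists f1 g1, [/\ ple f f1, cov predT f1 g1, ple g1 g & lab r c0 (f1, g1) = c].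
  move=> lfg l1 l2 ne.
  have [f1 [g1 [k1 cf k2 ne1]]] := cov_change (phi := fun x => r c (s d x)) lfg ne.
  exists f1, g1; split=> //.
  have [cb ub _] := u_cube cp l u cf (ple_tr l1 k1) (ple_tr k2 l2).
  apply/eqP; apply: contraT => n; move: ne1.
  by rewrite (u_other d0 Hs Hr cb ub) ?eqxx // eq_sym.
split=> //; rewrite eq /=; apply/eqP; apply: contraT => ne.
  have [|f1 [g1 [k1 cf k2 lc]]] := key p.1 (edge r p c).1 le1 (plexx _) (ple_tr ce' le2).
    by rewrite eq_sym.
  have := lab_neq c0 Hr (p := (f1, g1)) cf; rewrite lc /=.
  have k0 : ple (r c g1) p.1.
    by have := r_mono Hr c k2; rewrite (edge1 Hr) // pltxx.
  have k3 : ple p.1 (r c f1) by rewrite -(fixE c (cov_l cp)); apply: (r_mono Hr).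
  have k4 := r_mono Hr c (cov_le cf).
  by rewrite (ple_as k4 (ple_tr k0 k3)) eqxx.
have [f1 [g1 [k1 cf k2 lc]]] := key (edge r p c).2 p.2 le2 (ple_tr le1 ce') (plexx _) ne.
have := lab_neq c0 Hr (p := (f1, g1)) cf; rewrite lc /=.
have k0 : ple p.2 (r c f1).
  by have := r_mono Hr c k1; rewrite (edge2 Hr) // plexx.
have k3 : ple (r c g1) p.2 by rewrite -[X in ple _ X](fixE c (cov_r cp)); apply: (r_mono Hr).
have k4 := r_mono Hr c (cov_le cf).
by rewrite (ple_as k4 (ple_tr k3 k0)) eqxx.
Qed.

(** Injectivity of [dl p] ties a change of [s d] to direction [c] alone, and coordinate [c] is at
    its extreme value both before and after the edge. *)
Lemma m_coord p c : covp A p -> injective (dl p) ->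
  coord s d0 (edge r p c) = (s (dl p c) p.1, s (dl p c) p.2).
Proof.
move=> cp inj.
have ce := edge_cov c0 Hr c cp.
have le1 := edge_ge Hr c cp; have le2 := edge_le Hr c cp.
have ce' := cov_le ce.
rewrite /coord -/(dl p c); set d := dl p c.
have key f g : ple f g -> ple p.1 f -> ple g p.2 -> s d f != s d g ->
    exists f1 g1, [/\ ple f f1, cov predT f1 g1, ple g1 g & lab r c0 (f1, g1) = c].
  move=> lfg l1 l2 ne.
  have [f1 [g1 [k1 cf k2 e1]]] := cov_change_lab d0 Hs lfg ne.
  exists f1, g1; split=> //.
  have [e2 _ _] := dl_cube c0 d0 Hr Hs cp cf (ple_tr l1 k1) (ple_tr k2 l2).
  by apply: inj; rewrite -e2.
congr (_, _); apply/eqP; apply: contraT => ne.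
  have [|f1 [g1 [k1 cf k2 lc]]] := key p.1 (edge r p c).1 le1 (plexx _) (ple_tr ce' le2).
    by rewrite eq_sym.
  have := lab_neq c0 Hr (p := (f1, g1)) cf; rewrite lc /=.
  have k0 : ple (r c g1) p.1.
    by have := r_mono Hr c k2; rewrite (edge1 Hr) // pltxx.
  have k3 : ple p.1 (r c f1) by rewrite -(fixE c (cov_l cp)); apply: (r_mono Hr).
  have k4 := r_mono Hr c (cov_le cf).
  by rewrite (ple_as k4 (ple_tr k0 k3)) eqxx.
have [f1 [g1 [k1 cf k2 lc]]] := key (edge r p c).2 p.2 le2 (ple_tr le1 ce') (plexx _) ne.
have := lab_neq c0 Hr (p := (f1, g1)) cf; rewrite lc /=.
have k0 : ple p.2 (r c f1).
  by have := r_mono Hr c k1; rewrite (edge2 Hr) // plexx.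
have k3 : ple (r c g1) p.2 by rewrite -[X in ple _ X](fixE c (cov_r cp)); apply: (r_mono Hr).
have k4 := r_mono Hr c (cov_le cf).
by rewrite (ple_as k4 (ple_tr k3 k0)) eqxx.
Qed.

(** Inserting the pair [q] at index [d] of [x] gives an edge over [e], which [edge_base] links to
    the cube of [q]; its [C]-label is therefore read off from [q]. *)
Lemma upd_edge x q d : covp B q -> ple e q.1 -> ple e x -> ple (s d x) q.1 ->
  (forall d', plt d d' -> ple q.2 (s d' x)) ->
  let f := upd s x d q.1 in let g := upd s x d q.2 in
  [/\ (forall d', s d' f = if d' == d then q.1 else s d' x),
      (forall d', s d' g = if d' == d then q.2 else s d' x),
      cov predT f g, lab s d0 (f, g) = d & lab r c0 (f, g) = gl q d].
Proof.
move=> cq leq lex l1 l2 f g; have l12 := cov_le cq.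
have ef d' : s d' f = if d' == d then q.1 else s d' x.
  by apply: (upd_upP Hs) => //; [apply: cov_l cq|move=> d1 h; apply: ple_tr l12 (l2 d1 h)].
have eg d' : s d' g = if d' == d then q.2 else s d' x.
  by apply: (upd_upP Hs) => //; [apply: cov_r cq|apply: ple_tr l12].
have [cfg lfg] : covp predT (f, g) /\ lab s d0 (f, g) = d.
  apply: (cov_of_lab _ Hs); first by move=> d' n; rewrite ef eg (negbTE n).
  by rewrite ef eg eqxx.
have cofg : coord s d0 (f, g) = q by rewrite /coord lfg /= ef eg eqxx; case: (q).
split=> //.
have ov : over e (f, g).
  rewrite /over cfg /=; apply: (r_ext Hs) => d'; rewrite ef.
  by case: eqP => _; [rewrite fixE|apply: (r_mono Hs)].
have [h1 h2] := edge_base d0 Hs Be ov; rewrite cofg lfg in h1 h2.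
apply: ple_as; first exact: (leE_lab _ Hr ov).
by apply: (leE_lab _ Hr) h2; apply: (edge_over d0 Hs).
Qed.

(** Raise coordinate [d] of [p.1] to the smaller top value [z]; the result [z1] stays below [p.2].
    For each [c], the [D]-coordinate pair of the edge in direction [c] of the cube of [p1], inserted
    at index [d] of [p.1], is an edge below [z1] with [C]-label [c]. So every coordinate [c] of [z1]
    has reached [p.2]. *)
Lemma u_collapse p p1 d d1 : covp A p -> covp A p1 -> ple e p.1 -> ple e p1.1 ->
  (forall c, dl p c = d) -> (forall c, dl p1 c = d1) -> s d p.1 = s d1 p1.1 ->
  ple (s d1 p1.2) (s d p.2) -> s d1 p1.2 = s d p.2.
Proof.
move=> cp cp1 l l1 u u1 e1 h.
set z := s d1 p1.2 in h *.
have Bz : B z by apply: fix_r.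
have ez d' : s d' (upd s p.1 d z) = if d' == d then z else s d' p.1.
  apply: (upd_upP Hs) => //.
    by rewrite e1; apply: (r_mono Hs); apply: (cov_le cp1).
  move=> d2 dd'; rewrite (u_other c0 Hr Hs cp u) 1?eq_sym; last by case/andP: dd'.
  by apply: ple_tr h _; apply: (r_inc Hs); apply: pltW.
set z1 := upd _ _ _ _ in ez.
have z1le : ple z1 p.2.
  apply: (r_ext Hs) => d'; rewrite ez; case: eqP => [->//|_].
  by apply: (r_mono Hs); apply: cov_le cp.
have z1c c : r c z1 = p.2.
  have [cq eq _ _] := u_coord c cp1 l1 u1.
  have ut := u_types cp1 l1 u1 c.
  set q := coord _ _ _ in cq eq ut.
  have le1 := edge_ge Hr c cp1; have le2 := edge_le Hr c cp1.
  have q1 : ple (s d p.1) q.1 by rewrite e1 eq; apply: (r_mono Hs).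
  have q2 : ple q.2 z by rewrite eq; apply: (r_mono Hs).
  have q2' d' : plt d d' -> ple q.2 (s d' p.1).
    move=> dd'; rewrite (u_other c0 Hr Hs cp u) 1?eq_sym; last by case/andP: dd'.
    apply: ple_tr q2 _; apply: ple_tr h _; apply: (r_inc Hs); exact: pltW.
  have leq : ple e q.1.
    by rewrite eq /= -(fixE d1 Be); apply: (r_mono Hs); apply: ple_tr le1.
  have [ef eg cfg lfg lr] := upd_edge cq leq l q1 q2'.
  rewrite ut in lr.
  set f := upd _ _ _ _ in ef cfg lfg lr; set g := upd _ _ _ _ in eg cfg lfg lr.
  have fp : ple p.1 f.
    apply: (r_ext Hs) => d'; rewrite ef; case: eqP => [->//|_]; exact: plexx.
  have gz : ple g z1.
    apply: (r_ext Hs) => d'; rewrite eg ez; case: eqP => _ //; exact: plexx.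
  have ne := lab_neq c0 Hr (p := (f, g)) cfg; rewrite lr /= in ne.
  have b1 : ple p.1 (r c f) by rewrite -(fixE c (cov_l cp)); apply: (r_mono Hr).
  have b2 : ple (r c z1) p.2 by rewrite -[X in ple _ X](fixE c (cov_r cp)); apply: (r_mono Hr).
  have b3 := r_mono Hr c gz; have b4 := r_mono Hr c (cov_le cfg).
  case: (cov_mid cp (fix_r Hr c z1) (ple_tr b1 (ple_tr b4 b3)) b2) => // k.
  case/negP: ne; apply/eqP; apply: ple_as => //.
  by apply: ple_tr b3 _; rewrite k.
have -> : p.2 = z1 by apply/esym/(fix_ext Hr (cov_r cp)).
by rewrite ez eqxx.
Qed.
End Local.

Lemma conn_const (C : fposet) (X : Type) (phi : C -> X) : connected C ->
  (forall c c', ple c c' -> phi c = phi c') -> forall c c', phi c = phi c'.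
Proof.
move=> Ccon h c c'; have /connectP[p pp ->] := Ccon c c'.
elim: p c pp => //= c1 p IH c /andP[/orP[k|k] pp]; rewrite -(IH c1 pp); [exact: h|exact/esym/h].
Qed.

Lemma fixr_const (P C : fposet) (r : C -> P -> P) (c0 : C) (f : P) : root r -> connected C ->
  (forall c c', ple c c' -> r c f = r c' f) -> fixr r f.
Proof.
move=> Hr Cc h; have k := conn_const Cc h.
have Ax := fix_r Hr c0 f.
by rewrite (fix_ext Hr Ax (f := f)).
Qed.

(** * Fixed points of one structure under the other *)

Section Stable.
Variables (P C D : fposet) (r : C -> P -> P) (s : D -> P -> P) (c0 : C) (d0 : D).
Hypothesis RS : biroot r s.
Let Hr : root r := bi_r RS.
Let Hs : root s := bi_s RS.
Let SR := biroot_sym RS.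
Local Notation A := (fixr r).
Local Notation B := (fixr s).
Local Notation dl := (xlab r s d0).
Local Notation gl := (xlab s r c0).
Implicit Types (f g x y z : P) (p q : P * P) (c : C) (d : D).
Variable e : P.
Hypotheses (Ae : A e) (Be : B e).

(** Induction along covers (y, z) of [A]. In type u a single [s d1] moves; to see that the
    coordinates of [s d1 z] at comparable indices agree, cross to [B] and back by [u_coord] and
    compare by [u_collapse]. In type m every [r c' (s d z)] covers [s d y] in [A], and comparable
    covers of one point are equal. *)
Lemma stable_up a : A a -> ple e a -> forall d, A (s d a).
Proof.
have Cc : connected C by case: (bi_C RS).
apply: (cov_ind_up (S := A) (Q := fun a => forall d, A (s d a))) => //.
  by move=> d; rewrite fixE.
move=> y z ey Qy cyz d; have cp : covp A (y, z) := cyz.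
have ep : ple e (y, z).1 by [].
have Az := cov_r cyz; have Ay := cov_l cyz.
case: (A_types c0 d0 RS Ae Be cp ep) => [[d1 [u _]]|[inj _ surj mm]].
  case: (eqVneq d d1) => [->|nd]; last first.
    by rewrite -(u_other c0 Hr Hs cp u nd); apply: Qy.
  apply: (fixr_const c0 Hr Cc) => c c' cc'; apply: (r_inj Hs) => d'.
  have side k : exists p1, [/\ covp A p1, ple e p1.1, (forall c, dl p1 c = d'),
       s d' p1.1 = s d1 y & s d' p1.2 = s d' (r k (s d1 z))].
    have [cq eq h1 h2] := u_coord c0 RS Ae Be k cp ep u.
    have uq := u_types c0 RS Ae Be cp ep u k.
    set q := coord _ _ _ in cq eq h1 h2 uq.
    have leq : ple e q.1.
      rewrite eq /= -(fixE d1 Be); apply: (r_mono Hs).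
      exact: ple_tr (edge_ge Hr k cp).
    have [cp1 eq1 h3 h4] := u_coord d0 SR Be Ae d' cq leq uq.
    have up1 := u_types d0 SR Be Ae cq leq uq d'.
    set p1 := coord _ _ _ in cp1 eq1 h3 h4 up1.
    have lp1 : ple e p1.1.
      rewrite eq1 /= -(fixE k Ae); apply: (r_mono Hr).
      exact: ple_tr (edge_ge Hs d' cq).
    exists p1; split=> //; last by rewrite h4 h2.
    by rewrite h3 h1 /= (fixE k (Qy d1)) (r_abs Hs).
  have [p1 [cp1 lp1 u1 a1 b1]] := side c; have [p2 [cp2 lp2 u2 a2 b2]] := side c'.
  rewrite -b1 -b2; apply: (u_collapse c0 RS Ae Be cp2 cp1 lp2 lp1 u2 u1).
    by rewrite a1 a2.
  by rewrite b1 b2; apply: (r_mono Hs); apply: (r_inc Hr).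
have [c dc] := surj d.
have eq := m_coord c0 RS c cp inj; rewrite dc /= in eq.
have cq : covp B (s d y, s d z) by rewrite -eq; apply/(coord_cov _ Hs)/(edge_cov c0 Hr).
have glq c' : gl (s d y, s d z) (dl (y, z) c') = c' by rewrite -eq; apply: mm.
have ginj : injective (gl (s d y, s d z)).
  by move=> x1 x2; have [k1 <-] := surj x1; have [k2 <-] := surj x2; rewrite !glq => ->.
have covs c' : cov A (s d y) (r c' (s d z)).
  have := m_coord d0 SR (dl (y, z) c') cq ginj; rewrite glq /= (fixE _ (Qy d)) => eq2.
  have : covp A (s d y, r c' (s d z)) by rewrite -eq2; apply/(coord_cov _ Hr)/(edge_cov d0 Hs).
  by [].
apply: (fixr_const c0 Hr Cc) => k k' kk'.
have le := r_inc Hr (s d z) kk'.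
case: (cov_mid (covs k') (fix_r Hr k _) (cov_le (covs k)) le) => // h.
by case: (cov_neq (covs k)); rewrite h.
Qed.

Lemma lab_over f g : over e (f, g) -> lab r c0 (f, g) = gl (coord s d0 (f, g)) (lab s d0 (f, g)).
Proof.
move=> ov; have [h1 h2] := edge_base d0 Hs Be ov.
apply: ple_as; first exact: (leE_lab _ Hr ov).
apply: (leE_lab _ Hr) h2; apply: (edge_over d0 Hs); last by apply: coord_ge => //; case/andP: ov.
by apply: (coord_cov _ Hs); case/andP: ov.
Qed.
End Stable.

(** * Covers of the set of common fixed points *)

Section Ecov.
Variables (P C D : fposet) (r : C -> P -> P) (s : D -> P -> P) (c0 : C) (d0 : D).
Hypothesis RS : biroot r s.
Let Hr : root r := bi_r RS.
Let Hs : root s := bi_s RS.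
Local Notation A := (fixr r).
Local Notation B := (fixr s).
Local Notation dl := (xlab r s d0).
Implicit Types (f g x y z : P) (p q : P * P) (c : C) (d : D).
Definition bfix : pred P := fun x => A x && B x.
Local Notation E := bfix.

Variables e y : P.
Hypothesis cE : cov E e y.
Let Ae : A e. Proof. by case/andP: (cov_l cE). Qed.
Let Be : B e. Proof. by case/andP: (cov_l cE). Qed.
Let By : B y. Proof. by case/andP: (cov_r cE). Qed.

(** By [stable_up] the point [s d x] is still fixed by [r], so it is a point of [E] between [e] and
    [y]. *)
Lemma Ecov_val x d : A x -> ple e x -> ple x y -> s d x = e \/ s d x = y.
Proof.
move=> Ax ex xy; apply: (cov_mid cE).
- by apply/andP; split; [apply: (stable_up c0 d0 RS Ae Be)|apply: fix_r].
- by rewrite -(fixE d Be); apply: (r_mono Hs).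
- by rewrite -[y](fixE d By); apply: (r_mono Hs).
Qed.

Lemma Ecov_lt x z d : A x -> A z -> ple e x -> ple x z -> ple z y -> s d x != s d z ->
  s d x = e /\ s d z = y.
Proof.
move=> Ax Az ex xz zy ne; have h := r_mono Hs d xz.
case: (Ecov_val d Ax ex (ple_tr xz zy)) => e1; case: (Ecov_val d Az (ple_tr ex xz) zy) => e2 //.
- by rewrite e1 e2 eqxx in ne.
- by rewrite e1 e2 (plt_nge (cov_lt cE)) in h.
by rewrite e1 e2 eqxx in ne.
Qed.

(** Type u is excluded: it would move a single [D]-coordinate, while [e] and [y], being constant for
    [s], differ at every index. *)
Lemma Ecov_m : cov A e y -> cov B e y /\ injective (dl (e, y)).
Proof.
move=> cA; have cp : covp A (e, y) := cA.
have ep : ple e (e, y).1 := plexx e.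
have [_ _ [d1 [d2 n]]] := bi_D RS.
case: (A_types c0 d0 RS Ae Be cp ep) => [[d [u _]]|[inj _ surj _]].
  have [d' n'] : exists d', d' != d.
    by case: (eqVneq d1 d) => [h|]; [exists d2; rewrite -h eq_sym|exists d1].
  have := u_other c0 Hr Hs cp u n'; rewrite /= !fixE // => h.
  by case: (cov_neq cA).
split=> //; have [c dc] := surj d1.
have eq := m_coord c0 RS c cp inj; rewrite /= !(fixE (dl (e, y) c)) // in eq.
have : covp B (e, y) by rewrite -eq; apply/(coord_cov _ Hs)/(edge_cov c0 Hr).
by [].
Qed.

(** In type m every [D]-coordinate would pass from [e] to [y], so [p] would be the pair (e, y)
    itself, which is assumed not to be a cover of [A]. *)
Lemma Ecov_u p : ~~ cov A e y -> covp A p -> ple e p.1 -> ple p.2 y ->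
  exists d, [/\ forall c, dl p c = d, s d p.1 = e & s d p.2 = y].
Proof.
move=> nA cp l1 l2; have l12 := cov_le cp; have Ap1 := cov_l cp; have Ap2 := cov_r cp.
case: (A_types c0 d0 RS Ae Be cp l1) => [[d [u _]]|[inj _ surj _]].
  exists d; have [//|a b] := @Ecov_lt p.1 p.2 d Ap1 Ap2 l1 l12 l2; last by split.
  apply: contra_not_neq (cov_neq cp) => h; apply: (r_inj Hs) => d'.
  by case: (eqVneq d' d) => [->//|n]; rewrite (u_other c0 Hr Hs cp u n).
case/negP: nA.
have sd d : s d p.1 = e /\ s d p.2 = y.
  apply: Ecov_lt => //; have [c dc] := surj d.
  have eq := m_coord c0 RS c cp inj; rewrite dc in eq.
  have : covp B (s d p.1, s d p.2) by rewrite -eq; apply/(coord_cov _ Hs)/(edge_cov c0 Hr).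
  by move/cov_neq/eqP.
have e1 : p.1 = e by apply: (fix_ext Hs Be) => d; case: (sd d).
have e2 : p.2 = y by apply: (fix_ext Hs By) => d; case: (sd d).
by rewrite -e1 -e2.
Qed.
End Ecov.

Lemma bfixC (P C D : fposet) (r : C -> P -> P) (s : D -> P -> P) : bfix r s =1 bfix s r.
Proof. by move=> x; rewrite /bfix andbC. Qed.

Lemma eq_cov (P : fposet) (S S' : pred P) x y : S =1 S' -> cov S x y = cov S' x y.
Proof.
move=> h; apply/covP/covP => -[a b c d]; split; rewrite -?h // ?h // => z Sz; apply: d;
by rewrite ?h // -?h.
Qed.

Section EcovCube.
Variables (P C D : fposet) (r : C -> P -> P) (s : D -> P -> P) (c0 : C) (d0 : D).
Hypothesis RS : biroot r s.
Let Hr : root r := bi_r RS.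
Let Hs : root s := bi_s RS.
Let SR := biroot_sym RS.
Local Notation A := (fixr r).
Local Notation B := (fixr s).
Local Notation gl := (xlab s r c0).
Local Notation E := (bfix r s).
Implicit Types (f g x z : P) (p q : P * P) (c : C) (d : D).
Variables e y : P.
Hypothesis cE : cov E e y.
Let Ae : A e. Proof. by case/andP: (cov_l cE). Qed.
Let Be : B e. Proof. by case/andP: (cov_l cE). Qed.
Let Ay : A y. Proof. by case/andP: (cov_r cE). Qed.
Let By : B y. Proof. by case/andP: (cov_r cE). Qed.
Let cE' : cov (bfix s r) e y. Proof. by rewrite -(eq_cov _ _ (bfixC r s)). Qed.

Lemma Ecov_sym : cov A e y = cov B e y.
Proof.
apply/idP/idP => h; first by case: (Ecov_m c0 d0 RS cE h).
by case: (Ecov_m d0 c0 SR cE' h).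
Qed.

Lemma Ecov_edge c : ~~ cov A e y ->
  exists q, [/\ covp B q, ple e q.1, ple q.2 y & forall d, gl q d = c].
Proof.
move=> nA; have ey := cov_lt cE.
have ne : r c e != r c y by rewrite !fixE //; case/andP: ey.
have [f [g [l1 cfg l2 lr]]] := cov_change_lab c0 Hr (pltW ey) ne.
have cs := coord_cov d0 Hs (p := (f, g)) cfg.
have q1 : ple e (coord s d0 (f, g)).1 by apply: coord_ge.
have q2 : ple (coord s d0 (f, g)).2 y by apply: coord_le.
have nB : ~~ cov B e y by rewrite -Ecov_sym.
have [c' [u _ _]] := Ecov_u d0 c0 SR cE' nB cs q1 q2.
exists (coord s d0 (f, g)); split=> // d.
rewrite u -(u (lab s d0 (f, g))) -(lab_over c0 d0 RS Be) //.
by rewrite /over l1 andbT.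
Qed.

(** The whole cube of maps from [D] to {e, y} lies in [A]. For each [c] and [d] the value of
    [s d (r c h)] is bounded by comparing [h] with an edge of [C]-label [c] and [D]-label [d] placed
    as tightly as possible against it; on such an edge the value is known from [Ecov_u]. *)
Lemma Ecov_cube h : ~~ cov A e y -> (forall d, s d h = e \/ s d h = y) -> A h.
Proof.
move=> nA hv.
have ey := cov_le cE.
have eh : ple e h.
  by apply: (r_ext Hs) => d; rewrite fixE //; case: (hv d) => ->; rewrite ?plexx.
have hy : ple h y.
  by apply: (r_ext Hs) => d; rewrite (fixE d By); case: (hv d) => ->; rewrite ?plexx.
have key c d f g : ple e f -> ple g y -> cov predT f g -> lab r c0 (f, g) = c -> lab s d0 (f, g) = d ->
    s d (r c f) = e /\ s d (r c g) = y.
  move=> ef gy cfg lr ls.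
  have cp := coord_cov c0 Hr (p := (f, g)) cfg.
  have l1 : ple e (coord r c0 (f, g)).1 by apply: coord_ge.
  have l2 : ple (coord r c0 (f, g)).2 y by apply: coord_le.
  have [d1 [u a b]] := Ecov_u c0 d0 RS cE nA cp l1 l2.
  have ed : d1 = d.
    rewrite -ls (lab_over d0 c0 SR Ae); first by rewrite u.
    by rewrite /over ef andbT.
  by rewrite -ed -lr; split; [apply: a|apply: b].
have side c d : s d (r c h) = s d h.
  have [q [cq q1 q2 uq]] := Ecov_edge c nA.
  have q12 := cov_le cq.
  have between : ple e (r c h) /\ ple (r c h) y.
    by split; [rewrite -(fixE c Ae)|rewrite -[y](fixE c Ay)]; apply: (r_mono Hr).
  case: (hv d) => hd.
    (* The largest map to {e, y} with value [e] at [d]; so [h] stays below the lower end of the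
       inserted edge. *)
    pose a d' := if ple d' d then e else y.
    have ea d' : s d' (mk s e a) = a d'.
      apply: (mk_upP Hs (f := e)) => [x z xz||x]; rewrite /a.
      - case: ifP => [xd|nxd]; case: ifP => [zd|nzd]; rewrite ?plexx //.
        by rewrite (ple_tr xz zd) in nxd.
      - by move=> x; case: ifP.
      - by rewrite fixE //; case: ifP; rewrite ?plexx.
    set h1 := mk _ _ _ in ea.
    have eh1 : ple e h1.
      by apply: (r_ext Hs) => d'; rewrite ea fixE // /a; case: ifP; rewrite ?plexx.
    have h1d : ple (s d h1) q.1 by rewrite ea /a plexx.
    have h1u d' : plt d d' -> ple q.2 (s d' h1).
      by move=> lt; rewrite ea /a; case: ifP => // k; move: (plt_nge lt); rewrite k.
    have [ef eg cfg ls lr] := upd_edge c0 d0 RS Be cq q1 eh1 h1d h1u.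
    rewrite uq in lr; set f := upd _ _ _ _ in ef cfg ls lr; set g := upd _ _ _ _ in eg cfg ls lr.
    have hf : ple h f.
      apply: (r_ext Hs) => d'; rewrite ef ea /a; case: eqP => [->|_]; first by rewrite hd.
      case: ifP => [k|_]; first by rewrite -hd; apply: (r_inc Hs).
      by case: (hv d') => ->; rewrite ?plexx.
    have gy : ple g y.
      apply: (r_ext Hs) => d'; rewrite eg ea /a (fixE d' By); case: eqP => // _.
      by case: ifP; rewrite ?plexx.
    have [k _] := key c d f g (ple_tr eh hf) gy cfg lr ls.
    rewrite hd; apply: ple_as.
      by rewrite -k; apply: (r_mono Hs); apply: (r_mono Hr).
    by rewrite -(fixE d Be); apply: (r_mono Hs); case: between.
  (* Dually, an [h] with value [y] at [d] has value [y] at all larger indices, so it lies above the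
     upper end of the inserted edge. *)
  pose a d' := if plt d d' then y else e.
  have ea d' : s d' (mk s e a) = a d'.
    apply: (mk_upP Hs (f := e)) => [x z xz||x]; rewrite /a.
    - case: ifP => [xd|nxd]; last by case: ifP; rewrite ?plexx.
      by rewrite (plt_ple_trans xd xz) plexx.
    - by move=> x; case: ifP.
    - by rewrite fixE //; case: ifP; rewrite ?plexx.
  set h0 := mk _ _ _ in ea.
  have eh0 : ple e h0.
    by apply: (r_ext Hs) => d'; rewrite ea fixE // /a; case: ifP; rewrite ?plexx.
  have h0d : ple (s d h0) q.1 by rewrite ea /a pltxx.
  have h0u d' : plt d d' -> ple q.2 (s d' h0) by move=> lt; rewrite ea /a lt.
  have [ef eg cfg ls lr] := upd_edge c0 d0 RS Be cq q1 eh0 h0d h0u.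
  rewrite uq in lr; set f := upd _ _ _ _ in ef cfg ls lr; set g := upd _ _ _ _ in eg cfg ls lr.
  have gh : ple g h.
    apply: (r_ext Hs) => d'; rewrite eg ea /a; case: eqP => [->|_]; first by rewrite hd.
    case: ifP => [k|_]; first by rewrite -hd; apply: (r_inc Hs); apply: pltW.
    by rewrite -(fixE d' Be); apply: (r_mono Hs).
  have ef' : ple e f.
    apply: (r_ext Hs) => d'; rewrite ef ea /a fixE //; case: eqP => // _.
    by case: ifP; rewrite ?plexx.
  have [_ k] := key c d f g ef' (ple_tr gh hy) cfg lr ls.
  rewrite hd; apply: ple_as; last by rewrite -k; apply: (r_mono Hs); apply: (r_mono Hr).
  by rewrite -[y](fixE d By); apply: (r_mono Hs); case: between.
apply/fixP => c; apply: (r_inj Hs) => d; exact: side.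
Qed.
End EcovCube.

(** * Steps between fixed points of the second structure *)

Lemma conn_cov (C : fposet) (X : Type) (phi : C -> X) : connected C ->
  (forall c c', cov predT c c' -> phi c = phi c') -> forall c c', phi c = phi c'.
Proof.
move=> Cc h; apply: conn_const => // c c' cc'.
apply: (cov_ind_up (S := predT) (Q := fun d => phi c = phi d)) => //.
by move=> y z _ -> /h.
Qed.

(** Applied to both entries, [f] maps the finite set of comparable pairs injectively into itself,
    hence onto it. *)
Lemma mono_inj_refl (C : fposet) (f : C -> C) : (forall x y, ple x y -> ple (f x) (f y)) ->
  injective f -> forall x y, ple (f x) (f y) -> ple x y.
Proof.
move=> m fi x y h.
pose S := [set p : C * C | ple p.1 p.2].
pose g (p : C * C) := (f p.1, f p.2).
have gi : injective g by move=> [a b] [c d] [/fi -> /fi ->].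
have sub : g @: S \subset S.
  by apply/subsetP => _ /imsetP[p + ->]; rewrite !inE; apply: m.
have eS : g @: S = S.
  by apply/eqP; rewrite eqEcard sub card_imset // leqnn.
have : (f x, f y) \in g @: S by rewrite eS inE.
by case/imsetP => -[a b] /=; rewrite inE /= => ab [/fi -> /fi ->].
Qed.

Lemma inj_le_eq (C : fposet) (f g : C -> C) : (forall x y, ple x y -> ple (f x) (f y)) ->
  injective f -> injective g -> (forall x, ple (f x) (g x)) -> f =1 g.
Proof.
move=> m fi gi h x.
have hi : injective (fun x => invF fi (g x)).
  by move=> a b e; apply: gi; rewrite -(f_invF fi (g a)) e f_invF.
have le a : ple a (invF fi (g a)) by apply: (mono_inj_refl m fi); rewrite f_invF.
by rewrite -{1}(inflationary_inj hi le x) f_invF.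
Qed.

Section Steps.
Variables (P C D : fposet) (r : C -> P -> P) (s : D -> P -> P) (c0 : C) (d0 : D).

(* Over a fixed point of [r] this is [lab s d0 j] itself; elsewhere [j] may fail to be linked by
   squares to the parallel edge of the cube of [coord r c0 j], and the two labels can differ. *)
Definition cross_lab (j : P * P) : D := xlab r s d0 (coord r c0 j) (lab r c0 j).
Definition par_lab (l : P * P) (d : D) : D := cross_lab (edge s l d).
Definition cube_lab (l : P * P) (d : D) (c : C) : D := xlab r s d0 (coord r c0 (edge s l d)) c.
(** Reads [b] as a map from [C] to [E]. Then the coordinates of edges above [b] are covers above
    common fixed points, where [A_types] applies. *)
Definition eval_fixed (b : P) : Prop := fixr s b /\ forall c, fixr s (r c b).
Definition utype (l : P * P) : Prop := forall d c c', cube_lab l d c = cube_lab l d c'.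
Definition mtype (l : P * P) : Prop := forall d, injective (cube_lab l d).

Hypothesis RS : biroot r s.
Let Hr : root r := bi_r RS.
Let Hs : root s := bi_s RS.
Let SR := biroot_sym RS.
Local Notation A := (fixr r).
Local Notation B := (fixr s).
Local Notation dl := (xlab r s d0).
Local Notation gl := (xlab s r c0).
Local Notation E := (bfix r s).
Local Notation lb := (lab r c0).
Local Notation co := (coord r c0).
Implicit Types (f g x y z b : P) (p q l j : P * P) (c : C) (d : D).

Lemma eval_fixed_B b : eval_fixed b -> B b. Proof. by case. Qed.
Lemma eval_fixed_E b c : eval_fixed b -> E (r c b).
Proof. by case=> _ h; apply/andP; split; [apply: fix_r|]. Qed.
Lemma bfix_eval e : E e -> eval_fixed e.
Proof. by case/andP => Ae Be; split=> // c; rewrite fixE. Qed.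

(** In type m every [s d y] covers [e] in [B], and comparable covers of [e] coincide. *)
Lemma E_cov_B e y : E e -> cov A e y -> injective (dl (e, y)) -> B y.
Proof.
case/andP => Ae Be cA inj; have cp : covp A (e, y) := cA.
have ep : ple e (e, y).1 := plexx e.
have [Dc _ _] := bi_D RS.
have covs d : cov B e (s d y).
  case: (A_types c0 d0 RS Ae Be cp ep) => [[d1 [u _]]|[_ _ surj _]].
    by case: (inj_not_const RS cp u inj).
  have [c dc] := surj d; have eq := m_coord c0 RS c cp inj; rewrite dc /= fixE // in eq.
  have : covp B (e, s d y) by rewrite -eq; apply/(coord_cov _ Hs)/(edge_cov c0 Hr).
  by [].
apply: (fixr_const d0 Hs Dc) => d d' dd'.
case: (cov_mid (covs d') (fix_r Hs d y) (cov_le (covs d)) (r_inc Hs y dd')) => // h.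
by case: (cov_neq (covs d)); rewrite h.
Qed.

Lemma cube_lab_type b j : eval_fixed b -> over b j ->
  (forall c c', dl (co j) c = dl (co j) c') \/ injective (dl (co j)).
Proof.
move=> eb ov; have /andP[Ae Be] := eval_fixed_E (lb j) eb; case/andP: ov => cj lj.
have cp := coord_cov c0 Hr cj.
have l1 : ple (r (lb j) b) (co j).1 by apply: (r_mono Hr).
case: (A_types c0 d0 RS Ae Be cp l1) => [[d [u _]]|[inj _ _ _]]; last by right.
by left=> c c'; rewrite !u.
Qed.

Lemma over_R2 b j j' : eval_fixed b -> over b j -> over b j' -> R2 predT j j' ->
  (lb j = lb j' /\ (((forall c c', dl (co j) c = dl (co j) c') /\
      (forall c c', dl (co j') c = dl (co j') c')) \/
    (injective (dl (co j)) /\ forall c, dl (co j) c = dl (co j') c))) \/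
  (plt (lb j) (lb j') /\ R1 A (co j) (co j')).
Proof.
move=> eb ov ov' h; case: (R2_lab c0 Hr h) => [[e k]|]; last by right.
left; split=> //; have /andP[Ae Be] := eval_fixed_E (lb j) eb.
case/andP: ov => cj lj; case/andP: ov' => cj' lj'.
apply: (A_leE c0 d0 RS Ae Be _ _ _ _ k).
- exact: (coord_cov c0 Hr).
- exact: (coord_cov c0 Hr).
- exact: (r_mono Hr).
- by rewrite e; apply: (r_mono Hr).
Qed.

Lemma edge_over_s b l d : covp B l -> ple b l.1 -> over b (edge s l d).
Proof. exact: (edge_over d0 Hs). Qed.

(** By [edge_adj] one edge is stacked, up to a square, on the other. If the [C]-label jumps, their
    coordinate pairs are linked by squares, so the labels of the two cubes agree. *)
Lemma adj_type b l d d' : eval_fixed b -> covp B l -> ple b l.1 -> cov predT d d' ->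
  (lb (edge s l d) = lb (edge s l d') /\
     (((forall c c', cube_lab l d c = cube_lab l d c') /\ (forall c c', cube_lab l d' c = cube_lab l d' c')) \/
      (injective (cube_lab l d) /\ cube_lab l d =1 cube_lab l d'))) \/
  [/\ plt (lb (edge s l d)) (lb (edge s l d')), cube_lab l d =1 cube_lab l d' &
      ~~ ple (co (edge s l d)).2 (r (lb (edge s l d')) b)].
Proof.
move=> eb cl bl cd.
have [j [h1 h2 lj]] := edge_adj d0 Hs cl cd.
have ov := edge_over_s d cl bl.
have ovj : over b j.
  by rewrite /over (R1_cov2 h1); apply: ple_tr bl lj.
have el := R1_lab c0 Hr h1.
have ep c : cube_lab l d' c = dl (co j) c.
  by apply: (dl_R1 c0 d0 Hr Hs); apply: (R1_coord c0 Hr).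
case: (over_R2 eb ov ovj h2) => [[e t]|[lt k]].
  left; rewrite el; split=> //; case: t => [[t1 t2]|[t1 t2]].
    by left; split=> // c c'; rewrite !ep; apply: t2.
  by right; split=> // c; rewrite ep; apply: t2.
right; rewrite el; split=> //.
  by move=> c; rewrite ep; apply: (dl_R1 c0 d0 Hr Hs).
case/and5P: k => _ _ _ _; apply: contra => k; apply: (ple_tr k).
by apply: (r_mono Hr); case/andP: ovj.
Qed.

(** Connectedness of [D]: across a cover of [D] the alternative constant or injective is preserved,
    and in the injective case so is [cube_lab] itself. *)
Lemma l_type b l : eval_fixed b -> covp B l -> ple b l.1 ->
  utype l \/ (mtype l /\ forall d d', cube_lab l d =1 cube_lab l d').
Proof.
move=> eb cl bl; have [Dc _ _] := bi_D RS.
pose k d := [forall c, forall c', cube_lab l d c == cube_lab l d c'].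
have kP d : reflect (forall c c', cube_lab l d c = cube_lab l d c') (k d).
  apply: (iffP forallP) => h c; first by move=> c'; apply/eqP; move/forallP: (h c).
  by apply/forallP => c'; apply/eqP.
have big : exists c c' : C, c != c' by case: (bi_C RS).
have nk d : injective (cube_lab l d) -> k d = false.
  by have [c [c' /eqP n]] := big => inj; apply/negP => /kP h; case: n; apply/inj/h.
have tyd d : k d \/ injective (cube_lab l d).
  have ov := edge_over_s d cl bl.
  by case: (cube_lab_type eb ov) => h; [left; apply/kP|right].
have kc d d' : k d = k d'.
  apply: (conn_cov Dc) d d' => d d' cd.
  case: (adj_type eb cl bl cd) => [[_ [[t1 t2]|[t1 t2]]]|[_ t _]].
  - by move/kP: t1 => ->; move/kP: t2 => ->.
  - by rewrite !nk // => c c'; rewrite -!t2; apply: t1.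
  by apply/kP/kP => h c c'; have := h c c'; rewrite !t.
case/boolP: (k d0) => h; [left|right].
  by move=> d; apply/kP; rewrite (kc d d0).
have inj d : injective (cube_lab l d).
  by case: (tyd d) => //; rewrite (kc d d0) (negbTE h).
split=> // d d' c.
apply: (conn_cov (phi := fun d => cube_lab l d c) Dc) d d' => d d' cd.
case: (adj_type eb cl bl cd) => [[_ [[t1 t2]|[t1 t2]]]|[_ t _]] //.
by move: (nk d (inj d)) => /negP []; apply/kP.
Qed.

(** A jump of the [C]-label between neighbours would leave [cube_lab] unchanged; as this is constant
    in type u, [par_lab] would take one value at two indices. *)
Lemma u_lab b l : eval_fixed b -> covp B l -> ple b l.1 -> utype l -> injective (par_lab l) ->
  forall d d', lb (edge s l d) = lb (edge s l d').
Proof.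
move=> eb cl bl u inj; have [Dc _ _] := bi_D RS.
apply: (conn_cov Dc) => d d' cd.
case: (adj_type eb cl bl cd) => [[]//|[lt t _]].
case: (cov_neq cd); apply: inj.
by rewrite /par_lab /cross_lab -!/(cube_lab _ _ _) -t; apply: u.
Qed.

Lemma m_gl_inj b l : eval_fixed b -> covp B l -> ple b l.1 -> mtype l -> injective (par_lab l) -> injective (gl l).
Proof.
move=> eb cl bl m inj d d' e; apply: inj.
case: (l_type eb cl bl) => [u|[_ h]].
  by have [_ _ [c [c' /eqP n]]] := bi_C RS; case: n; apply: (m d); apply: u.
by rewrite /par_lab /cross_lab -!/(cube_lab _ _ _) -!/(gl l _) e; apply: h.
Qed.

(** Choose the index [dd] with [par_lab] equal to [d]. By injectivity only edges with [D]-label [dd]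
    change [s d] after [r c1], and coordinate [dd] is constant both before and after the chosen edge
    [j]. *)
Lemma u_step_val b b' c1 : eval_fixed b -> cov B b b' -> (forall d, gl (b, b') d = c1) ->
  utype (b, b') -> injective (par_lab (b, b')) ->
  forall d, exists p d1, [/\ covp A p, ple (r c1 b) p.1, ple p.2 (r c1 b'), dl p =1 (fun=> d) &
     [/\ s d p.1 = r c1 b, s d p.2 = s d (r c1 b') & par_lab (b, b') d1 = d]].
Proof.
move=> eb cb gc u inj d; set l := (b, b').
have cl : covp B l := cb.
pose dd := invF inj d; have ed : par_lab l dd = d by apply: f_invF.
set j := edge s l dd; have cj : covp predT j by apply: (edge_cov d0 Hs).
have lj : lb j = c1 by apply: gc.
have l1 : ple b j.1 by apply: (edge_ge Hs dd cl).
have l2 : ple j.2 b' by apply: (edge_le Hs dd cl).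
have cp := coord_cov c0 Hr cj.
have pe : co j = (r c1 j.1, r c1 j.2) by rewrite /coord lj.
have same f g : cov predT f g -> ple b f -> ple g b' -> s d (r c1 f) != s d (r c1 g) ->
    lab s d0 (f, g) = dd.
  move=> cfg bf gb' ne; have [e1 e2 h] := dl_cube d0 c0 Hs Hr cl cfg bf gb'.
  rewrite gc in e1.
  have cp' := coord_cov c0 Hr (p := (f, g)) cfg.
  set d2 := lab s d0 (f, g) in h *.
  have u' c : dl (co (f, g)) c = par_lab l d2.
    rewrite -(dl_R1 c0 d0 Hr Hs c (R1_coord c0 Hr h)); exact: u.
  have : par_lab l d2 = d.
    apply/eqP; apply: contraR ne => n; apply/eqP.
    by have := u_other c0 Hr Hs cp' u'; rewrite /coord e1 /=; apply; rewrite eq_sym.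
  by rewrite -ed => /inj.
exists (co j), dd; rewrite pe; split.
- by rewrite -pe.
- exact: (r_mono Hr).
- exact: (r_mono Hr).
- by move=> c; rewrite -pe; rewrite -ed; apply: u.
split=> //=.
  have /andP[_ /fixE Bc] := eval_fixed_E c1 eb; rewrite -[RHS](Bc d); apply/eqP; apply: contraT => ne.
  have ne' : s d (r c1 b) != s d (r c1 j.1) by rewrite eq_sym.
  have [f [g [h1 h2 h3 h4]]] := cov_change (phi := fun x => s d (r c1 x)) l1 ne'.
  have e := same f g h2 h1 (ple_tr h3 (ple_tr (cov_le cj) l2)) h4.
  have := lab_neq d0 Hs (p := (f, g)) h2; rewrite e /=.
  have k3 := r_mono Hs dd h3; rewrite (edge1 Hs) // pltxx /= in k3.
  have k1 := r_mono Hs dd h1; rewrite (fixE dd (eval_fixed_B eb)) in k1.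
  by have k2 := r_mono Hs dd (cov_le h2); rewrite (ple_as k2 (ple_tr k3 k1)) eqxx.
apply/eqP; apply: contraT => ne.
have [f [g [h1 h2 h3 h4]]] := cov_change (phi := fun x => s d (r c1 x)) l2 ne.
have e := same f g h2 (ple_tr l1 (ple_tr (cov_le cj) h1)) h3 h4.
have := lab_neq d0 Hs (p := (f, g)) h2; rewrite e /=.
have k1 := r_mono Hs dd h1; rewrite (edge2 Hs) // plexx /= in k1.
have k3 := r_mono Hs dd h3; rewrite (fixE dd (cov_r cb)) in k3.
by have k2 := r_mono Hs dd (cov_le h2); rewrite (ple_as k2 (ple_tr k3 k1)) eqxx.
Qed.

(** The values [s d y] at comparable indices agree by [u_collapse], so [y] is fixed by [s]. An
    [E]-point [z] strictly above [e] and below [y] lies above a cover (e, a) of [A]; in type u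
    another use of [u_collapse] gives [z = y], and type m is contradictory. *)
Lemma u_step b b' : eval_fixed b -> cov B b b' -> utype (b, b') -> injective (par_lab (b, b')) ->
  eval_fixed b' /\ exists c1, [/\ forall c, c != c1 -> r c b = r c b', cov E (r c1 b) (r c1 b') &
     ~~ cov A (r c1 b) (r c1 b')].
Proof.
move=> eb cb u inj; set l := (b, b'); have cl : covp B l := cb.
have [Dc _ _] := bi_D RS.
pose c1 := gl l d0; have gc d : gl l d = c1 by apply: (u_lab eb cl (plexx b) u inj).
have oth c : c != c1 -> r c b = r c b' by apply: (u_other d0 Hs Hr cl gc).
have V := u_step_val eb cb gc u inj.
have Ee := eval_fixed_E c1 eb; set e := r c1 b in Ee V *; set y := r c1 b' in V *.
have /andP[Ae Be] := Ee.
have Ay : A y by apply: fix_r.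
have ley : ple e y by apply: (r_mono Hr); apply: (cov_le cb).
have By : B y.
  apply: (fixr_const d0 Hs Dc) => d d' dd'.
  have [p [_ [cp l1 l2 up [a1 a2 _]]]] := V d; have [p' [_ [cp' l1' l2' up' [a1' a2' _]]]] := V d'.
  rewrite -a2 -a2'; apply: (u_collapse c0 RS Ae Be cp' cp l1' l1 up' up); first by rewrite a1 a1'.
  by rewrite a2 a2'; apply: (r_inc Hs).
have ney : e != y.
  have [p [_ [cp _ _ up [a1 a2 _]]]] := V d0.
  apply/eqP => h; case: (cov_neq cp); apply: (r_inj Hs) => d.
  case: (eqVneq d d0) => [->|n]; last exact: (u_other c0 Hr Hs cp up n).
  by rewrite a1 a2 -h fixE.
have Ey : E y by apply/andP.
have cE : cov E e y.
  apply/covP; split=> //; first by rewrite /plt ney.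
  move=> z /andP[Az Bz] ez zy; case: (ple_eqVlt ez) => [->|ltz]; [by left|right].
  have [a ca az] := cov_up_ex Ae Az ltz; have cea : covp A (e, a) := ca.
  case: (A_types c0 d0 RS Ae Be cea (plexx e)) => [[d [ua _]]|[injA _ surj mm]].
    have k : ple (s d a) (s d0 y).
      rewrite (fixE d0 By) -[y](fixE d By); apply: (r_mono Hs); exact: ple_tr zy.
    have [p [_ [cp l1 l2 up [a1 a2 _]]]] := V d0; rewrite -a2 in k.
    have e1 : s d0 p.1 = s d (e, a).1 by rewrite a1 /= fixE.
    have e2 := u_collapse c0 RS Ae Be cp cea l1 (plexx e) up ua e1 k.
    apply: ple_as => //; rewrite -(fixE d0 By) -a2 -e2 /=.
    by rewrite -[z](fixE d Bz); apply: (r_mono Hs).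
  (* In type m the pair (e, a) is also a cover of [B]. Inserted at index [d0] of [p.1] it becomes an
     edge of the type u interval of [p], so the [C]-labels of its cube are all equal, against
     [mm]. *)
  exfalso.
  have Ba := E_cov_B Ee ca injA.
  have [p [_ [cp l1 l2 up [a1 a2 _]]]] := V d0; rewrite (fixE d0 By) in a2.
  have cB : covp B (e, a).
    have [c dc] := surj d0; have eq := m_coord c0 RS c cea injA; rewrite dc /= !fixE // in eq.
    by rewrite -eq; apply/(coord_cov _ Hs)/(edge_cov c0 Hr).
  have up1 d' : plt d0 d' -> ple a (s d' p.1).
    move=> lt; rewrite (u_other c0 Hr Hs cp up) 1?eq_sym; last by case/andP: lt.
    apply: (ple_tr (ple_tr az zy)); rewrite -a2; apply: (r_inc Hs); exact: pltW.
  have k1 : ple (s d0 p.1) (e, a).1 by rewrite a1 plexx.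
  have [ef eg cfg ls lr] := upd_edge c0 d0 RS Be cB (plexx e) l1 k1 up1.
  set f := upd _ _ _ _ in ef cfg ls lr; set g := upd _ _ _ _ in eg cfg ls lr.
  have pf : ple p.1 f.
    by apply: (r_ext Hs) => d'; rewrite ef; case: eqP => [->|_]; rewrite ?a1 plexx.
  have gp : ple g p.2.
    apply: (r_ext Hs) => d'; rewrite eg; case: eqP => [->|/eqP n] /=.
      by rewrite a2; apply: ple_tr zy.
    by rewrite (u_other c0 Hr Hs cp up n) plexx.
  have [_ cst eqc] := u_cube c0 RS Ae Be cp l1 up cfg pf gp.
  have eco : (s d0 f, s d0 g) = (e, a) by rewrite ef eg eqxx.
  rewrite eco in cst.
  have [_ _ [c [c' /eqP n]]] := bi_C RS; apply: n.
  have := mm c c; have := mm c c'.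
  have -> : coord s d0 (edge r (e, a) c) = (e, a) by rewrite (m_coord c0 RS c cea injA) /= !fixE.
  by rewrite !cst => <- <-.
have nA : ~~ cov A e y.
  apply/negP => cA; have [_ inj'] := Ecov_m c0 d0 RS cE cA.
  have [p [_ [cp l1 l2 up _]]] := V d0.
  have p1 : p.1 = e.
    case: (cov_mid cA (cov_l cp) l1 (ple_tr (cov_le cp) l2)) => // h.
    by move: (plt_nge (cov_lt cp)); rewrite h l2.
  have p2 : p.2 = y.
    case: (cov_mid cA (cov_r cp) (ple_tr l1 (cov_le cp)) l2) => // h.
    by move: (plt_nge (cov_lt cp)); rewrite h p1 plexx.
  have pe : p = (e, y) by rewrite -p1 -p2; case: (p).
  by rewrite pe in cp up; case: (inj_not_const RS cp up inj').
split; last by exists c1.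
split; first exact: (cov_r cb).
by move=> c; case: (eqVneq c c1) => [->//|n]; rewrite -oth //; case: eb.
Qed.

(** Here [par_lab] factors as [cube_lab] after [gl]. Being a monotone injection of the finite [D]
    into itself it reflects the order, which makes [gl] an isomorphism; by [m_coord] each coordinate
    of [b] moves along a cover of [A]. Neighbouring indices have different [C]-labels, so the jump
    alternative of [adj_type] holds and gives the last clause. *)
Lemma m_step b b' : eval_fixed b -> cov B b b' -> mtype (b, b') -> injective (par_lab (b, b')) ->
  [/\ eval_fixed b', iso C D, forall c, cov A (r c b) (r c b') &
     forall c c', cov predT c c' -> ~~ ple (r c b') (r c' b)].
Proof.
move=> eb cb m inj; set l := (b, b'); have cl : covp B l := cb.
have gi := m_gl_inj eb cl (plexx b) m inj.
have [_ mm] : mtype l /\ forall d d', cube_lab l d =1 cube_lab l d'.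
  case: (l_type eb cl (plexx b)) => // u.
  by have [_ _ [c [c' /eqP n]]] := bi_C RS; case: n; apply: (m d0); apply: u.
have co_l d := m_coord d0 SR d cl gi.
have tl d : exists2 c, cube_lab l d0 c = d & forall c', ple (cube_lab l d0 c) (cube_lab l d0 c') -> ple c c'.
  have ov := edge_over_s d0 cl (plexx b); have /andP[Ae Be] := eval_fixed_E (lb (edge s l d0)) eb.
  have cp := coord_cov c0 Hr (over_cov ov).
  have l1 : ple (r (lb (edge s l d0)) b) (co (edge s l d0)).1 by apply/(r_mono Hr)/(over_le ov).
  case: (A_types c0 d0 RS Ae Be cp l1) => [[d1 [u _]]|[_ h surj _]].
    by case: (inj_not_const RS cp u (m d0)).
  by have [c e] := surj d; exists c => // c'; apply: h.
have eqd d : par_lab l d = cube_lab l d0 (gl l d) by rewrite -(mm d d0).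
have dBm d d' : ple d d' -> ple (par_lab l d) (par_lab l d').
  rewrite !eqd => h; apply: (dl_le c0 d0 Hr Hs); last exact: (dl_le d0 c0 Hs Hr).
  exact/(coord_cov c0 Hr)/(edge_cov d0 Hs).
have gsurj c : exists d, gl l d = c.
  exists (invF inj (cube_lab l d0 c)); apply: (m d0).
  by rewrite -eqd f_invF.
have grefl d d' : ple (gl l d) (gl l d') -> ple d d'.
  move=> h; apply: (mono_inj_refl dBm inj); rewrite !eqd; apply: (dl_le c0 d0 Hr Hs) => //.
  exact/(coord_cov c0 Hr)/(edge_cov d0 Hs).
have gle d d' : ple d d' = ple (gl l d) (gl l d').
  by apply/idP/idP => [|/grefl //]; apply: (dl_le d0 c0 Hs Hr).
have covA c : cov A (r c b) (r c b').
  have [d <-] := gsurj c.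
  have : covp A (co (edge s l d)) by apply/(coord_cov c0 Hr)/(edge_cov d0 Hs).
  by rewrite co_l.
have gb : bijective (gl l).
  apply: (inj_card_bij gi); rewrite -(card_codom gi); apply: subset_leq_card.
  by apply/subsetP => c _; have [d <-] := gsurj c; apply: codom_f.
split=> //.
- split; first exact: (cov_r cb).
  move=> c; have [d e] := gsurj c; apply: (E_cov_B (eval_fixed_E c eb) (covA c)).
  by have := m d; rewrite /cube_lab co_l -/l e.
- have [g K1 K2] := gb; exists g; split; first by exists (gl l).
  by move=> c c'; rewrite gle !K2.
move=> c c' cc'; have [d ed] := gsurj c; have [d' ed'] := gsurj c'.
have cd : cov predT d d'.
  rewrite -ed -ed' in cc'; apply/covP; split=> //.
    by have := cov_lt cc'; rewrite /plt -gle (inj_eq gi).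
  move=> z _ h1 h2; rewrite gle in h1; rewrite gle in h2.
  by case: (cov_mid cc' (z := gl l z) isT h1 h2) => /gi; [left|right].
case: (adj_type eb cl (plexx b) cd) => [[e _]|[_ _]].
  by case: (cov_neq cc'); rewrite -ed -ed'.
by rewrite co_l -/(gl l d) -/(gl l d') ed ed'.
Qed.
End Steps.

(** * Recognizing fixed points of [s] by counting labels *)

Section Closure.
Variables (P C D : fposet) (r : C -> P -> P) (s : D -> P -> P) (c0 : C) (d0 : D).
Hypothesis RS : biroot r s.
Let Hr : root r := bi_r RS.
Let Hs : root s := bi_s RS.
Local Notation A := (fixr r).
Local Notation B := (fixr s).
Local Notation dl := (xlab r s d0).
Local Notation E := (bfix r s).
Local Notation co := (coord r c0).
Local Notation xc := (cross_lab r s c0 d0).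
Local Notation dBl := (par_lab r s c0 d0).
Implicit Types (f g x y z b : P) (p q l j : P * P) (c : C) (d : D).

Lemma cross_lab_le b j j' : over b j -> leE b j j' -> ple (xc j) (xc j').
Proof.
move=> ov h; suff : over b j' /\ ple (xc j) (xc j') by case.
apply: (leE_ind (Q := fun j j' => ple (xc j) (xc j')) _ _ _ _ ov h).
- by move=> *; apply: plexx.
- by move=> a a' a''; apply: ple_tr.
- move=> a a' _ _ k; rewrite /cross_lab (R1_lab c0 Hr k).
  by rewrite (dl_R1 c0 d0 Hr Hs _ (R1_coord c0 Hr k)) plexx.
move=> a a' _ _ k; have ca := coord_cov c0 Hr (R2_cov1 k); have ca' := coord_cov c0 Hr (R2_cov2 k).
case: (R2_lab c0 Hr k) => [[e h']|[lt h']]; rewrite /cross_lab; last first.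
  rewrite (dl_R1 c0 d0 Hr Hs _ h'); apply: (dl_le c0 d0 Hr Hs) => //; exact: pltW.
rewrite e; have l' : ple (co a').1 (co a).1.
  by case/and4P: h' => _ cq /eqP -> _; apply: (cov_le cq).
apply: (leE_lab (b := (co a').1) d0 Hs (edge_over c0 Hr _ ca l')).
by apply: (edge_R2 c0 Hr); rewrite // plexx.
Qed.

Lemma par_lab_le l d d' : covp B l -> ple d d' -> ple (dBl l d) (dBl l d').
Proof.
move=> cl h; have lx := plexx l.1.
by apply: cross_lab_le (edge_over d0 Hs d cl lx) (edge_inc d0 Hs cl lx h).
Qed.

Lemma par_lab_R1 l l' d : R1 B l l' -> dBl l d = dBl l' d.
Proof.
move=> h; have k := edge_R1 d0 Hs d h.
by rewrite /par_lab /cross_lab (R1_lab c0 Hr k) (dl_R1 c0 d0 Hr Hs _ (R1_coord c0 Hr k)).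
Qed.

(** A substitute for the equation [par_lab l d = d], which holds over [E]: enough for [u_step] and
    [m_step], and easier to carry to other points. *)
Definition up_inj b := forall l, covp B l -> ple b l.1 -> injective (dBl l).

Section Once.
Variables (b g : P) (I : fposet) (jj : I -> P * P) (phi : I -> P -> bool).
Hypotheses (Bb : B b) (ub : up_inj b) (Icon : connected I).
Hypothesis ov : forall i, over b (jj i).
Hypothesis jg : forall i, ple (jj i).2 g.
Hypothesis adj : forall i i', cov predT i i' -> leE b (jj i) (jj i').
Hypothesis kap : bijective (fun i => xc (jj i)).
Hypothesis phi_mono : forall i f f', ple b f -> ple f f' -> ple f' g -> phi i f -> phi i f'.
Hypothesis phi_edge : forall f f', cov predT f f' -> ple b f -> ple f' g ->
  exists i, [/\ lab s d0 (f, f') = lab s d0 (jj i), phi i f = false & phi i f'].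

(* Every label occurs exactly once between [b] and [g], so each [s d g] covers [b]; comparable
   covers of [b] coincide, hence [g] is fixed by [s]. *)
Lemma fix_of_once : B g.
Proof.
have Dc : connected D by case: (bi_D RS).
pose t i := lab s d0 (jj i); pose q i := coord s d0 (jj i).
have cq i : covp B (q i) by apply/(coord_cov _ Hs)/over_cov/ov.
have bq i : ple b (q i).1 by apply: coord_ge => //; exact: over_le (ov i).
have dBx i : dBl (q i) (t i) = xc (jj i).
  have [h1 h2] := edge_base d0 Hs Bb (ov i); apply: ple_as; last exact: cross_lab_le (ov i) h1.
  exact: cross_lab_le (edge_over d0 Hs _ (cq i) (bq i)) h2.
(* Along a cover of [I] the two label maps are comparable pointwise; monotone injections of the
   finite [D] that are comparable are equal. *)
have dBi i i' : dBl (q i) =1 dBl (q i').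
  suff : finfun (dBl (q i)) = finfun (dBl (q i')).
    by move/ffunP => h d; have := h d; rewrite !ffunE.
  apply: (conn_cov (phi := fun i => finfun (dBl (q i))) Icon) i i' => i i' ci.
  apply/ffunP => d; rewrite !ffunE; apply: inj_le_eq.
  - by move=> x y; apply: par_lab_le (cq i).
  - exact: ub (cq i) (bq i).
  - exact: ub (cq i') (bq i').
  move=> k; have aB := edge_action d0 Hs Bb.
  exact: cross_lab_le (edge_over d0 Hs _ (cq i) (bq i)) (act_le aB k (ov i) (ov i') (adj ci)).
have ti : injective t.
  by move=> i i' e; apply: (bij_inj kap); rewrite -!dBx (dBi i i') e.
have [tinv tK tK'] : bijective t by apply: inj_card_bij; rewrite // (bij_eq_card kap).
have inc d : cov B b (s d g).
  pose i := tinv d; have ei : t i = d by apply: tK'.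
  have cj := over_cov (ov i); have lj := over_le (ov i).
  have c12 : cov B (s d (jj i).1) (s d (jj i).2).
    by have := cq i; rewrite /covp /q /coord -/(t i) ei.
  (* An edge of the interval along which [s d] changes switches [phi i] on, and [phi i] never
     switches off again; so there is no change before the edge [jj i] and none after it. *)
  have same f f' : cov predT f f' -> ple b f -> ple f' g -> s d f != s d f' ->
      phi i f = false /\ phi i f'.
    move=> cff bf fg ne; have [i' [e1 e2 e3]] := phi_edge cff bf fg.
    have e : lab s d0 (f, f') = d by apply: (lab_eq _ Hs (p := (f, f'))).
    have -> : i = i' by apply: ti; rewrite ei -e e1.
    by [].
  have nej : s d (jj i).1 != s d (jj i).2 by apply/eqP; apply: cov_neq c12.
  have cjj : cov predT (jj i).1 (jj i).2 by [].
  have [p1 p2] := same _ _ cjj lj (jg i) nej.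
  have e1 : s d b = s d (jj i).1.
    apply/eqP; apply: contraT => ne.
    have [f [f' [h1 h2 h3 h4]]] := cov_change (phi := s d) lj ne.
    have le1 : ple (jj i).1 g by apply: ple_tr (cov_le cj) (jg i).
    have [_ k] := same f f' h2 h1 (ple_tr h3 le1) h4.
    by move: (phi_mono (ple_tr h1 (cov_le h2)) h3 le1 k); rewrite p1.
  have e2 : s d (jj i).2 = s d g.
    apply/eqP; apply: contraT => ne.
    have [f [f' [h1 h2 h3 h4]]] := cov_change (phi := s d) (jg i) ne.
    have le1 : ple b (jj i).2 by apply: ple_tr lj (cov_le cj).
    have [k _] := same f f' h2 (ple_tr le1 h1) h3 h4.
    by move: (phi_mono le1 h1 (ple_tr (cov_le h2) h3) p2); rewrite k.
  by rewrite -e2 -(fixE d Bb) e1.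
apply: (fixr_const d0 Hs Dc) => d d' dd'.
case: (cov_mid (inc d') (fix_r Hs d g) (cov_le (inc d)) (r_inc Hs g dd')) => // h.
by case: (cov_neq (inc d)); rewrite h.
Qed.
End Once.

(** The pair (e, y) is not a cover of [B], so the general facts on [edge] do not apply and the
    coordinates are computed afresh. Both ends lie in [A] by [Ecov_cube], and a point of [A] between
    them has only the values [e] and [y] at [d], by [Ecov_val]. *)
Lemma Ecov_cube_edge e y d : cov E e y -> ~~ cov A e y ->
  let p := edge s (e, y) d in [/\ covp A p, dl p =1 (fun=> d), ple e p.1 & ple p.2 y].
Proof.
move=> cE nA p; have /andP[Ae Be] := cov_l cE; have /andP[Ay By] := cov_r cE.
have nB : ~~ cov B e y by rewrite -(Ecov_sym c0 d0 RS cE).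
have ley := cov_le cE.
have mon (a1 a2 : bool) : (a1 -> a2) -> ple (if a1 then y else e) (if a2 then y else e).
  by case: a1; case: a2 => // h; rewrite ?plexx //; move: (h isT).
have v1 k : s k p.1 = if plt d k then y else e.
  apply: (mk_upP Hs (f := e)) => [k1 k2 kk||k1].
  - by apply: mon => h; apply: plt_ple_trans kk.
  - by move=> k1 /=; case: ifP.
  - by rewrite fixE //=; case: ifP; rewrite ?plexx.
have v2 k : s k p.2 = if ple d k then y else e.
  apply: (mk_upP Hs (f := e)) => [k1 k2 kk||k1].
  - by apply: mon => h; apply: ple_tr kk.
  - by move=> k1 /=; case: ifP.
  - by rewrite fixE //=; case: ifP; rewrite ?plexx.
have A1 : A p.1 by apply: (Ecov_cube c0 d0 RS cE nA) => k; rewrite v1; case: ifP; auto.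
have A2 : A p.2 by apply: (Ecov_cube c0 d0 RS cE nA) => k; rewrite v2; case: ifP; auto.
have e1 : ple e p.1.
  by apply: (r_ext Hs) => k; rewrite v1 fixE //; case: ifP; rewrite ?plexx.
have e2 : ple p.2 y.
  by apply: (r_ext Hs) => k; rewrite v2 (fixE k By); case: ifP; rewrite ?plexx.
have oth k : k != d -> s k p.1 = s k p.2 by move=> n; rewrite v1 v2 /plt eq_sym n.
have ne : e != y by case/andP: (cov_lt cE).
have cp : covp A p.
  apply/covP; split=> //.
    apply/andP; split.
      by apply/eqP => h; have := v1 d; rewrite h v2 pltxx plexx => h'; rewrite h' eqxx in ne.
    apply: (r_ext Hs) => k; rewrite v1 v2; apply: mon; exact: pltW.
  move=> z Az h1 h2.
  have ez k : k != d -> s k z = s k p.1.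
    move=> n; apply: ple_as; last exact: (r_mono Hs).
    by rewrite oth //; apply: (r_mono Hs).
  case: (Ecov_val c0 d0 RS cE d Az (ple_tr e1 h1) (ple_tr h2 e2)) => h; [left|right];
  apply: (r_inj Hs) => k; case: (eqVneq k d) => [->|n].
  - by rewrite h v1 pltxx.
  - exact: ez.
  - by rewrite h v2 plexx.
  - by rewrite ez // oth.
split=> //.
have [d1 [u k1 k2]] := Ecov_u c0 d0 RS cE nA cp e1 e2.
move=> c; rewrite u; apply/eqP; apply: contraT => n; move: ne.
by rewrite -k1 -k2 oth // eqxx.
Qed.
End Closure.

(** * Lifting edges of [A] to one coordinate of [b] *)

Section Lift.
Variables (P C : fposet) (r : C -> P -> P) (c0 : C).
Hypothesis H : root r.
Local Notation A := (fixr r).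
Local Notation lb := (lab r c0).
Local Notation co := (coord r c0).
Variables (b : P) (c1 : C).
Definition liftable a := [/\ A a, ple (r c1 b) a & forall c, plt c1 c -> ple a (r c b)].
Local Notation L := (upd r b c1).

Lemma liftE a : liftable a -> forall c, r c (L a) = if c == c1 then a else r c b.
Proof. by case=> ? ? ?; apply: upd_upP. Qed.

Lemma lift_ge a : liftable a -> ple b (L a).
Proof.
move=> la; apply: (r_ext H) => c; rewrite liftE //; case: eqP => [->|_]; last exact: plexx.
by case: la.
Qed.

Lemma lift_cov p : liftable p.1 -> liftable p.2 -> covp A p ->
  let j := (L p.1, L p.2) in [/\ covp predT j, lb j = c1 & co j = p].
Proof.
move=> l1 l2 cp j.
have [cj lj] : covp predT j /\ lb j = c1.
  apply: (cov_of_lab _ H); first by move=> c n; rewrite !liftE // (negbTE n).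
  by rewrite !liftE // eqxx.
by split=> //; rewrite /coord lj /= !liftE // eqxx; case: (p).
Qed.

Lemma lift_R1 p j : liftable p.1 -> liftable p.2 -> covp predT j -> lb j = c1 ->
  ple b j.1 -> co j = p \/ R1 A p (co j) -> R1 predT (L p.1, L p.2) j.
Proof.
move=> l1 l2 cj lj bj h.
have cc := coord_cov c0 H cj.
have [cp k1 k2] : [/\ covp A p, ple p.1 (co j).1 & ple p.2 (co j).2].
  by case: h => [<-|/and5P[]] //; split=> //; apply: plexx.
have [cL lL coL] := lift_cov l1 l2 cp.
rewrite /coord lj /= in k1 k2.
apply: (R1_of (c0 := c0) H) => //; first by rewrite lL lj.
- by rewrite coL; case: h => [->|]; [left|right].
- apply: (r_ext H) => c; rewrite liftE //; case: eqP => [->//|_]; exact: (r_mono H).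
apply: (r_ext H) => c; rewrite liftE //; case: eqP => [->//|_]; apply: (r_mono H).
by apply: ple_tr bj _; apply: (cov_le cj).
Qed.

Lemma lift_R2 p q : liftable p.1 -> liftable p.2 -> liftable q.1 -> R2 A p q ->
  R2 predT (L p.1, L p.2) (L q.1, L p.1).
Proof.
move=> l1 l2 l3 /and4P[cp cq /eqP e /forallP no].
have l4 : liftable q.2 by rewrite -e.
have [cL lL coL] := lift_cov l1 l2 cp; have [cM lM coM] := lift_cov l3 l4 cq.
apply/and4P; split=> //=; first by rewrite e.
apply/forallP => m; apply/implyP => h1; apply/implyP => h2.
have l12 := ple_tr (cov_le h1) (cov_le h2).
have oth c : c != c1 -> r c m = r c b.
  move=> n; apply: ple_as.
    by have := r_mono H c (cov_le h2); rewrite liftE // (negbTE n).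
  by have := r_mono H c (cov_le h1); rewrite liftE // (negbTE n).
have k1 : lb (L q.1, m) = c1.
  apply/eqP; apply: contraT => n; have := lab_neq c0 H (p := (_, m)) h1 => /=.
  by rewrite liftE // (negbTE n) oth // eqxx.
have k2 : lb (m, L p.2) = c1.
  apply/eqP; apply: contraT => n; have := lab_neq c0 H (p := (m, _)) h2 => /=.
  by rewrite liftE // (negbTE n) oth // eqxx.
have a1 := coord_cov c0 H (p := (_, m)) h1; have a2 := coord_cov c0 H (p := (m, _)) h2.
rewrite /covp /coord k1 /= liftE // eqxx in a1; rewrite /covp /coord k2 /= liftE // eqxx in a2.
have := no (r c1 m); rewrite /= a1 a2 /= => /eqP em.
apply/eqP; apply: (r_inj H) => c; rewrite liftE //; case: eqP => [->|/eqP n]; last exact: oth.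
by rewrite em e.
Qed.
End Lift.

(** * Converses of the two kinds of steps *)

Section Closure.
Variables (P C D : fposet) (r : C -> P -> P) (s : D -> P -> P) (c0 : C) (d0 : D).
Hypothesis RS : biroot r s.
Let Hr : root r := bi_r RS.
Let Hs : root s := bi_s RS.
Local Notation A := (fixr r).
Local Notation B := (fixr s).
Local Notation dl := (xlab r s d0).
Local Notation E := (bfix r s).
Local Notation lb := (lab r c0).
Local Notation co := (coord r c0).
Local Notation xc := (cross_lab r s c0 d0).
Local Notation UCb := (up_inj r s c0 d0).
Implicit Types (f g x y z b : P) (p q l j : P * P) (c : C) (d : D).

Section U.
Variables (b g y : P) (c1 : C).
Hypotheses (eb : eval_fixed r s b) (ub : UCb b).
Let e := r c1 b.
Hypotheses (cE : cov E e y) (nA : ~~ cov A e y).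
Hypothesis gE : forall c, r c g = if c == c1 then y else r c b.
Let Be : B e. Proof. by case/andP: (cov_l cE). Qed.
Let By : B y. Proof. by case/andP: (cov_r cE). Qed.
Local Notation L := (upd r b c1).
Local Notation Lb := (liftable r b c1).

Let y_up c : plt c1 c -> ple y (r c b).
Proof.
move=> lt; have := r_inc Hr g (pltW lt); rewrite !gE eqxx.
by case: eqP lt => [->|]; rewrite ?pltxx.
Qed.

Let lift_in a : A a -> ple e a -> ple a y -> Lb a.
Proof. by move=> Aa l1 l2; split=> // c /y_up; apply: ple_tr. Qed.

Let le_g f : ple b f -> ple f g -> ple e (r c1 f) /\ ple (r c1 f) y.
Proof.
move=> l1 l2; split; first exact: (r_mono Hr).
by have := r_mono Hr c1 l2; rewrite gE eqxx.
Qed.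

Let pe d := edge s (e, y) d.
Let peP d : [/\ covp A (pe d), dl (pe d) =1 (fun=> d), ple e (pe d).1 & ple (pe d).2 y].
Proof. exact: (Ecov_cube_edge c0 d0 RS). Qed.

Let cubeE (U : pred D) : (forall k k', ple k k' -> U k -> U k') ->
  exists h, [/\ A h, ple e h, ple h y & forall k, s k h = if U k then y else e].
Proof.
move=> up; have ley := cov_le cE.
have v k : s k (mk s e (fun k => if U k then y else e)) = if U k then y else e.
  apply: (mk_upP Hs (f := e)) => [k1 k2 kk||k1].
  - by case: ifP => [/(up _ _ kk) ->|_]; [apply: plexx|case: ifP; rewrite ?plexx].
  - by move=> k1; case: ifP.
  - by rewrite fixE //; case: ifP; rewrite ?plexx.
exists (mk s e (fun k => if U k then y else e)); split=> //.
- by apply: (Ecov_cube c0 d0 RS cE nA) => k; rewrite v; case: ifP; auto.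
- by apply: (r_ext Hs) => k; rewrite v fixE //; case: ifP; rewrite ?plexx.
- by apply: (r_ext Hs) => k; rewrite v (fixE k By); case: ifP; rewrite ?plexx.
Qed.

Let ne : e != y. Proof. by case/andP: (cov_lt cE). Qed.

Let cube_cov x z d : A x -> A z -> ple e x -> ple z y -> (forall k, k != d -> s k x = s k z) ->
  s d x = e -> s d z = y -> cov A x z.
Proof.
move=> Ax Az ex zy oth xe zye; have ley := cov_le cE.
have xz : ple x z.
  by apply: (r_ext Hs) => k; case: (eqVneq k d) => [->|/oth ->]; rewrite ?plexx // xe zye.
apply/covP; split=> //.
  by rewrite /plt xz andbT; apply: contraNneq ne => h; rewrite -xe h zye.
move=> w Aw h1 h2.
have ew k : k != d -> s k w = s k x.
  by move=> n; apply: ple_as; [rewrite oth //|]; apply: (r_mono Hs).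
case: (Ecov_val c0 d0 RS cE d Aw (ple_tr ex h1) (ple_tr h2 zy)) => h; [left|right];
apply: (r_inj Hs) => k; case: (eqVneq k d) => [->|n].
- by rewrite h xe.
- exact: ew.
- by rewrite h zye.
- by rewrite ew // oth.
Qed.

Let pe1 d k : s k (pe d).1 = if plt d k then y else e.
Proof.
have [h [_ _ _ hv]] := @cubeE (plt d) (fun k k' kk h => plt_ple_trans h kk).
by apply: (mkP (r := s)); exists h => k'; rewrite hv.
Qed.
Let pe2 d k : s k (pe d).2 = if ple d k then y else e.
Proof.
have [h [_ _ _ hv]] := @cubeE (ple d) (fun k k' kk h => ple_tr h kk).
by apply: (mkP (r := s)); exists h => k'; rewrite hv.
Qed.

Let peL d : Lb (pe d).1 /\ Lb (pe d).2.
Proof.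
have [cp _ l1 l2] := peP d; have l := cov_le cp.
split; apply: lift_in => //; [exact: cov_l cp|exact: ple_tr l l2|exact: cov_r cp|exact: ple_tr l1 l].
Qed.

(** An instance of [fix_of_once] indexed by [D]: the edge for [d] is the edge in direction [d] of
    the cube of maps from [D] to {e, y}, lifted to coordinate [c1] of [b], and it has been passed at
    [f] when [s d (r c1 f)] equals [y]. *)
Lemma u_closed : B g.
Proof.
have Dc : connected D by case: (bi_D RS).
pose jj d := (L (pe d).1, L (pe d).2).
have jc d : [/\ covp predT (jj d), lb (jj d) = c1 & co (jj d) = pe d].
  by have [l1 l2] := peL d; have [cp _ _ _] := peP d; apply: lift_cov.
have jb d : ple b (jj d).1 by have [l1 _] := peL d; apply: lift_ge.
have jo d : over b (jj d) by rewrite /over jb andbT; case: (jc d).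
have val k f : A f -> ple e f -> ple f y -> s k f = e \/ s k f = y.
  by move=> Af; apply: (Ecov_val c0 d0 RS cE).
apply: (@fix_of_once _ _ _ _ _ c0 d0 RS b g D jj (fun d f => s d (r c1 f) == y)) => //.
- by case: eb.
- move=> d; apply: (r_ext Hr) => c; have [_ l2] := peL d; rewrite liftE // gE; case: eqP => _.
    by case: (peP d).
  exact: plexx.
- move=> d d' cd.
  have [ltd mid] : plt d d' /\ forall k, ple d k -> ple k d' -> k = d \/ k = d'.
    by split; [apply: cov_lt cd|move=> k h1 h2; apply: (cov_mid cd isT h1 h2)].
  have nd : d' != d by rewrite eq_sym; case/andP: ltd.
  (* Everything above [d] except [d'] is raised, as in [edge_adj]: the edge from [h] raises [d'] and
     carries the edge of [d] on top. *)
  have [|h [Ah eh hy hv]] := @cubeE (fun k => plt d k && (k != d')).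
    move=> k k' kk /andP[h1 h2]; rewrite (plt_ple_trans h1 kk) /=.
    apply: contraNneq h2 => e'; rewrite e' in kk.
    case: (mid k (pltW h1) kk) => e2; last by rewrite e2.
    by rewrite e2 pltxx in h1.
  have Lh : Lb h by apply: lift_in.
  have [Ld1 Ld2] := peL d; have [Ld1' Ld2'] := peL d'.
  have [cp _ k1 k2] := peP d; have [cp' _ k1' k2'] := peP d'.
  have cq : covp A (h, (pe d).1).
    apply: (@cube_cov _ _ d') => //.
    - exact: cov_l cp.
    - exact: ple_tr (cov_le cp) k2.
    - by move=> k n; rewrite hv pe1 n andbT.
    - by rewrite hv eqxx andbF.
    - by rewrite pe1 ltd.
  have R2A : R2 A (pe d) (h, (pe d).1).
    apply/and4P; split=> //; apply/forallP => m; apply/implyP => h1; apply/implyP => h2.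
    have Am := cov_r h1.
    have em : ple e m by apply: ple_tr eh (cov_le h1).
    have my : ple m y by apply: ple_tr (cov_le h2) k2.
    have oth k : k != d -> k != d' -> s k m = s k (pe d).1.
      move=> n1 n2; rewrite pe1; apply: ple_as.
        by have := r_mono Hs k (cov_le h2); rewrite pe2 /plt eq_sym n1.
      by have := r_mono Hs k (cov_le h1); rewrite hv n2 andbT.
    have md : s d m = e.
      case: (val d m Am em my) => // md; case: (cov_neq h2).
      apply: (r_inj Hs) => k; rewrite pe2.
      case: (eqVneq k d) => [->|n1]; first by rewrite plexx.
      case: (eqVneq k d') => [->|n2]; last by rewrite oth // pe1 /plt eq_sym n1.
      rewrite (pltW ltd); apply: ple_as; first by rewrite -[X in ple _ X](fixE d' By); apply: (r_mono Hs).
      by rewrite -md; apply: (r_inc Hs); apply: pltW.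
    have md' : s d' m = y.
      case: (val d' m Am em my) => // md'; case: (cov_neq h1).
      apply: (r_inj Hs) => k; rewrite hv.
      case: (eqVneq k d') => [->|n2]; first by rewrite andbF.
      case: (eqVneq k d) => [->|n1]; first by rewrite pltxx.
      by rewrite oth // pe1 andbT.
    apply/eqP; apply: (r_inj Hs) => k; rewrite pe1.
    case: (eqVneq k d') => [->|n2]; first by rewrite ltd.
    case: (eqVneq k d) => [->|n1]; first by rewrite pltxx.
    by rewrite oth // pe1.
  have R1A : R1 A (pe d') (h, (pe d).1).
    apply/and5P; split=> //=.
    - apply: (r_ext Hs) => k; rewrite pe1 hv.
      case: ifP => [lt|_]; first by rewrite (plt_trans ltd lt) eq_sym; case/andP: lt => -> _; apply: plexx.
      by case: ifP; rewrite ?plexx // (cov_le cE).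
    - apply: (r_ext Hs) => k; rewrite pe1 pe2.
      case: ifP => [lt|_]; first by rewrite (plt_ple_trans ltd lt) plexx.
      by case: ifP; rewrite ?plexx // (cov_le cE).
    apply/negP => bad; have := r_mono Hs d' bad; rewrite pe2 plexx hv eqxx andbF => bad'.
    by move: ne; rewrite (ple_as (cov_le cE) bad') eqxx.
  have r2 := lift_R2 (q := (h, (pe d).1)) c0 Hr Ld1 Ld2 Lh R2A.
  have [c2 l2 o2] := lift_cov (p := (h, (pe d).1)) c0 Hr Lh Ld1 cq.
  have bh : ple b (L h, L (pe d).1).1 by apply: lift_ge.
  have r1 : R1 predT (jj d') (L h, L (pe d).1).
    by apply: (lift_R1 (c0 := c0) Hr) => //; right; rewrite o2.
  apply: (leE_trans (q := (L h, L (pe d).1))); first exact: leE_R2 (jb d) bh r2.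
  exact: leE_R1r bh (jb d') r1.
- have xE d : xc (jj d) = d.
    by rewrite /cross_lab; have [_ _ ->] := jc d; have [_ -> _ _] := peP d.
  by exists id => d; rewrite /= xE.
- move=> d f f' bf ff' fg /eqP h; have [_ k2] := le_g (ple_tr bf ff') fg.
  apply/eqP; apply: ple_as; first by rewrite -[X in ple _ X](fixE d By); apply: (r_mono Hs).
  by rewrite -h; apply: (r_mono Hs); apply: (r_mono Hr).
move=> f f' cf bf fg; have lf := cov_le cf.
have oth c : c != c1 -> r c f = r c f'.
  move=> n; apply: ple_as; first exact: (r_mono Hr).
  have h1 := r_mono Hr c fg; rewrite gE (negbTE n) in h1.
  by apply: ple_tr h1 _; apply: (r_mono Hr).
have lff : lb (f, f') = c1.
  apply/eqP; apply: contraT => n; have := lab_neq c0 Hr (p := (f, f')) cf.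
  by rewrite /= oth // eqxx.
have cc := coord_cov c0 Hr (p := (f, f')) cf.
have [e1 _] := le_g bf (ple_tr lf fg); have [_ e2] := le_g (ple_tr bf lf) fg.
have pc : co (f, f') = (r c1 f, r c1 f') by rewrite /coord lff.
rewrite pc in cc.
have [d [u a1 a2]] := Ecov_u c0 d0 RS cE nA cc e1 e2.
exists d; rewrite /= in a1 a2.
split; [|by rewrite a1; apply/negbTE|by rewrite a2].
have [l1 l2] := peL d; have [cp up _ _] := peP d.
apply/esym; apply: (R1_lab d0 Hs).
have othc k : k != d -> s k (r c1 f) = s k (r c1 f') by apply: (u_other c0 Hr Hs cc u).
have ek f1 k : ple b f1 -> ple e (s k (r c1 f1)).
  by move=> h; rewrite -(fixE k Be); apply: (r_mono Hs); apply: (r_mono Hr).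
apply: (lift_R1 (c0 := c0) Hr) => //; right; apply/and5P; split; rewrite ?pc //=.
- apply: (r_ext Hs) => k; rewrite pe1; case: ifP => [lt|_]; last exact: ek.
  rewrite othc; last by rewrite eq_sym; case/andP: lt.
  by rewrite -a2; apply: (r_inc Hs); apply: pltW.
- apply: (r_ext Hs) => k; rewrite pe2; case: ifP => [lt|_]; last exact: ek (ple_tr bf lf).
  by rewrite -a2; apply: (r_inc Hs).
apply/negP => bad; have := r_mono Hs d bad; rewrite pe2 plexx a1 => bad'.
by move: ne; rewrite (ple_as (cov_le cE) bad') eqxx.
Qed.
End U.

Section M.
Variables (b g : P).
Hypotheses (eb : eval_fixed r s b) (ub : UCb b).
Hypothesis cA : forall c, cov A (r c b) (r c g).
Hypothesis Bg : forall c, B (r c g).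
Hypothesis ng : forall c c', cov predT c c' -> ~~ ple (r c g) (r c' b).
Let Ee c : E (r c b) := eval_fixed_E RS c eb.
Let lbg c : ple (r c b) (r c g). Proof. exact: cov_le (cA c). Qed.
Let cE c : cov E (r c b) (r c g).
Proof.
have [_ _ l h] := covP _ _ _ (cA c); apply/covP; split=> //.
  by apply/andP; split; [apply: fix_r|].
by move=> z /andP[Az _]; apply: h.
Qed.

Let cubeE (U : pred C) : (forall k k', ple k k' -> U k -> U k') ->
  exists h, forall k, r k h = if U k then r k g else r k b.
Proof.
move=> up; exists (mk r b (fun k => if U k then r k g else r k b)).
apply: (mk_upP Hr (f := b)) => [k k' kk||k].
- case: ifP => [/(up _ _ kk) ->|_]; first exact: (r_inc Hr).
  by case: ifP => _; [apply: ple_tr (lbg k')|]; apply: (r_inc Hr).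
- by move=> k; case: ifP => _; apply: fix_r.
- by case: ifP; rewrite ?plexx.
Qed.

(** An instance of [fix_of_once] indexed by [C]: the edge for [c] raises coordinate [c] of [b] after
    all larger ones. The hypothesis [ng] prevents neighbouring raises from being exchanged, so
    consecutive edges are comparable in the preorder. *)
Lemma m_closed : B g.
Proof.
have Cc : connected C by case: (bi_C RS).
pose h1 c := mk r b (fun k => if plt c k then r k g else r k b).
pose h2 c := mk r b (fun k => if ple c k then r k g else r k b).
have e1 c k : r k (h1 c) = if plt c k then r k g else r k b.
  have [h hv] := @cubeE (plt c) (fun k k' kk h => plt_ple_trans h kk).
  by apply: (mkP (r := r)); exists h.
have e2 c k : r k (h2 c) = if ple c k then r k g else r k b.
  have [h hv] := @cubeE (ple c) (fun k k' kk h => ple_tr h kk).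
  by apply: (mkP (r := r)); exists h.
pose jj c := (h1 c, h2 c).
have bnd f : (forall k, r k f = r k g \/ r k f = r k b) -> ple b f /\ ple f g.
  move=> hf; split; apply: (r_ext Hr) => k; by case: (hf k) => ->; rewrite ?plexx ?lbg.
have n c : r c b != r c g by apply/eqP; apply: cov_neq (cA c).
have jc c : [/\ covp predT (jj c), lb (jj c) = c & co (jj c) = (r c b, r c g)].
  have [cj lj] : covp predT (jj c) /\ lb (jj c) = c.
    apply: (cov_of_lab _ Hr); first by move=> k nk; rewrite e1 e2 /plt eq_sym nk.
    by rewrite e1 e2 pltxx plexx.
  by split=> //; rewrite /coord lj /= e1 e2 pltxx plexx.
have jb c : ple b (jj c).1 by case: (bnd (h1 c)) => // k; rewrite e1; case: ifP; auto.
have jg c : ple (jj c).2 g by case: (bnd (h2 c)) => // k; rewrite e2; case: ifP; auto.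
have jo c : over b (jj c) by rewrite /over jb andbT; case: (jc c).
have xE c : xc (jj c) = dl (r c b, r c g) c by rewrite /cross_lab; have [_ -> ->] := jc c.
have mid c f : ple b f -> ple f g -> r c f = r c b \/ r c f = r c g.
  by move=> h h'; apply: (cov_mid (cA c) (fix_r Hr _ _)); apply: (r_mono Hr).
apply: (@fix_of_once _ _ _ _ _ c0 d0 RS b g C jj (fun c f => r c f == r c g)) => //.
- by case: eb.
- move=> c c' cc'; have lt := cov_lt cc'.
  have nc : c' != c by rewrite eq_sym; case/andP: lt.
  have [|h hv] := @cubeE (fun k => plt c k && (k != c')).
    move=> k k' kk /andP[k1 k2]; rewrite (plt_ple_trans k1 kk) /=.
    apply: contraNneq k2 => e'; rewrite e' in kk.
    case: (cov_mid cc' isT (pltW k1) kk) => e3; last by rewrite e3.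
    by rewrite e3 pltxx in k1.
  have [bh hg] : ple b (h, h1 c).1 /\ ple h g by apply: bnd => k; rewrite hv; case: ifP; auto.
  have [ch lh] : covp predT (h, h1 c) /\ lb (h, h1 c) = c'.
    apply: (cov_of_lab _ Hr); first by move=> k nk; rewrite hv e1 nk andbT.
    by rewrite hv e1 eqxx andbF lt.
  have oh : co (h, h1 c) = (r c' b, r c' g).
    by rewrite /coord lh /= hv e1 eqxx andbF lt.
  have [cj lj oj] := jc c; have [cj' lj' oj'] := jc c'.
  have r1 : R1 predT (jj c') (h, h1 c).
    apply: (R1_of (c0 := c0) Hr) => //; first (by rewrite lj' lh); first by left; rewrite oj' oh.
      apply: (r_ext Hr) => k; rewrite /= hv e1; case: ifP => [lt'|_].
        by rewrite (plt_trans lt lt') eq_sym; case/andP: lt' => -> _; apply: plexx.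
      by case: ifP; rewrite ?plexx ?lbg.
    apply: (r_ext Hr) => k; rewrite /= e1 e2; case: ifP => [lt'|_].
      by rewrite (plt_ple_trans lt lt') plexx.
    by case: ifP; rewrite ?plexx ?lbg.
  have r2 : R2 predT (jj c) (h, h1 c).
    apply/and4P; split=> //=; apply/forallP => m; apply/implyP => k1; apply/implyP => k2.
    have hm := cov_le k1; have mh := cov_le k2.
    have oth k : k != c -> k != c' -> r k m = r k (h1 c).
      move=> n1 n2; rewrite e1; apply: ple_as.
        by have := r_mono Hr k mh; rewrite e2 /plt eq_sym n1.
      by have := r_mono Hr k hm; rewrite hv n2 andbT.
    have bm : ple b m := ple_tr bh hm; have mg : ple m g := ple_tr mh (jg c).
    have mc : r c m = r c b.
      case: (mid c m bm mg) => // mc.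
      case: (mid c' m bm mg) => mc'.
        by move: (ng cc'); rewrite -mc -mc' (r_inc Hr) ?(pltW lt).
      case: (cov_neq k2); apply: (r_inj Hr) => k; rewrite e2.
      case: (eqVneq k c) => [->|n1]; first by rewrite plexx.
      case: (eqVneq k c') => [->|n2]; first by rewrite (pltW lt).
      by rewrite oth // e1 /plt eq_sym n1.
    have mc' : r c' m = r c' g.
      case: (mid c' m bm mg) => // mc'; case: (cov_neq k1); apply: (r_inj Hr) => k; rewrite hv.
      case: (eqVneq k c') => [->|n2]; first by rewrite andbF.
      case: (eqVneq k c) => [->|n1]; first by rewrite pltxx.
      by rewrite oth // e1 andbT.
    apply/eqP; apply: (r_inj Hr) => k; rewrite e1.
    case: (eqVneq k c') => [->|n2]; first by rewrite lt.
    case: (eqVneq k c) => [->|n1]; first by rewrite pltxx.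
    by rewrite oth // e1.
  apply: (leE_trans (q := (h, h1 c))); first exact: leE_R2 (jb c) bh r2.
  exact: leE_R1r bh (jb c') r1.
(* By [ng], neighbouring coordinate pairs are opposite sides of a square of [A]. So [dl] is the same
   map for all [c], and the label of the edge for [c] is its value at [c]; in type m that is a
   bijection. *)
- have same : forall c c', finfun (dl (r c b, r c g)) = finfun (dl (r c' b, r c' g)).
    apply: (conn_cov (phi := fun c => finfun (dl (r c b, r c g))) Cc) => c c' cc'.
    apply/ffunP => k; rewrite !ffunE; apply: (dl_R1 c0 d0 Hr Hs).
    have lcc := cov_le cc'.
    by apply/and5P; split; rewrite /covp ?cA //=; [apply: (r_inc Hr)|apply: (r_inc Hr)|apply: ng].
  have /andP[Ae Be] := Ee c0.
  have cp : covp A (r c0 b, r c0 g) := cA c0.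
  case: (A_types c0 d0 RS Ae Be cp (plexx _)) => [[d [u _]]|[inj _ surj _]].
    by case: (inj_not_const RS cp u); have [_ k] := Ecov_m c0 d0 RS (cE c0) (cA c0).
  have xE' c : xc (jj c) = dl (r c0 b, r c0 g) c.
    by rewrite xE; have /ffunP/(_ c) := same c c0; rewrite !ffunE.
  have inj' : injective (fun c => xc (jj c)) by move=> c c'; rewrite !xE'; apply: inj.
  apply: (inj_card_bij inj'); rewrite -(card_codom inj'); apply: subset_leq_card.
  apply/subsetP => d _; have [c <-] := surj d; apply/codomP; by exists c; rewrite xE'.
- move=> c f f' bf ff' fg /eqP h; apply/eqP; apply: ple_as; first exact: (r_mono Hr).
  by rewrite -h; apply: (r_mono Hr).
move=> f f' cf bf fg; have lf := cov_le cf.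
pose c := lb (f, f'); have cc := coord_cov c0 Hr (p := (f, f')) cf.
have lc : plt (r c f) (r c f') by apply: cov_lt cc.
have bf' := ple_tr bf lf; have fg' := ple_tr lf fg.
have [ef ef'] : r c f = r c b /\ r c f' = r c g.
  case: (mid c f bf fg') => k1; case: (mid c f' bf' fg) => k2 //; rewrite k1 k2 ?pltxx // in lc.
  by have := lbg c; rewrite (plt_nge lc).
exists c; split; [|by rewrite ef; apply/negbTE|by rewrite ef'].
have [_ oth] := lab_cov c0 Hr (p := (f, f')) cf.
have up : forall k, ple c k -> r k f' = r k g.
  move=> k0; apply: (cov_ind_up (S := predT) (Q := fun k => r k f' = r k g)) => // k k' _ e ckk.
  case: (mid k' f' bf' fg) => // e'; case/negP: (ng ckk).
  by rewrite -e -e'; apply: (r_inc Hr); apply: cov_le ckk.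
have [cj lj oj] := jc c.
apply/esym; apply: (R1_lab d0 Hs); apply: (R1_of (c0 := c0) Hr) => //.
- by left; rewrite oj /coord -/c /= ef ef'.
- apply: (r_ext Hr) => k; rewrite e1; case: ifP => [lt|_]; last exact: (r_mono Hr).
  rewrite oth ?up ?plexx ?(pltW lt) //= eq_sym; by case/andP: lt.
apply: (r_ext Hr) => k; rewrite e2; case: ifP => [lt|_]; last exact: (r_mono Hr).
by rewrite up ?plexx.
Qed.
End M.
End Closure.

(** * Duality and the case of an extremal element *)

Definition swap (T : Type) (p : T * T) : T * T := (p.2, p.1).

Lemma covp_op (P : fposet) (S : pred P) (p : P * P) : @covp (op P) S (swap p) = covp S p.
Proof. exact: cov_op. Qed.

Lemma covp_op' (P : fposet) (S : pred P) (p : op P * op P) : @covp (op P) S p = @covp P S (swap p).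
Proof. exact: cov_op. Qed.

Lemma lab_op (P C : fposet) (r : C -> P -> P) c0 (p : P * P) :
  @lab (op P) (op C) r c0 (swap p) = lab r c0 p.
Proof. by rewrite /lab; congr odflt; apply: eq_pick => c /=; rewrite eq_sym. Qed.

Lemma lab_op' (P C : fposet) (r : C -> P -> P) c0 (p : op P * op P) :
  @lab (op P) (op C) r c0 p = @lab P C r c0 (swap p).
Proof. by rewrite /lab; congr odflt; apply: eq_pick => c /=; rewrite eq_sym. Qed.

Lemma coord_op' (P C : fposet) (r : C -> P -> P) c0 (p : op P * op P) :
  @coord (op P) (op C) r c0 p = swap (@coord P C r c0 (swap p)).
Proof. by rewrite /coord lab_op'. Qed.

Lemma coord_op (P C : fposet) (r : C -> P -> P) c0 (p : P * P) :
  @coord (op P) (op C) r c0 (swap p) = swap (coord r c0 p).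
Proof. by rewrite /coord lab_op. Qed.

(** The standard edge of the dual structure lies in the same cube and has the same label, so
    [R1_cube] places it across a square from the standard edge. *)
Lemma edge_op (P C : fposet) (r : C -> P -> P) (c0 : C) (p : P * P) c : root r -> covp (fixr r) p ->
  R1 predT (edge r p c) (swap (@edge (op P) (op C) r (swap p) c)).
Proof.
move=> Hr cp; have Ho := root_op Hr.
have cp' : @covp (op P) (fixr r) (swap p) by rewrite covp_op.
set q := @edge (op P) (op C) r (swap p) c.
have cq : @covp P predT (swap q) by rewrite -(@covp_op' P); apply: (edge_cov (C := op C) c0 Ho c cp').
have lq : @lab P C r c0 (swap q) = c by rewrite -(@lab_op' P); apply: (edge_lab (C := op C) c0 Ho c cp').
have [_] := R1_cube c0 Hr cp cq (edge_le Ho c cp') (edge_ge Ho c cp').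
by rewrite lq.
Qed.

Section Op.
Variables (P C D : fposet) (r : C -> P -> P) (s : D -> P -> P) (c0 : C) (d0 : D).
Hypotheses (Hr : root r) (Hs : root s).
Implicit Types (p j l : P * P) (c : C) (d : D).

Lemma xlab_op p c : covp (fixr r) p ->
  @xlab (op P) (op C) (op D) r s d0 (swap p) c = xlab r s d0 p c.
Proof.
move=> cp; by rewrite /xlab (R1_lab d0 Hs (edge_op c0 c Hr cp)) -(@lab_op' P).
Qed.

Lemma cross_lab_op j : covp predT j ->
  @cross_lab (op P) (op C) (op D) r s c0 d0 (swap j) = cross_lab r s c0 d0 j.
Proof. by move=> cj; rewrite /cross_lab coord_op xlab_op ?lab_op //; apply: (coord_cov c0 Hr). Qed.

Lemma cube_lab_op l d c : covp (fixr s) l ->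
  @cube_lab (op P) (op C) (op D) r s c0 d0 (swap l) d c = cube_lab r s c0 d0 l d c.
Proof.
move=> cl; rewrite /cube_lab; have h := edge_op d0 d Hs cl.
rewrite (@coord_op' P) xlab_op; last by apply/(coord_cov c0 Hr)/(R1_cov2 h).
by rewrite -(dl_R1 c0 d0 Hr Hs c (R1_coord c0 Hr h)).
Qed.

Lemma cross_lab_R1 j j' : R1 predT j j' -> cross_lab r s c0 d0 j = cross_lab r s c0 d0 j'.
Proof.
by move=> h; rewrite /cross_lab (R1_lab c0 Hr h) (dl_R1 c0 d0 Hr Hs _ (R1_coord c0 Hr h)).
Qed.

Lemma par_lab_op l d : covp (fixr s) l ->
  @par_lab (op P) (op C) (op D) r s c0 d0 (swap l) d = par_lab r s c0 d0 l d.
Proof.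
move=> cl; rewrite /par_lab; have h := edge_op d0 d Hs cl.
rewrite (cross_lab_R1 h) -cross_lab_op //; last exact: R1_cov2 h.
Qed.
End Op.

Section Top.
Variables (P C D : fposet) (r : C -> P -> P) (s : D -> P -> P) (c0 : C) (d0 : D).
Hypotheses (Hr : root r) (Hs : root s).
Local Notation A := (fixr r).
Implicit Types (p j l : P * P) (c : C) (d : D) (f h : P).

Let above p c h := r c h = p.1 /\ forall k, plt c k -> ple p.2 (r k h).

Lemma edge_at p c h : covp A p -> above p c h ->
  let j := (h, upd r h c p.2) in [/\ covp predT j, lab r c0 j = c, coord r c0 j = p &
    forall k, r k (upd r h c p.2) = if k == c then p.2 else r k h].
Proof.
move=> cp [e1 up] j.
have ej : forall k, r k (upd r h c p.2) = if k == c then p.2 else r k h.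
  by apply: (upd_upP Hr) => //; [apply: cov_r cp|rewrite e1; apply: cov_le cp].
have [cj lj] : covp predT j /\ lab r c0 j = c.
  apply: (cov_of_lab _ Hr); first by move=> k n; rewrite ej (negbTE n).
  by rewrite ej eqxx e1.
by split=> //; rewrite /coord lj /= ej eqxx e1; case: (p).
Qed.

Lemma edge_at_lab p c h h' : covp A p -> above p c h -> above p c h' -> ple h h' ->
  lab s d0 (h, upd r h c p.2) = lab s d0 (h', upd r h' c p.2).
Proof.
move=> cp u u' hh; have [cj lj oj ej] := edge_at cp u; have [cj' lj' oj' ej'] := edge_at cp u'.
apply: (R1_lab d0 Hs); apply: (R1_of (c0 := c0) Hr) => //; first by rewrite lj lj'.
  by left; rewrite oj oj'.
apply: (r_ext Hr) => k; rewrite ej ej'; case: eqP => _; first exact: plexx.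
exact: (r_mono Hr).
Qed.

(* The zigzag [h <= h1 >= h2 <= h3] keeps the coordinate [c] and ends in the cube of [p]; going
   up to [h1] is where the top is used. *)
Lemma cross_lab_top (t : C) : (forall c, ple c t) ->
  forall j, covp predT j -> cross_lab r s c0 d0 j = lab s d0 j.
Proof.
move=> tt j cj; set c := lab r c0 j; set p := coord r c0 j.
have cp : covp A p by apply: (coord_cov c0 Hr).
have le12 := cov_le cp.
pose h := j.1; pose a := r t h.
have [_ oth] := lab_cov c0 Hr cj.
have u0 : above p c h by split=> // k lt; apply: (lab_above Hr cj).
have ej : j = (h, upd r h c p.2).
  rewrite (surjective_pairing j); congr (_, _); apply: (r_inj Hr) => k.
  have [_ _ _ ->] := edge_at cp u0; case: eqP => [->//|/eqP n]; by rewrite -oth.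
have ya k : ~~ ple k c -> ple p.2 a.
  move=> nk; apply: (lab_above Hr cj); rewrite /plt tt andbT; apply: contraNneq nk => e.
  by rewrite /c e.
pose F (z : P) k := if ple k c then r k h else z.
have Fm z : A z -> (forall k k', ple k c -> ~~ ple k' c -> ple (r k h) z) ->
    (forall k k', ple k k' -> ple (F z k) (F z k')) /\ forall k, A (F z k).
  move=> Az hz; split=> [k k' kk|k]; rewrite /F; last by case: ifP => _ //; apply: fix_r.
  case: ifP => kc; case: ifP => kc'; rewrite ?plexx //; first exact: (r_inc Hr).
    by apply: hz kc (negbT kc').
  by rewrite (ple_tr kk kc') in kc.
have [m1 f1] := Fm a (fix_r Hr t h) (fun k k' _ _ => r_inc Hr h (tt k)).
have e1 k : r k (mk r h (F a)) = F a k.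
  apply: (mk_upP Hr (f := h)) => // k'; rewrite /F; case: ifP => _; first exact: plexx.
  exact: (r_inc Hr).
set h1 := mk r h (F a) in e1.
have [m2 f2] := Fm p.2 (cov_r cp) (fun k k' kc _ => ple_tr (r_inc Hr h kc) le12).
have e2 k : r k (mk r h (F p.2)) = F p.2 k.
  apply: (mk_dnP Hr (f := h1)) => // k'; rewrite e1 /F; case: ifP => nk; first exact: plexx.
  exact: ya (negbT nk).
set h2 := mk r h (F p.2) in e2.
have e3 k : r k (mk r p.1 (fun k => if ple k c then p.1 else p.2)) = if ple k c then p.1 else p.2.
  apply: (mk_upP Hr (f := p.1)) => [k1 k2 kk||k1].
  - case: ifP => kc; case: ifP => kc'; rewrite ?plexx //.
    by rewrite (ple_tr kk kc') in kc.
  - by move=> k1; case: ifP => _; [apply: (cov_l cp)|apply: (cov_r cp)].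
  - by rewrite fixE ?(cov_l cp) //; case: ifP; rewrite ?plexx.
set h3 := mk r p.1 _ in e3.
have u1 : above p c h1.
  split; first by rewrite e1 /F plexx.
  by move=> k lt; rewrite e1 /F (plt_nge lt) /=; apply: (ya k); rewrite (plt_nge lt).
have u2 : above p c h2.
  split; first by rewrite e2 /F plexx.
  by move=> k lt; rewrite e2 /F (plt_nge lt) plexx.
have u3 : above p c h3.
  split; first by rewrite e3 plexx.
  by move=> k lt; rewrite e3 (plt_nge lt) plexx.
have l01 : ple h h1.
  apply: (r_ext Hr) => k; rewrite e1 /F; case: ifP => _; first exact: plexx.
  exact: (r_inc Hr).
have l21 : ple h2 h1.
  apply: (r_ext Hr) => k; rewrite e1 e2 /F; case: ifP => nk; first exact: plexx.
  exact: ya (negbT nk).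
have l23 : ple h2 h3.
  apply: (r_ext Hr) => k; rewrite e2 e3 /F; case: ifP => kc; last exact: plexx.
  by rewrite -(proj1 u0); apply: (r_inc Hr).
have [cj3 lj3 oj3 ej3] := edge_at cp u3.
have k1 : ple p.1 h3.
  by apply: (r_ext Hr) => k; rewrite e3 fixE ?(cov_l cp) //; case: ifP; rewrite ?plexx.
have k2 : ple (upd r h3 c p.2) p.2.
  apply: (r_ext Hr) => k; rewrite ej3 e3 (fixE k (cov_r cp)).
  by case: eqP => _; [|case: ifP => _]; rewrite ?plexx.
have [-> _ _] : [/\ cross_lab r s c0 d0 j = lab s d0 (h3, upd r h3 c p.2), True & True].
  by split=> //; have [-> _ _] := dl_cube c0 d0 Hr Hs cp cj3 k1 k2; rewrite lj3.
rewrite [in RHS]ej (edge_at_lab cp u0 u1 l01) -(edge_at_lab cp u2 u1 l21).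
by rewrite (edge_at_lab cp u2 u3 l23).
Qed.
End Top.

Lemma cross_lab_bot (P C D : fposet) (r : C -> P -> P) (s : D -> P -> P) (c0 : C) (d0 : D) (t : C) :
  root r -> root s -> (forall c, ple t c) ->
  forall j, covp predT j -> cross_lab r s c0 d0 j = lab s d0 j.
Proof.
move=> Hr Hs tt j cj; rewrite -(cross_lab_op c0 d0 Hr Hs cj) -(@lab_op P D).
have h := @cross_lab_top (op P) (op C) (op D) r s c0 d0 (root_op Hr) (root_op Hs) t tt (swap j).
by apply: h; rewrite covp_op.
Qed.

(** Under the hypothesis [par_lab l d] is the label of an edge of direction [d], that is, [d]
    itself. *)
Lemma par_lab_inj (P C D : fposet) (r : C -> P -> P) (s : D -> P -> P) (c0 : C) (d0 : D) :
  root s -> (forall j, covp predT j -> cross_lab r s c0 d0 j = lab s d0 j) ->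
  forall l, covp (fixr s) l -> injective (par_lab r s c0 d0 l).
Proof.
move=> Hs h l cl d d'; have ce k : covp predT (edge s l k) by apply: (edge_cov d0 Hs).
by rewrite /par_lab !h // !(edge_lab d0 Hs).
Qed.

(** * The case of several extremal elements *)

Section Pointwise.
Variables (P T : fposet).
Local Notation Q := (exp_poset P T).
Implicit Types (F G : Q) (t : T).

Lemma expP F G : reflect (forall t, ple (val F t) (val G t)) (ple F G).
Proof. exact: forallP. Qed.

Lemma exp_ext F G : (forall t, val F t = val G t) -> F = G.
Proof. by move=> h; apply/val_inj/ffunP. Qed.

Lemma exp_mono F t t' : ple t t' -> ple (val F t) (val F t').
Proof. by case: F => f /= /forallP/(_ t)/forallP/(_ t')/implyP. Qed.

Lemma exp_build (f : T -> P) : (forall t t', ple t t' -> ple (f t) (f t')) ->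
  exists F, forall t, val F t = f t.
Proof.
move=> h; have m : monob [ffun t => f t].
  by apply/forallP => t; apply/forallP => t'; apply/implyP => tt'; rewrite !ffunE; apply: h.
by exists (exist (fun f : {ffun T -> P} => is_true (monob f)) _ m) => t; rewrite /= ffunE.
Qed.

Variables (C : fposet) (r : C -> P -> P).
Definition proot (c : C) (F : Q) : Q := insubd F [ffun t => r c (val F t)].
Hypothesis Hr : root r.

Lemma prootE c F t : val (proot c F) t = r c (val F t).
Proof.
rewrite /proot val_insubd; case: ifP => [_|/negbT/negP []]; first by rewrite ffunE.
apply/forallP => x; apply/forallP => y; apply/implyP => xy; rewrite !ffunE.
by apply/(r_mono Hr)/exp_mono.
Qed.

Lemma proot_root : root proot.
Proof.
split.
- by move=> c F G /expP h; apply/expP => t; rewrite !prootE; apply: (r_mono Hr).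
- by move=> c c' F; apply: exp_ext => t; rewrite !prootE (r_abs Hr).
- by move=> c c' F cc'; apply/expP => t; rewrite !prootE; apply: (r_inc Hr).
- move=> F G h; apply/expP => t; apply: (r_ext Hr) => c.
  by move/expP: (h c) => /(_ t); rewrite !prootE.
- move=> F a am fx h.
  have e t c : r c (mk r (val F t) (fun c => val (a c) t)) = val (a c) t.
    apply: (mk_upP Hr (f := val F t)) => [k k' kk||k].
    + by move/expP: (am _ _ kk).
    + by move=> k; apply/fixP => k'; rewrite -prootE fx.
    + by move/expP: (h k) => /(_ t); rewrite prootE.
  have [|G hG] := @exp_build (fun t => mk r (val F t) (fun c => val (a c) t)).
    by move=> t t' tt'; apply: (r_ext Hr) => c; rewrite !e; apply: exp_mono.
  by exists G => c; apply: exp_ext => t; rewrite prootE hG e.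
- move=> F a am fx h.
  have e t c : r c (mk r (val F t) (fun c => val (a c) t)) = val (a c) t.
    apply: (mk_dnP Hr (f := val F t)) => [k k' kk||k].
    + by move/expP: (am _ _ kk).
    + by move=> k; apply/fixP => k'; rewrite -prootE fx.
    + by move/expP: (h k) => /(_ t); rewrite prootE.
  have [|G hG] := @exp_build (fun t => mk r (val F t) (fun c => val (a c) t)).
    by move=> t t' tt'; apply: (r_ext Hr) => c; rewrite !e; apply: exp_mono.
  by exists G => c; apply: exp_ext => t; rewrite prootE hG e.
Qed.

Lemma proot_fix F : reflect (forall t, fixr r (val F t)) (fixr proot F).
Proof.
apply: (iffP idP) => [h t|h]; apply/fixP => c; first by rewrite -prootE fixE.
by apply: exp_ext => t; rewrite prootE fixE.
Qed.
End Pointwise.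

(* The edges of [P] over [b] carry the action of [s]; in [exp_poset P C], where [P] sits as the
   fixed points of the pointwise structure [proot r] and [b] becomes a common fixed point, the
   edges carry a second action of [D], by [proot s].  Both live on the edges over [row b]. *)
Section Dichotomy.
Variables (P C D : fposet) (r : C -> P -> P) (s : D -> P -> P) (c0 : C) (d0 : D).
Hypothesis RS : biroot r s.
Let Hr : root r := bi_r RS.
Let Hs : root s := bi_s RS.
Local Notation B := (fixr s).
Local Notation dl := (xlab r s d0).
Local Notation Q := (exp_poset P C).
Local Notation ro := (@proot P C C r).
Local Notation si := (@proot P C D s).
Let Hro : root ro := proot_root C Hr.
Let Hsi : root si := proot_root C Hs.
Implicit Types (f g h x y z : P) (p q l j : P * P) (c : C) (d : D) (X Y : Q) (u v : Q * Q).
Variable b : P.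
Hypothesis eb : eval_fixed r s b.

Lemma row_mono h : monob [ffun t : C => r t h].
Proof.
apply/forallP => t; apply/forallP => t'; apply/implyP => tt'; rewrite !ffunE; exact: (r_inc Hr).
Qed.
Definition row h : Q := exist (fun f : {ffun C -> P} => is_true (monob f)) _ (row_mono h).
Definition unrow X : P := mk r b (fun t => val X t).
Definition rowp j : Q * Q := (row j.1, row j.2).
Definition urp u : P * P := (unrow u.1, unrow u.2).

Lemma rowE h t : val (row h) t = r t h. Proof. by rewrite /= ffunE. Qed.
Lemma row_le f g : ple (row f) (row g) = ple f g.
Proof.
apply/idP/idP => [/expP h|h]; last by apply/expP => t; rewrite !rowE; apply: (r_mono Hr).
by apply: (r_ext Hr) => t; move: (h t); rewrite !rowE.
Qed.
Lemma row_inj : injective row.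
Proof. by move=> f g e; apply: ple_as; rewrite -row_le e plexx. Qed.
Lemma row_fix h : fixr ro (row h).
Proof. by apply/(proot_fix Hr) => t; rewrite rowE; apply: (fix_r Hr). Qed.
Lemma unrow_val X : fixr ro X -> ple (row b) X -> forall t, r t (unrow X) = val X t.
Proof.
move=> /(proot_fix Hr) fX /expP l; apply: (mk_upP Hr (f := b)) => [t t' tt'||t].
- exact: exp_mono.
- exact: fX.
- by have := l t; rewrite rowE.
Qed.
Lemma unrowK X : fixr ro X -> ple (row b) X -> row (unrow X) = X.
Proof. by move=> fX l; apply: exp_ext => t; rewrite rowE unrow_val. Qed.
Lemma rowK h : ple b h -> unrow (row h) = h.
Proof. by move=> l; apply/row_inj/unrowK; rewrite ?row_fix ?row_le. Qed.

Lemma row_cov f g : ple b f -> cov (fixr ro) (row f) (row g) = cov predT f g.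
Proof.
move=> bf; apply/covP/covP => -[h1 h2 h3 h4]; split; rewrite ?row_fix //.
- by move: h3; rewrite /plt row_le (inj_eq row_inj).
- move=> z _ fz zg; case: (h4 (row z) (row_fix z)); rewrite ?row_le // => /row_inj; auto.
- by move: h3; rewrite /plt row_le (inj_eq row_inj).
move=> Z fZ l1 l2; have bZ : ple (row b) Z by apply: ple_tr l1; rewrite row_le.
rewrite -(unrowK fZ bZ) !row_le in l1 l2 *.
by case: (h4 (unrow Z) isT l1 l2) => ->; auto.
Qed.

Lemma rowp_over j : over b j -> covp (fixr ro) (rowp j) /\ ple (row b) (rowp j).1.
Proof. by case/andP => cj lj; rewrite /covp row_cov // row_le. Qed.

Lemma rowp_urp u : covp (fixr ro) u -> ple (row b) u.1 -> rowp (urp u) = u /\ over b (urp u).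
Proof.
move=> cu lu; have l2 := ple_tr lu (cov_le cu).
have e : rowp (urp u) = u.
  by rewrite /rowp /urp /= !unrowK ?(cov_l cu) ?(cov_r cu) //; case: (u).
split=> //; have b1 : ple b (unrow u.1) by rewrite -row_le unrowK ?(cov_l cu).
have h : cov (fixr ro) (row (unrow u.1)) (row (unrow u.2)) by move: cu; rewrite -{1}e.
by rewrite (row_cov _ b1) in h; apply/andP.
Qed.

Lemma urp_rowp j : over b j -> urp (rowp j) = j.
Proof.
case/andP => cj lj; rewrite /urp /= !rowK //; first by case: (j).
exact: ple_tr (cov_le cj).
Qed.

Lemma row_R1 j j' : over b j -> over b j' -> R1 (fixr ro) (rowp j) (rowp j') = R1 predT j j'.
Proof.
case/andP => cj lj; case/andP => cj' lj'.
have e1 : covp (fixr ro) (rowp j) = covp predT j := row_cov _ lj.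
have e2 : covp (fixr ro) (rowp j') = covp predT j' := row_cov _ lj'.
by rewrite /R1 e1 e2; congr [&& _, _, _, _ & ~~ _]; apply: row_le.
Qed.

Lemma row_R2 j j' : over b j -> over b j' -> R2 (fixr ro) (rowp j) (rowp j') = R2 predT j j'.
Proof.
case/andP => cj lj; case/andP => cj' lj'.
have e1 : covp (fixr ro) (rowp j) = covp predT j := row_cov _ lj.
have e2 : covp (fixr ro) (rowp j') = covp predT j' := row_cov _ lj'.
rewrite /R2 e1 e2; congr [&& _, _, _ & _]; first exact: (inj_eq row_inj).
apply/forallP/forallP => h.
  move=> m; apply/implyP => h1; apply/implyP => h2; have := h (row m).
  rewrite (row_cov _ lj') h1 (inj_eq row_inj) /= row_cov; last exact: ple_tr (cov_le h1).
  by rewrite h2.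
move=> M; apply/implyP => h1; apply/implyP => h2.
have bM : ple (row b) M by apply: ple_tr (cov_le h1); rewrite row_le.
have := unrowK (cov_r h1) bM; move: (unrow M) => m em; move: h1 h2 bM; rewrite -em.
rewrite row_le => h1 h2 bm; rewrite (row_cov _ lj') in h1; rewrite (row_cov _ bm) in h2.
by have := h m; rewrite h1 h2 (inj_eq row_inj).
Qed.

Let bro : fixr ro (row b). Proof. exact: row_fix. Qed.
Let bsi : fixr si (row b).
Proof. by apply/(proot_fix Hs) => t; rewrite rowE; case: eb. Qed.

Lemma leE_row c j j' : over b j -> leE b j j' ->
  leE (row b) (edge ro (rowp j) c) (edge ro (rowp j') c).
Proof.
move=> ov h.
suff : over b j' /\ leE (row b) (edge ro (rowp j) c) (edge ro (rowp j') c) by case.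
apply: (leE_ind (Q := fun j j' => leE (row b) (edge ro (rowp j) c) (edge ro (rowp j') c)) _ _ _ _ ov h).
- by move=> *; apply: leE_refl.
- by move=> a a' a''; apply: leE_trans.
- move=> a a' oa oa' k; have [ca la] := rowp_over oa; have [ca' la'] := rowp_over oa'.
  apply: leE_R1; try exact: over_le (edge_over c0 Hro _ _ _).
  by apply: (edge_R1 c0 Hro); rewrite row_R1.
- move=> a a' oa oa' k; have [ca la] := rowp_over oa; have [ca' la'] := rowp_over oa'.
  by apply: (edge_R2 c0 Hro); rewrite // row_R2.
Qed.

Lemma coord_over u : over (row b) u ->
  let p := coord ro c0 u in rowp (urp p) = p /\ over b (urp p).
Proof.
case/andP => cu lu; apply: rowp_urp; first exact: (coord_cov c0 Hro).
exact: (coord_ge c0 Hro).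
Qed.

Lemma leE_urp u v : over (row b) u -> leE (row b) u v ->
  leE b (urp (coord ro c0 u)) (urp (coord ro c0 v)).
Proof.
move=> ou h.
suff : over (row b) v /\ leE b (urp (coord ro c0 u)) (urp (coord ro c0 v)) by case.
apply: (leE_ind (Q := fun u v => leE b (urp (coord ro c0 u)) (urp (coord ro c0 v))) _ _ _ _ ou h).
- by move=> *; apply: leE_refl.
- by move=> a a' a''; apply: leE_trans.
- move=> a a' oa oa' k; have [ca la] := coord_over oa; have [ca' la'] := coord_over oa'.
  apply: (leE_R1 (over_le la) (over_le la')).
  by rewrite -(row_R1 la la') ca ca'; apply: (R1_coord c0 Hro).
- move=> a a' oa oa' k; have [ca la] := coord_over oa; have [ca' la'] := coord_over oa'.
  case: (R2_lab c0 Hro k) => -[_ k'].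
    apply: (leE_R2 (over_le la) (over_le la')).
    by rewrite -(row_R2 la la') ca ca'.
  apply: (leE_R1l (over_le la) (over_le la')).
  by rewrite -(row_R1 la la') ca ca'.
Qed.

Let labD u := lab s d0 (urp (coord ro c0 u)).
Let actD u d := edge ro (rowp (edge s (coord s d0 (urp (coord ro c0 u))) d)) (lab ro c0 u).

Lemma edge_rowK j c : over b j -> urp (coord ro c0 (edge ro (rowp j) c)) = j.
Proof. by move=> oj; have [cj _] := rowp_over oj; rewrite (edge_coord c0 Hro) // urp_rowp. Qed.

Lemma edge_row_over j c : over b j -> over (row b) (edge ro (rowp j) c).
Proof. by move=> oj; have [cj lj] := rowp_over oj; apply: (edge_over c0 Hro). Qed.

Let aB := edge_action d0 Hs (proj1 eb).

(** The action moves the underlying edge of [P] inside the cube of its [s]-coordinate and keeps the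
    direction in which the row edge runs. *)
Lemma row_action : action (over (row b)) (leE (row b)) labD actD.
Proof.
have oa u d : over (row b) u -> over b (edge s (coord s d0 (urp (coord ro c0 u))) d).
  by move=> ou; have [_ o] := coord_over ou; apply: (act_V aB).
split.
- by move=> u d ou; apply/edge_row_over/oa.
- move=> u d ou; rewrite /labD edge_rowK; last exact: oa.
  by have [_ o] := coord_over ou; apply: (act_lab aB).
- move=> u ou; have [e o] := coord_over ou; have /andP[k1 k2] := act_id aB o.
  have [b1 b2] := edge_base c0 Hro bro ou.
  rewrite -[in edge ro (coord _ _ _) _]e in b1 b2.
  apply/andP; split.
    by apply: leE_trans b2; apply: leE_row k1; apply: oa.
  by apply: leE_trans b1 _; apply: leE_row k2.
- move=> u d d' ou; have [e o] := coord_over ou.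
  rewrite /eqv /actD edge_rowK; last exact: oa.
  rewrite (edge_lab c0 Hro); last by case: (rowp_over (oa u d ou)).
  have /andP[k1 k2] := act_act aB d d' o.
  have o2 := act_V aB d' (act_V aB d o).
  by rewrite (leE_row _ o2 k1) (leE_row _ (oa u d' ou) k2).
- move=> u v d ou ov h; have [e o] := coord_over ou; have [e' o'] := coord_over ov.
  have k := act_le aB d o o' (leE_urp ou h).
  apply: leE_trans (leE_row _ (oa u d ou) k) _.
  have [cr lr] := rowp_over (oa v d ov).
  by apply: (edge_inc c0 Hro) => //; apply: (leE_lab c0 Hro ou).
- move=> u v ou ov h; have [e o] := coord_over ou; have [e' o'] := coord_over ov.
  by apply: (lab_le aB) => //; apply: leE_urp.
- move=> u d d' ou h; have [e o] := coord_over ou.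
  by apply: leE_row (act_inc aB o h); apply: oa.
Qed.

(** Evaluation at the [C]-label of [j] turns the row edge in direction [c] into the edge in
    direction [c] of the cube of [coord r c0 j]. A change of an [s]-coordinate there is a change in
    the pointwise structure as well. *)
Lemma lab_row j c : over b j -> lab si d0 (edge ro (rowp j) c) = dl (coord r c0 j) c.
Proof.
move=> oj; have [cr _] := rowp_over oj; have cj := over_cov oj.
have cp := coord_cov c0 Hr cj; set p := coord r c0 j in cp *.
set t := lab r c0 j.
have pe : p = (r t j.1, r t j.2) by [].
have e1 : val (edge ro (rowp j) c).1 t = (edge r p c).1.
  apply: (r_inj Hr) => k; rewrite -(prootE Hr) !(edge1 (r := ro)) // (edge1 Hr) // pe.
  by case: ifP => _; rewrite /= ffunE.
have e2 : val (edge ro (rowp j) c).2 t = (edge r p c).2.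
  apply: (r_inj Hr) => k; rewrite -(prootE Hr) !(edge2 (r := ro)) // (edge2 Hr) // pe.
  by case: ifP => _; rewrite /= ffunE.
apply: (lab_eq _ Hsi); first exact: (edge_cov c0 Hro).
have ce := edge_cov c0 Hr c cp.
apply: contra_neq (lab_neq d0 Hs ce) => e.
have q1 := prootE Hs (dl p c) (edge ro (rowp j) c).1 t.
have q2 := prootE Hs (dl p c) (edge ro (rowp j) c).2 t.
rewrite e1 in q1; rewrite e2 in q2.
exact: etrans (esym q1) (etrans (congr1 (fun F : Q => val F t) e) q2).
Qed.

Local Notation psi := (cube_lab r s c0 d0).
Let aS := edge_action d0 Hsi bsi.
Let letr (y x z : Q * Q) := @leE_trans Q (row b) y x z.
Let fD := bi_D RS.

Lemma actD_psi l d c : covp B l -> ple b l.1 ->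
  lab si d0 (actD (edge ro (rowp (edge s l d0)) c) d) = psi l d c.
Proof.
move=> cl bl; have o k : over b (edge s l k) by apply: (edge_over d0 Hs).
rewrite /actD edge_rowK // (edge_coord d0 Hs) // (edge_lab c0 Hro); last by case: (rowp_over (o d0)).
exact: lab_row.
Qed.

(** Along an orbit of the action coming from [P], the label for the pointwise action is [psi l d c]
    as a function of [d]. It is constant when the two actions are independent and injective when
    they are matched. *)
Lemma dich l c : covp B l -> ple b l.1 ->
  (forall d d', psi l d c = psi l d' c) \/ injective (fun d => psi l d c).
Proof.
move=> cl bl; have o : over b (edge s l d0) by apply: (edge_over d0 Hs).
have oe := edge_row_over c o.
have e d := actD_psi d c cl bl.
case: (types letr row_action aS fD fD oe) => t; [left=> d d'|right=> d d' h].
  by rewrite -(e d) -(e d') (proj1 t d) (proj1 t d').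
apply: (can_inj (sigK row_action aS oe t)).
exact: etrans (e d) (etrans h (esym (e d'))).
Qed.

Lemma dich_R2 l l' c : ple b l.1 -> ple b l'.1 -> R2 B l l' ->
  injective (fun d => psi l d c) <-> injective (fun d => psi l' d c).
Proof.
move=> bl bl' h; have cl := R2_cov1 h; have cl' := R2_cov2 h.
have o : over b (edge s l d0) by apply: (edge_over d0 Hs).
have o' : over b (edge s l' d0) by apply: (edge_over d0 Hs).
have k := leE_row c o (edge_R2 d0 Hs d0 bl bl' h).
have oe := edge_row_over c o; have oe' := edge_row_over c o'.
have e1 d := actD_psi d c cl bl; have e2 d := actD_psi d c cl' bl'.
case: (type_le letr row_action aS fD fD oe oe' k) => [[[t1 _] [t2 _]]|[m1 m2 e]].
  have [_ _ [d [d' /eqP n]]] := fD.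
  split=> inj; case: n; apply: inj.
    by rewrite -(e1 d) -(e1 d') (t1 d) (t1 d').
  by rewrite -(e2 d) -(e2 d') (t2 d) (t2 d').
have eqp d : psi l d c = psi l' d c by rewrite -(e1 d) -(e2 d) (e d).
by split=> inj d d'; [rewrite -!eqp|rewrite !eqp]; apply: inj.
Qed.
End Dichotomy.

(** * Squares obtained from maximal indices *)

Definition maxi (C : fposet) (c : C) := forall k, plt c k = false.
Definition two_max (C : fposet) := exists c c' : C, [/\ c != c', maxi c & maxi c'].

Section Diamond.
Variables (P C : fposet) (r : C -> P -> P) (c0 : C).
Hypothesis H : root r.
Local Notation A := (fixr r).
Local Notation lb := (lab r c0).

(** Each change is possible from [b] alone and touches a different coordinate, so both can be made;
    the result is the join, computed coordinate by coordinate. *)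
Lemma diamond b f f1 : cov predT b f -> cov predT b f1 -> lb (b, f) != lb (b, f1) ->
  exists g, [/\ R1 predT (b, f) (f1, g), R1 predT (b, f1) (f, g) &
    forall u, ple f u -> ple f1 u -> ple g u].
Proof.
move=> cf cf1 n; have [ca e] := lab_cov c0 H (p := (b, f)) cf.
have [ca1 e1] := lab_cov c0 H (p := (b, f1)) cf1.
set c := lb (b, f) in n ca e; set c1 := lb (b, f1) in n ca1 e1.
have {}e k : k != c -> r k b = r k f := e k; have {}e1 k : k != c1 -> r k b = r k f1 := e1 k.
have bf := cov_le cf; have bf1 := cov_le cf1.
have eg k : r k (upd r f1 c (r c f)) = if k == c then r c f else r k f1.
  apply: (upd_upP H); first exact: fix_r.
    by rewrite -e1 //; apply: (r_mono H).
  move=> k' lt; apply: ple_tr (r_mono H k' bf1); exact: (lab_above (p := (b, f)) H cf).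
set g := upd _ _ _ _ in eg.
have cfc : covp A (r c b, r c f) by [].
have [cg lg] : covp predT (f1, g) /\ lb (f1, g) = c.
  apply: (cov_of_lab _ H); first by move=> k nk; rewrite eg (negbTE nk).
  by rewrite eg eqxx -e1.
have [cg1 lg1] : covp predT (f, g) /\ lb (f, g) = c1.
  apply: (cov_of_lab _ H).
    by move=> k nk; rewrite eg; case: eqP => [->//|/eqP nk']; rewrite -e // e1.
  by rewrite eg eq_sym (negbTE n) -e 1?eq_sym.
exists g; split.
- apply: (R1_of (c0 := c0) H) => //.
    by left; rewrite /coord lg /= eg eqxx -e1.
  apply: (r_ext H) => k; rewrite eg; case: eqP => [->|/eqP nk]; first exact: plexx.
  by rewrite -e //; apply: (r_mono H).
- apply: (R1_of (c0 := c0) H) => //.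
    by left; rewrite /coord lg1 /= eg eq_sym (negbTE n) -e 1?eq_sym.
  apply: (r_ext H) => k; rewrite eg; case: eqP => [->|/eqP nk]; last exact: plexx.
  by rewrite -e1 //; apply: (r_mono H).
move=> u fu f1u; apply: (r_ext H) => k; rewrite eg; case: eqP => [->|_]; exact: (r_mono H).
Qed.

Lemma edge_max p c : covp A p -> maxi c -> (edge r p c).1 = p.1.
Proof.
move=> cp m; apply: (fix_ext H (cov_l cp)) => k; by rewrite (edge1 H) // m.
Qed.
End Diamond.

Section Two.
Variables (P C D : fposet) (r : C -> P -> P) (s : D -> P -> P) (c0 : C) (d0 : D).
Hypothesis RS : biroot r s.
Let Hr : root r := bi_r RS.
Let Hs : root s := bi_s RS.
Local Notation B := (fixr s).
Local Notation dl := (xlab r s d0).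
Local Notation lb := (lab r c0).
Local Notation co := (coord r c0).
Local Notation dB := (par_lab r s c0 d0).
Local Notation psi := (cube_lab r s c0 d0).
Local Notation ut := (utype r s c0 d0).
Local Notation mt := (mtype r s c0 d0).
Local Notation UC := (up_inj r s c0 d0).
Local Notation ev := (eval_fixed r s).
Implicit Types (f g x y z b : P) (p q l j : P * P) (c : C) (d : D).

(** At a maximal index [c] the standard edges of both cubes start at [e] itself, and their
    [D]-labels differ, so [diamond] for [s] joins them to some [G]. The coordinate [r c G] closes a
    square in [A] above [e], and lifting it to coordinate [c1] of [b] closes the square of [f] and
    [f1]. *)
Lemma same_diamond b f f1 c : ev b -> cov predT b f -> cov predT b f1 -> lb (b, f) = lb (b, f1) ->
  maxi c -> dl (co (b, f)) c != dl (co (b, f1)) c ->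
  exists g, R1 predT (b, f) (f1, g) /\ R1 predT (b, f1) (f, g).
Proof.
move=> eb cf cf1 el mc n; set c1 := lb (b, f) in el.
have cp := coord_cov c0 Hr (p := (b, f)) cf; have cp1 := coord_cov c0 Hr (p := (b, f1)) cf1.
have [_ oth] := lab_cov c0 Hr (p := (b, f)) cf; have [_ oth1] := lab_cov c0 Hr (p := (b, f1)) cf1.
have ep : co (b, f) = (r c1 b, r c1 f) by [].
have ep1 : co (b, f1) = (r c1 b, r c1 f1) by rewrite /coord -el.
rewrite ep in cp n; rewrite ep1 in cp1 n; set e := r c1 b in cp cp1 n.
set z := r c1 f in cp n; set z1 := r c1 f1 in cp1 n.
pose Z := (edge r (e, z) c).2; pose Z1 := (edge r (e, z1) c).2.
have ee : edge r (e, z) c = (e, Z) by rewrite [LHS]surjective_pairing (edge_max Hr cp mc).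
have ee1 : edge r (e, z1) c = (e, Z1) by rewrite [LHS]surjective_pairing (edge_max Hr cp1 mc).
have cZ : cov predT e Z by have := edge_cov c0 Hr c cp; rewrite ee.
have cZ1 : cov predT e Z1 by have := edge_cov c0 Hr c cp1; rewrite ee1.
rewrite /xlab ee ee1 in n.
have [G [r1 r2 lub]] := diamond Hs cZ cZ1 n.
have lZ : lb (e, Z) = c by rewrite -ee; apply: (edge_lab c0 Hr).
have lZ1 : lb (e, Z1) = c by rewrite -ee1; apply: (edge_lab c0 Hr).
have oZ : co (e, Z) = (e, z) by rewrite -ee (edge_coord c0 Hr).
have oZ1 : co (e, Z1) = (e, z1) by rewrite -ee1 (edge_coord c0 Hr).
have vZ : r c Z = z by have := congr1 snd oZ; rewrite /coord lZ.
have vZ1 : r c Z1 = z1 by have := congr1 snd oZ1; rewrite /coord lZ1.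
have k1 := R1_coord c0 Hr r1; have k2 := R1_coord c0 Hr r2.
rewrite oZ /coord -(R1_lab c0 Hr r1) lZ /= vZ1 in k1.
rewrite oZ1 /coord -(R1_lab c0 Hr r2) lZ1 /= vZ in k2.
set w := r c G in k1 k2.
have le_z : ple Z z by rewrite /Z; apply: (edge_le Hr c cp).
have le_z1 : ple Z1 z1 by rewrite /Z1; apply: (edge_le Hr c cp1).
have up k : plt c1 k -> ple z (r k b) /\ ple z1 (r k b).
  move=> lt; split; first exact: (lab_above (p := (b, f)) Hr cf lt).
  have := lab_above (c0 := c0) (p := (b, f1)) Hr cf1 (c := k); rewrite -el ep1; exact.
have Lz : liftable r b c1 z.
  by split; [apply: fix_r|apply: (cov_le cp)|move=> k /up[]].
have Lz1 : liftable r b c1 z1.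
  by split; [apply: fix_r|apply: (cov_le cp1)|move=> k /up[]].
have Lw : liftable r b c1 w.
  split; first exact: fix_r.
    by apply: ple_tr (cov_le cp) _; apply: (cov_le (R1_cov2 k2)).
  move=> k /up[u1 u2]; rewrite -[r k b](r_abs Hr c k); apply: (r_mono Hr).
  by apply: lub; [apply: ple_tr u1|apply: ple_tr u2].
have Le : liftable r b c1 e.
  by split; [apply: fix_r|apply: plexx|move=> k lt; apply: (r_inc Hr); apply: pltW].
have e0 : upd r b c1 e = b.
  by apply: (r_inj Hr) => k; rewrite liftE //; case: eqP => [->|].
have e1 : upd r b c1 z = f.
  by apply: (r_inj Hr) => k; rewrite liftE //; case: eqP => [->//|/eqP nk]; apply: oth.
have e2 : upd r b c1 z1 = f1.
  by apply: (r_inj Hr) => k; rewrite liftE //; case: eqP => [->//|/eqP nk]; apply: oth1; rewrite -el.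
exists (upd r b c1 w).
have [c2 l2 o2] := lift_cov (p := (z1, w)) c0 Hr Lz1 Lw (R1_cov2 k1).
have [c3 l3 o3] := lift_cov (p := (z, w)) c0 Hr Lz Lw (R1_cov2 k2).
rewrite /= e2 in c2 l2 o2; rewrite /= e1 in c3 l3 o3.
split.
  have := @lift_R1 _ _ _ c0 Hr b c1 (e, z) (f1, upd r b c1 w) Le Lz c2 l2 (cov_le cf1).
  by rewrite /= e0 e1; apply; right; rewrite o2.
have := @lift_R1 _ _ _ c0 Hr b c1 (e, z1) (f, upd r b c1 w) Le Lz1 c3 l3 (cov_le cf).
by rewrite /= e0 e2; apply; right; rewrite o3.
Qed.

(** At a maximal [d] the edges of both cubes start at [b]. They span a square by [diamond] or, for
    equal [C]-labels, by [same_diamond]; both have [D]-label [d], so taking coordinate [d] gives a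
    square in [B]. *)
Lemma B_diamond b y b1 c d : ev b -> cov B b y -> cov B b b1 -> maxi c -> maxi d ->
  lb (edge s (b, y) d) != lb (edge s (b, b1) d) \/ psi (b, y) d c != psi (b, b1) d c ->
  exists w, R1 B (b, y) (b1, w) /\ R1 B (b, b1) (y, w).
Proof.
move=> eb cy c1 mc md h.
have cl : covp B (b, y) := cy; have cl1 : covp B (b, b1) := c1.
pose f := (edge s (b, y) d).2; pose f1 := (edge s (b, b1) d).2.
have ee : edge s (b, y) d = (b, f) by rewrite [LHS]surjective_pairing (edge_max Hs cl md).
have ee1 : edge s (b, b1) d = (b, f1) by rewrite [LHS]surjective_pairing (edge_max Hs cl1 md).
have cf : cov predT b f by have := edge_cov d0 Hs d cl; rewrite ee.
have cf1 : cov predT b f1 by have := edge_cov d0 Hs d cl1; rewrite ee1.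
have [g [r1 r2]] : exists g, R1 predT (b, f) (f1, g) /\ R1 predT (b, f1) (f, g).
  rewrite /cube_lab ee ee1 in h.
  case: (eqVneq (lb (b, f)) (lb (b, f1))) h => [e|n _]; last first.
    by have [g [? ? _]] := diamond Hr cf cf1 n; exists g.
  case=> // n; exact: same_diamond mc n.
have l1 : lab s d0 (b, f) = d by rewrite -ee (edge_lab d0 Hs).
have l2 : lab s d0 (b, f1) = d by rewrite -ee1 (edge_lab d0 Hs).
have o1 : coord s d0 (b, f) = (b, y) by rewrite -ee (edge_coord d0 Hs).
have o2 : coord s d0 (b, f1) = (b, b1) by rewrite -ee1 (edge_coord d0 Hs).
have v1 : s d f = y by have := congr1 snd o1; rewrite /coord l1.
have v2 : s d f1 = b1 by have := congr1 snd o2; rewrite /coord l2.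
have k1 := R1_coord d0 Hs r1; have k2 := R1_coord d0 Hs r2.
rewrite o1 /coord -(R1_lab d0 Hs r1) l1 /= v2 in k1.
rewrite o2 /coord -(R1_lab d0 Hs r2) l2 /= v1 in k2.
by exists (s d g).
Qed.

Lemma cube_lab_R1 l l' d c : R1 B l l' -> psi l d c = psi l' d c.
Proof. by move=> h; apply: (dl_R1 c0 d0 Hr Hs); apply/(R1_coord c0 Hr)/(edge_R1 d0 Hs). Qed.
Lemma utype_R1 l l' : R1 B l l' -> ut l <-> ut l'.
Proof. by move=> h; split=> u d c c'; [rewrite -!(cube_lab_R1 _ _ h)|rewrite !(cube_lab_R1 _ _ h)]. Qed.
Lemma mtype_R1 l l' : R1 B l l' -> mt l <-> mt l'.
Proof. by move=> h; split=> u d c c'; [rewrite -!(cube_lab_R1 _ _ h)|rewrite !(cube_lab_R1 _ _ h)]; apply: u. Qed.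

Lemma utype_mtype l : ut l -> mt l -> False.
Proof. by move=> u m; have [_ _ [c [c' /eqP n]]] := bi_C RS; apply/n/(m d0)/u. Qed.

Lemma leE_type b j j' : ev b -> over b j -> leE b j j' ->
  ((forall c c', dl (co j) c = dl (co j) c') /\ (forall c c', dl (co j') c = dl (co j') c')) \/
  (injective (dl (co j)) /\ injective (dl (co j'))).
Proof.
move=> eb ov h; pose k j := forall c c', dl (co j) c = dl (co j) c'.
have kn i : k i -> injective (dl (co i)) -> False.
  by move=> h1 h2; have [_ _ [c [c' /eqP n]]] := bi_C RS; apply/n/h2/h1.
suff : over b j' /\ ((k j /\ k j') \/ (injective (dl (co j)) /\ injective (dl (co j')))) by case.
apply: (leE_ind (Q := fun j j' => (k j /\ k j') \/ (injective (dl (co j)) /\ injective (dl (co j')))) _ _ _ _ ov h).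
- by move=> i oi; case: (cube_lab_type c0 d0 RS eb oi); auto.
- move=> i1 i2 i3 [[a1 a2]|[a1 a2]] [[b1 b2]|[b1 b2]]; auto; exfalso; exact: (kn i2).
- move=> i1 i2 o1 o2 h12; have e c := dl_R1 c0 d0 Hr Hs c (R1_coord c0 Hr h12).
  case: (cube_lab_type c0 d0 RS eb o1) => t.
    have t' : k i2 by move=> c c'; rewrite -!e; apply: t.
    by split; left.
  have t' : injective (dl (co i2)) by move=> c c'; rewrite -!e; apply: t.
  by split; right.
- move=> i1 i2 o1 o2 h12; case: (over_R2 c0 d0 RS eb o1 o2 h12) => [[_ [[t1 t2]|[t1 t2]]]|[_ h']].
  + by left.
  + by right; split=> // c c'; rewrite -!t2; apply: t1.
  have e c := dl_R1 c0 d0 Hr Hs c h'.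
  case: (cube_lab_type c0 d0 RS eb o1) => t; [left|right]; split=> // c c'; rewrite -!e; exact: t.
Qed.

Lemma R2_type b l l' : ev b -> ple b l.1 -> ple b l'.1 -> R2 B l l' ->
  (ut l /\ ut l') \/ (mt l /\ mt l').
Proof.
move=> eb bl bl' h; have cl := R2_cov1 h; have cl' := R2_cov2 h.
have ov : over b (edge s l d0) by apply: (edge_over d0 Hs).
have k := leE_type eb ov (edge_R2 d0 Hs d0 bl bl' h).
have kn (f : C -> D) : (forall c c', f c = f c') -> injective f -> False.
  by move=> h1 h2; have [_ _ [c [c' /eqP n]]] := bi_C RS; apply/n/h2/h1.
case: (l_type c0 d0 RS eb cl bl) => [u|[m _]]; case: (l_type c0 d0 RS eb cl' bl') => [u'|[m' _]]; auto.
  by case: k => [[_ k]|[k _]]; exfalso; [apply: (kn _ k (m' d0))|apply: (kn _ (u d0) k)].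
by case: k => [[k _]|[_ k]]; exfalso; [apply: (kn _ k (m d0))|apply: (kn _ (u' d0) k)].
Qed.

(** A second middle of the chain gives a cover of [x] parallel to (y, z). *)
Lemma push_down x y z : cov B x y -> cov B y z ->
  R2 B (y, z) (x, y) \/ exists m, R1 B (x, m) (y, z) /\ R1 B (x, y) (m, z).
Proof.
move=> cxy cyz; case: (boolP [forall m, cov B x m ==> cov B m z ==> (m == y)]) => h.
  by left; apply/and4P; split.
right; case/forallPn: h => m; rewrite !negb_imply => /and3P[h1 h2 n].
exists m; split; apply/and5P; split; rewrite // ?(cov_le cxy) ?(cov_le h1) ?(cov_le cyz) ?(cov_le h2) //=.
  apply/negP => h; case: (cov_mid cxy (cov_r h1) (cov_le h1) h) => e; last by rewrite e eqxx in n.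
  by case: (cov_neq h1).
apply/negP => h; case: (cov_mid h1 (cov_r cxy) (cov_le cxy) h) => e; last by rewrite e eqxx in n.
by case: (cov_neq cxy).
Qed.

Hypotheses (C2 : two_max C) (D2 : two_max D).

(** Two maximal indices are what makes this work: equal labels at both would contradict constancy
    for one cover against injectivity for the other, so some maximal index separates them. *)
Lemma um_diamond b y b1 : ev b -> cov B b y -> cov B b b1 -> (ut (b, y) /\ mt (b, b1)) \/
  (mt (b, y) /\ ut (b, b1)) -> exists w, R1 B (b, y) (b1, w) /\ R1 B (b, b1) (y, w).
Proof.
move=> eb cy c1 h; have [c [c' [/eqP n mc mc']]] := C2; have [d [_ [_ md _]]] := D2.
case: (eqVneq (psi (b, y) d c) (psi (b, b1) d c)) => e; last by apply: (B_diamond eb cy c1 mc md); right.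
case: (eqVneq (psi (b, y) d c') (psi (b, b1) d c')) => e'; last by apply: (B_diamond eb cy c1 mc' md); right.
case: h => -[h1 h2]; case: n.
  by apply: (h2 d); rewrite -e -e'; apply: h1.
by apply: (h1 d); rewrite e e'; apply: h2.
Qed.

(* At an atom [(b, y)] either [y] and [b1] span a square, and [b1] decides, or the edges to [y]
   and to [b1] carry the same labels at every maximal index. *)
Lemma u_inj b b1 : ev b -> cov B b b1 -> UC b1 -> injective (dB (b, b1)) ->
  forall l, covp B l -> ple b l.1 -> ut l -> injective (dB l).
Proof.
move=> eb cb ub1 inj1 l cl bl ul.
have dBu l' c : ut l' -> forall d, dB l' d = psi l' d c by move=> u d; apply: u.
have Bb : B b := cov_l cb.
suff: injective (fun d => psi l d c0) by move=> h d d'; rewrite !(dBu _ c0 ul) => /h.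
pose Qx x := exists y, [/\ cov B x y, ut (x, y) &
  injective (fun d => psi (x, y) d c0) -> injective (fun d => psi l d c0)].
have [y [cy uy]] : Qx b.
  suff : ple b b -> Qx b by apply; apply: plexx.
  apply: (cov_ind_dn (S := B) (Q := fun x => ple b x -> Qx x) (x := l.1)) => //.
  - exact: cov_l cl.
  - by move=> _; exists l.2; case: (l) cl ul => x y; split.
  move=> x x' _ Qx' cx bx'; have [y [cy uy hy]] := Qx' (ple_tr bx' (cov_le cx)).
  case: (push_down cx cy) => [h|[m [h1 h2]]].
    have l1 : ple b (x, y).1 := ple_tr bx' (cov_le cx).
    exists x; split=> //; last by move=> k; apply: hy; apply: (proj2 (dich_R2 c0 d0 RS eb c0 l1 (bx' : ple b (x', x).1) h)).
    by case: (R2_type eb l1 (bx' : ple b (x', x).1) h) => -[] // m _; case: (utype_mtype uy m).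
  exists m; split; [exact: (R1_cov1 h1)|exact/(utype_R1 h1)|].
  by move=> k; apply: hy => d d'; rewrite -!(cube_lab_R1 _ _ h1); apply: k.
apply; have cy' : covp B (b, y) := cy.
have dia w : R1 B (b, y) (b1, w) -> injective (fun d => psi (b, y) d c0).
  move=> h d d'; rewrite -!(dBu _ c0 uy) !(par_lab_R1 c0 d0 RS _ h).
  by apply: ub1; [apply: R1_cov2 h|apply: plexx].
case: (l_type c0 d0 RS eb (cb : covp B (b, b1)) (plexx b)) => [u1|[m1 _]]; last first.
  by have [|w [h _]] := um_diamond eb cy cb; [left|apply: dia h].
have [c [_ [_ mc _]]] := C2; have [d [d' [/eqP nd md md']]] := D2.
case: (eqVneq (psi (b, y) d c) (psi (b, b1) d c)) => e; last first.
  by have [|w [h _]] := B_diamond eb cy cb mc md; [right|apply: dia h].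
case: (eqVneq (psi (b, y) d' c) (psi (b, b1) d' c)) => e'; last first.
  by have [|w [h _]] := B_diamond eb cy cb mc md'; [right|apply: dia h].
case: (dich c0 d0 RS eb c0 cy' (plexx b)) => // k.
case: nd; apply: inj1; rewrite !(dBu _ c u1) -e -e' !(uy _ c c0); exact: k.
Qed.

(** Slide [l] down to a cover (b, y) of type m. The square with the type u cover (b, b1) turns it
    into a cover above [b1], where labels are distinct. The slide stops when it meets another cover
    of type m; then [y] is below [l.1], [m_step] makes [y] a map into [E], and the induction
    continues at [y] with the opposite side (y, w). *)
Lemma m_inj b b1 : ev b -> cov B b b1 -> UC b1 -> ut (b, b1) ->
  forall l, covp B l -> ple b l.1 -> mt l -> injective (dB l).
Proof.
have [n] := ubnP #|[set z | ple b z]|.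
elim: n b b1 => // n IH b b1; rewrite ltnS => le_n eb cb ub1 u1 l cl bl ml.
have Bb : B b := cov_l cb.
pose Qx x := exists y, [/\ cov B x y, mt (x, y) & ple y l.1 \/ (forall d, dB (x, y) d = dB l d)].
have [y [cy my hy]] : Qx b.
  suff : ple b b -> Qx b by apply; apply: plexx.
  apply: (cov_ind_dn (S := B) (Q := fun x => ple b x -> Qx x) (x := l.1)) => //.
  - exact: cov_l cl.
  - by move=> _; exists l.2; case: (l) cl ml => x y; split=> //; right.
  move=> x x' lx Qx' cx bx'; have bx : ple b x := ple_tr bx' (cov_le cx).
  case: (l_type c0 d0 RS eb (cx : covp B (x', x)) bx') => [u|[m _]]; last by exists x; split=> //; left.
  have [y [cy my hy]] := Qx' bx.
  case: (push_down cx cy) => [h|[m [h1 h2]]].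
    have l1 : ple b (x, y).1 := bx.
    by case: (R2_type eb l1 (bx' : ple b (x', x).1) h) => -[k1 k2]; [case: (utype_mtype k1 my)|case: (utype_mtype u k2)].
  exists m; split; [exact: (R1_cov1 h1)|exact/(mtype_R1 h1)|].
  case: hy => [ly|e]; [left|right].
    by apply: ple_tr ly; apply: cov_le (R1_cov2 h2).
  by move=> d; rewrite (par_lab_R1 c0 d0 RS _ h1) e.
have [|w [h1 h2]] := um_diamond eb cy cb; first by right.
have inj : injective (dB (b, y)).
  move=> d d'; rewrite !(par_lab_R1 c0 d0 RS _ h1).
  by apply: ub1; [apply: R1_cov2 h1|apply: plexx].
case: hy => [ly|e]; last by move=> d d'; rewrite -!e; apply: inj.
have [ey _ _ _] := m_step RS eb cy my inj.
have cyw := R1_cov2 h2; have cbw := R1_cov2 h1.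
apply: (IH y w) => //.
- apply: leq_trans le_n; apply: proper_card; apply/properP; split.
    by apply/subsetP => z; rewrite !inE; apply: ple_tr; apply: cov_le cy.
  by exists b; rewrite !inE ?plexx ?(plt_nge (cov_lt cy)).
- by move=> l' cl' wl'; apply: ub1 => //; apply: ple_tr wl'; apply: cov_le cbw.
- exact/(utype_R1 h2).
Qed.

Lemma up_inj_step b b1 : ev b -> cov B b b1 -> ut (b, b1) -> UC b1 -> injective (dB (b, b1)) -> UC b.
Proof.
move=> eb cb u1 ub1 inj l cl bl.
case: (l_type c0 d0 RS eb cl bl) => [u|[m _]]; first exact: (u_inj eb cb ub1 inj).
exact: (m_inj eb cb ub1 u1).
Qed.
End Two.

(** * Regular points and their propagation *)

Lemma sub_conn_ind (P : fposet) (S : pred P) (Q : P -> Prop) x : connected (sub_poset S) ->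
  S x -> Q x -> (forall y z, Q y -> cov S y z -> Q z) -> (forall y z, Q y -> cov S z y -> Q z) ->
  forall y, S y -> Q y.
Proof.
move=> Sc Sx Qx up dn y Sy.
have /connectP[p pp e] := Sc (exist (fun z => is_true (S z)) x Sx) (exist (fun z => is_true (S z)) y Sy).
have {e} -> : y = val (last (exist (fun z => is_true (S z)) x Sx) p) by rewrite -e.
have : Q (val (exist (fun z => is_true (S z)) x Sx)) by [].
move: (exist _ x Sx) pp => x0; elim: p x0 {Qx} => //= z p IH x0 /andP[xz pp] Qx; apply: IH pp _.
have {Sx Sy} := valP x0 => Sx; have Sz := valP z.
case/orP: xz => h.
  exact: (cov_ind_up (Q := Q) Sx Qx (fun u v _ Qu => up u v Qu) Sz h).
exact: (cov_ind_dn (Q := Q) Sx Qx (fun u v _ Qu => dn u v Qu) Sz h).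
Qed.

Definition dn_inj (P C D : fposet) (r : C -> P -> P) (s : D -> P -> P) (c0 : C) (d0 : D) (b : P) : Prop :=
  forall l, covp (fixr s) l -> ple l.2 b -> injective (par_lab r s c0 d0 l).
(** Both directions are kept together so that the notion is self-dual and steps down follow from
    steps up. *)
Definition regular (P C D : fposet) (r : C -> P -> P) (s : D -> P -> P) (c0 : C) (d0 : D) (b : P) : Prop :=
  [/\ eval_fixed r s b, up_inj r s c0 d0 b & dn_inj r s c0 d0 b].

Section Good.
Variables (P C D : fposet) (r : C -> P -> P) (s : D -> P -> P) (c0 : C) (d0 : D).
Hypothesis RS : biroot r s.
Let Hr : root r := bi_r RS.
Let Hs : root s := bi_s RS.
Local Notation B := (fixr s).
Local Notation dB := (par_lab r s c0 d0).
Local Notation ut := (utype r s c0 d0).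
Local Notation mt := (mtype r s c0 d0).
Local Notation UC := (up_inj r s c0 d0).
Local Notation ev := (eval_fixed r s).
Local Notation DC := (dn_inj r s c0 d0).
Local Notation good := (regular r s c0 d0).
Local Notation UCo := (@up_inj (op P) (op C) (op D) r s c0 d0).
Implicit Types (x y b : P) (l : P * P).

Lemma up_inj_op b : UCo b <-> DC b.
Proof.
split=> h l cl lb.
  have := h (swap l); rewrite covp_op => /(_ cl lb) inj d d'.
  by rewrite -(par_lab_op c0 d0 Hr Hs d cl) -(par_lab_op c0 d0 Hr Hs d' cl); apply: inj.
have cl' : @covp P B (swap l) by rewrite -(@covp_op' P).
move=> d d'; have e k : @par_lab (op P) (op C) (op D) r s c0 d0 l k = dB (swap l) k.
  by rewrite -(par_lab_op c0 d0 Hr Hs) // /swap; case: (l).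
by rewrite !e; apply: h.
Qed.

Lemma dn_inj_op b : @dn_inj (op P) (op C) (op D) r s c0 d0 b <-> UC b.
Proof.
split=> h l cl lb.
  have := h (swap l); rewrite covp_op => /(_ cl lb) inj d d'.
  by rewrite -(par_lab_op c0 d0 Hr Hs d cl) -(par_lab_op c0 d0 Hr Hs d' cl); apply: inj.
have cl' : @covp P B (swap l) by rewrite -(@covp_op' P).
move=> d d'; have e k : @par_lab (op P) (op C) (op D) r s c0 d0 l k = dB (swap l) k.
  by rewrite -(par_lab_op c0 d0 Hr Hs) // /swap; case: (l).
by rewrite !e; apply: h.
Qed.

Lemma regular_op b : @regular (op P) (op C) (op D) r s c0 d0 b <-> good b.
Proof.
split=> -[h1 h2 h3]; split.
- exact: h1.
- exact/dn_inj_op.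
- exact/up_inj_op.
- exact: h1.
- exact/up_inj_op.
- exact/dn_inj_op.
Qed.

Lemma utype_op l : covp B l -> @utype (op P) (op C) (op D) r s c0 d0 (swap l) <-> ut l.
Proof.
move=> cl; split=> u d c c'; have := u d c c'; rewrite !(cube_lab_op c0 d0 Hr Hs) //.
Qed.
Lemma mtype_op l : covp B l -> @mtype (op P) (op C) (op D) r s c0 d0 (swap l) <-> mt l.
Proof.
by move=> cl; split=> u d c c'; have := u d c c'; rewrite !(cube_lab_op c0 d0 Hr Hs).
Qed.

Lemma eval_up b b' : ev b -> cov B b b' -> injective (dB (b, b')) -> ev b'.
Proof.
move=> eb cb inj; case: (l_type c0 d0 RS eb (cb : covp B (b, b')) (plexx b)) => [u|[m _]].
  by case: (u_step RS eb cb u inj).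
by case: (m_step RS eb cb m inj).
Qed.
End Good.

Section Good2.
Variables (P C D : fposet) (r : C -> P -> P) (s : D -> P -> P) (c0 : C) (d0 : D).
Hypothesis RS : biroot r s.
Let Hr : root r := bi_r RS.
Let Hs : root s := bi_s RS.
Let RO := biroot_op RS.
Local Notation B := (fixr s).
Local Notation E := (bfix r s).
Local Notation dB := (par_lab r s c0 d0).
Local Notation ut := (utype r s c0 d0).
Local Notation good := (regular r s c0 d0).
Local Notation ev := (eval_fixed r s).
Implicit Types (x y b : P) (l : P * P).

Lemma eval_dn b b' : ev b' -> cov B b b' -> injective (dB (b, b')) -> ev b.
Proof.
move=> eb cb inj; apply: (@eval_up (op P) (op C) (op D) r s c0 d0 RO b' b eb); first by rewrite cov_op.
have cl : covp B (b, b') := cb.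
by move=> d d'; rewrite !(par_lab_op c0 d0 Hr Hs _ cl); apply: inj.
Qed.

Lemma all_regular_of_inj e : E e -> connected (sub_poset B) -> (forall l, covp B l -> injective (dB l)) ->
  forall b, B b -> good b.
Proof.
move=> Ee Bc inj b Bb; split; [|by move=> l ? _; apply: inj|by move=> l ? _; apply: inj].
apply: (sub_conn_ind Bc (x := e)) Bb => //; [by case/andP: Ee|exact: bfix_eval| |].
  by move=> y z ey cy; apply: (eval_up RS ey cy); apply: inj.
by move=> y z ey cy; apply: (eval_dn ey cy); apply: inj.
Qed.

Section TwoEnds.
Hypotheses (C2 : two_max C) (C2' : two_max (op C)) (D2 : two_max D) (D2' : two_max (op D)).

(** Upward distinctness is inherited, as the covers above [b'] are also above [b]. Downward
    distinctness is the dual of [up_inj_step], applied to the reversed cover. *)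
Lemma regular_u_up b b' : good b -> cov B b b' -> ut (b, b') -> good b'.
Proof.
case=> eb ub db cb u; have cl : covp B (b, b') := cb.
have inj : injective (dB (b, b')) by apply: ub => //; apply: plexx.
have eb' := eval_up RS eb cb inj; split=> //.
  by move=> l cl' bl; apply: ub => //; apply: ple_tr bl; apply: cov_le cb.
apply/(up_inj_op c0 d0 RS).
apply: (@up_inj_step (op P) (op C) (op D) r s c0 d0 RO C2' D2' b' b).
- exact: eb'.
- by rewrite cov_op.
- exact/(utype_op c0 d0 RS cl).
- exact/(up_inj_op c0 d0 RS).
by move=> d d'; rewrite !(par_lab_op c0 d0 Hr Hs _ cl); apply: inj.
Qed.
End TwoEnds.
End Good2.

(** * Points joined to [E] by steps of type u *)

Section Reach.
Variables (P C D : fposet) (r : C -> P -> P) (s : D -> P -> P) (c0 : C) (d0 : D).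
Hypothesis RS : biroot r s.
Let Hr : root r := bi_r RS.
Let Hs : root s := bi_s RS.
Let SR := biroot_sym RS.
Let RO := biroot_op RS.
Local Notation B := (fixr s).
Local Notation E := (bfix r s).
Local Notation dB := (par_lab r s c0 d0).
Local Notation psi := (cube_lab r s c0 d0).
Local Notation ut := (utype r s c0 d0).
Local Notation mt := (mtype r s c0 d0).
Local Notation UC := (up_inj r s c0 d0).
Local Notation good := (regular r s c0 d0).
Local Notation ev := (eval_fixed r s).
Implicit Types (x y a b : P) (l : P * P).

(** All coordinates of [b] cover the one point [e] in [A], so at comparable indices they agree. *)
Lemma m_up_E e b : E e -> UC e -> cov B e b -> mt (e, b) -> E b.
Proof.
move=> Ee ub cb m; have cl : covp B (e, b) := cb.
have [[Bb _] _ cA _] := m_step RS (bfix_eval Ee) cb m (ub _ cl (plexx e)).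
have /andP[Ae Be] := Ee; have [Cc _ _] := bi_C RS.
apply/andP; split=> //; apply: (fixr_const c0 Hr Cc) => c c' cc'.
have h1 := cA c; have h2 := cA c'; rewrite (fixE c Ae) in h1; rewrite (fixE c' Ae) in h2.
case: (cov_mid h2 (fix_r Hr c b) (cov_le h1) (r_inc Hr b cc')) => // k.
by case: (cov_neq h1).
Qed.

Lemma um_up a b b' : ev a -> cov B a b -> ut (a, b) -> cov B b b' -> mt (b, b') ->
  exists w, [/\ cov B a w, mt (a, w), cov B w b' & ut (w, b')].
Proof.
move=> ea cab u cbb m; case: (push_down cab cbb) => [h|[w [h1 h2]]].
  have l1 : ple a (b, b').1 := cov_le cab; have l2 : ple a (a, b).1 := plexx a.
  by case: (R2_type c0 d0 RS ea l1 l2 h) => -[k1 k2]; [case: (utype_mtype RS k1 m)|case: (utype_mtype RS u k2)].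
exists w; split; [exact: (R1_cov1 h1)|exact/(mtype_R1 c0 d0 RS h1)| exact: (R1_cov2 h2)|].
by apply/(utype_R1 c0 d0 RS h2).
Qed.

Lemma um_dn a b b' : two_max C -> two_max D -> ev b -> cov B b a -> ut (b, a) -> cov B b b' ->
  mt (b, b') -> exists w, [/\ cov B a w, mt (a, w), cov B b' w & ut (b', w)].
Proof.
move=> C2 D2 eb cba u cbb m.
have [|w [h1 h2]] := um_diamond RS C2 D2 eb cba cbb (c0 := c0) (d0 := d0); first by left.
exists w; split; [exact: (R1_cov2 h2)|exact/(mtype_R1 c0 d0 RS h2)| exact: (R1_cov2 h1)|].
by apply/(utype_R1 c0 d0 RS h1).
Qed.

(** Over a common fixed point every edge is linked to the cube of its coordinate, so by [lab_over]
    measured and actual labels agree. *)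
Lemma bfix_up_inj e : E e -> UC e.
Proof.
case/andP => Ae Be l cl el d d'.
have k j : dB l j = j.
  have ov := edge_over d0 Hs j cl el.
  by rewrite -[RHS](edge_lab d0 Hs j cl) /par_lab /cross_lab -(lab_over d0 c0 SR Ae ov).
by rewrite !k.
Qed.

Lemma regular_u_dn b b' : two_max C -> two_max D -> good b' -> cov B b b' -> ut (b, b') -> good b.
Proof.
move=> C2 D2 gb cb u; have cl : covp B (b, b') := cb.
apply/(regular_op c0 d0 RS).
apply: (@regular_u_up (op P) (op C) (op D) r s c0 d0 RO C2 D2 b' b).
- exact/(regular_op c0 d0 RS).
- by rewrite cov_op.
exact/(utype_op c0 d0 RS cl).
Qed.

Definition utypeb l := [forall d, forall c, forall c', psi l d c == psi l d c'].
Lemma utypeP l : reflect (ut l) (utypeb l).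
Proof.
apply: (iffP forallP) => [h d c c'|h d].
  by move/forallP: (h d) => /(_ c)/forallP/(_ c')/eqP.
by apply/forallP => c; apply/forallP => c'; apply/eqP.
Qed.
Definition ulink : rel P := fun x y => (cov B x y && utypeb (x, y)) || (cov B y x && utypeb (y, x)).
(** Paths use steps of type u alone, because regularity is propagated along these. *)
Definition reach b := exists2 e, E e & connect ulink e b.
Lemma reach_step a b : reach a -> ulink a b -> reach b.
Proof. by case=> e Ee h k; exists e => //; apply: connect_trans (connect1 k). Qed.
End Reach.

Section Reach2.
Variables (P C D : fposet) (r : C -> P -> P) (s : D -> P -> P) (c0 : C) (d0 : D).
Hypothesis RS : biroot r s.
Let RO := biroot_op RS.
Local Notation B := (fixr s).
Local Notation E := (bfix r s).
Local Notation ut := (utype r s c0 d0).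
Local Notation mt := (mtype r s c0 d0).
Local Notation good := (regular r s c0 d0).
Local Notation ustep := (ulink r s c0 d0).
Local Notation reach := (reach r s c0 d0).
Local Notation uto := (@utype (op P) (op C) (op D) r s c0 d0).
Local Notation mto := (@mtype (op P) (op C) (op D) r s c0 d0).
Implicit Types (x y a b : P) (l : P * P).
Hypotheses (C2 : two_max C) (C2' : two_max (op C)) (D2 : two_max D) (D2' : two_max (op D)).

Lemma bfix_regular e : E e -> good e.
Proof.
move=> Ee; split; [exact: bfix_eval Ee|exact: (bfix_up_inj RS)|].
by apply/(up_inj_op c0 d0 RS); apply: (bfix_up_inj RO).
Qed.

Lemma ulink_regular a b : good a -> ustep a b -> good b.
Proof.
move=> ga /orP[/andP[cab /utypeP u]|/andP[cba /utypeP u]]; first exact: (regular_u_up RS C2' D2' ga cab u).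
exact: (regular_u_dn RS C2 D2 ga cba u).
Qed.

Lemma reach_regular b : reach b -> good b.
Proof.
case=> e /bfix_regular ge /connectP[p pp ->]; elim: p e pp ge => //= a p IH e /andP[h pp] ge.
by apply: IH pp _; apply: ulink_regular h.
Qed.

(** Induction on the path from [E]. A step of type m at its end changes places with the last step of
    type u, by [um_up] if the two form a chain and by [um_dn] if they form a fork, or by their
    duals. At the start of the path the step begins in [E] and hence ends there. *)
Lemma reach_m b : reach b -> forall b', (cov B b b' -> mt (b, b') -> reach b') /\
  (cov B b' b -> mt (b', b) -> reach b').
Proof.
case=> e Ee /connectP[p]; elim/last_ind: p b => [b _ -> {b} b'|p b IH b0].
  have [_ ub db] := bfix_regular Ee.
  split=> cb m; (exists b'; last exact: connect0).
    exact: (m_up_E RS Ee ub cb m).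
  have cl : covp B (b', e) := cb.
  apply: (@m_up_E (op P) (op C) (op D) r s c0 d0 RO e b' Ee).
  - exact/(up_inj_op c0 d0 RS).
  - by rewrite cov_op.
  exact/(mtype_op c0 d0 RS cl).
rewrite rcons_path last_rcons => /andP[pp st] -> {b0} b'.
set a := last e p in st; have ra : reach a by exists e => //; apply/connectP; exists p.
have {}IH := IH a pp erefl.
have [ea _ _] := reach_regular ra.
have [eb _ _] := reach_regular (reach_step ra st).
have fin_up w : cov B w b' -> ut (w, b') -> reach w -> reach b'.
  by move=> c /utypeP u rw; apply: reach_step rw _; rewrite /ulink c u.
have fin_dn w : cov B b' w -> ut (b', w) -> reach w -> reach b'.
  by move=> c /utypeP u rw; apply: reach_step rw _; rewrite /ulink c u orbT.
have op_up w : @cov (op P) B a w -> mto (a, w) -> reach w.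
  rewrite cov_op => c m; have cl : covp B (w, a) := c.
  by apply: (proj2 (IH w)) => //; apply/(mtype_op c0 d0 RS cl).
have op_ut x y : covp B (x, y) -> ut (x, y) -> uto (y, x) by move=> cl u; apply/(utype_op c0 d0 RS cl).
have op_mt x y : covp B (x, y) -> mt (x, y) -> mto (y, x) by move=> cl u; apply/(mtype_op c0 d0 RS cl).
have op_ut' x y : covp B (x, y) -> uto (y, x) -> ut (x, y) by move=> cl /(utype_op c0 d0 RS cl).
split=> cb m; case/orP: st => /andP[cab /utypeP u].
- have [w [h1 h2 h3 h4]] := um_up RS ea cab u cb m.
  by apply: (fin_up w) => //; apply: (proj1 (IH w)).
- have [w [h1 h2 h3 h4]] := um_dn RS C2 D2 eb cab u cb m.
  by apply: (fin_dn w) => //; apply: (proj1 (IH w)).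
- have := @um_dn (op P) (op C) (op D) r s c0 d0 RO a b b' C2' D2' eb.
  rewrite !cov_op => /(_ cab (op_ut _ _ cab u) cb (op_mt _ _ cb m))[w []].
  rewrite !cov_op => h1 h2 h3 h4.
  by apply: (fin_up w) => //; [apply: op_ut'|apply: op_up; rewrite ?cov_op].
- have := @um_up (op P) (op C) (op D) r s c0 d0 RO a b b' ea.
  rewrite !cov_op => /(_ cab (op_ut _ _ cab u) cb (op_mt _ _ cb m))[w []].
  rewrite !cov_op => h1 h2 h3 h4.
  by apply: (fin_dn w) => //; [apply: op_ut'|apply: op_up; rewrite ?cov_op].
Qed.

Lemma reach_all e : E e -> connected (sub_poset B) -> forall b, B b -> reach b.
Proof.
move=> Ee Bc; apply: (sub_conn_ind Bc (x := e)).
- by case/andP: Ee.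
- by exists e => //; apply: connect0.
- move=> y z ry cy; have [ey _ _] := reach_regular ry.
  case: (l_type c0 d0 RS ey (cy : covp B (y, z)) (plexx y)) => [/utypeP u|[m _]].
    by apply: reach_step ry _; rewrite /ulink cy u.
  by apply: (proj1 (reach_m ry z)).
move=> y z ry cy; have [ey uy dy] := reach_regular ry.
have cl : covp B (z, y) := cy.
have ez := eval_dn RS ey cy (dy _ cl (plexx y)).
case: (l_type c0 d0 RS ez cl (plexx z)) => [/utypeP u|[m _]].
  by apply: reach_step ry _; rewrite /ulink cy u orbT.
by apply: (proj2 (reach_m ry z)).
Qed.
End Reach2.

(** Asymmetric, since a top or a bottom is asked of the first poset; [ends_or] supplies one of the
    two orders. *)
Definition ends (C D : fposet) : Prop := [\/ exists t : C, forall c, ple c t,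
  exists t : C, forall c, ple t c |
  [/\ two_max C, two_max (op C), two_max D & two_max (op D)]].

Lemma all_regular (P C D : fposet) (r : C -> P -> P) (s : D -> P -> P) (c0 : C) (d0 : D) (e : P) :
  biroot r s -> bfix r s e -> connected (sub_poset (fixr s)) -> ends C D ->
  forall b, fixr s b -> regular r s c0 d0 b.
Proof.
move=> RS Ee Bc; have Hr := bi_r RS; have Hs := bi_s RS.
case=> [[t tt]|[t tt]|[h1 h2 h3 h4]] b Bb.
- apply: (all_regular_of_inj RS Ee Bc) => //; apply: par_lab_inj => //; exact: cross_lab_top tt.
- apply: (all_regular_of_inj RS Ee Bc) => //; apply: par_lab_inj => //; exact: cross_lab_bot tt.
exact: (reach_regular RS h1 h2 h3 h4 (reach_all c0 d0 RS h1 h2 h3 h4 Ee Bc Bb)).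
Qed.

(** * Cancellation for indecomposable exponents *)

(** A relation that is total on both sides and compatible with the orders is the graph of an
    isomorphism; antisymmetry makes it single-valued both ways. This avoids writing maps between
    subposets. *)
Lemma iso_rel (P Q : fposet) (R : P -> Q -> Prop) : (forall x, exists y, R x y) ->
  (forall y, exists x, R x y) ->
  (forall x x' y y', R x y -> R x' y' -> ple x x' = ple y y') -> iso P Q.
Proof.
move=> h1 h2 h; have [f fR] := fin_all_exists h1; have [g gR] := fin_all_exists h2.
have fm x y : ple x y = ple (f x) (f y) by apply: h.
have uniq x y y' : R x y -> R x y' -> y = y'.
  by move=> k k'; apply: ple_as; rewrite -(h _ _ _ _ k k') plexx || rewrite -(h _ _ _ _ k' k) plexx.
have uniq' x x' y : R x y -> R x' y -> x = x'.
  by move=> k k'; apply: ple_as; rewrite ?(h _ _ _ _ k k') ?(h _ _ _ _ k' k) plexx.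
exists f; split=> //; exists g => [x|y]; first exact: uniq' (gR _) (fR x).
exact: uniq (fR _) (gR y).
Qed.

Lemma iso_sym (P Q : fposet) : iso P Q -> iso Q P.
Proof.
move=> [f [fb fm]]; apply: (iso_rel (R := fun y x => f x = y)) => [y|x|y y' x x' <- <-].
- by have [g _ gK] := fb; exists (g y).
- by exists (f x).
- by rewrite fm.
Qed.

Lemma iso_refl (P : fposet) : iso P P.
Proof. by exists id; split=> //; exists id. Qed.

Lemma iso_trans (P Q T : fposet) : iso P Q -> iso Q T -> iso P T.
Proof.
move=> [f [fb fm]] [g [gb gm]]; exists (g \o f); split; first exact: bij_comp.
by move=> x y; rewrite fm gm.
Qed.

Lemma top_or_two (C : fposet) (c : C) : (exists t : C, forall c, ple c t) \/ two_max C.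
Proof.
have above x : exists2 m : C, maxi m & ple x m.
  have [n] := ubnP #|[set z | ple x z]|; elim: n x => // n IH x; rewrite ltnS => le_n.
  case: (pickP (fun k => plt x k)) => [k xk|no]; last by exists x; rewrite ?plexx.
  have [|m mm km] := IH k; last by exists m => //; apply: ple_tr km; apply: pltW.
  apply: leq_trans le_n; apply: proper_card; apply/properP; split.
    by apply/subsetP => z; rewrite !inE; apply: ple_tr; apply: pltW.
  by exists x; rewrite !inE ?plexx ?(plt_nge xk).
have [m mm _] := above c.
case: (classic (exists2 m' : C, maxi m' & m != m')) => [[m' mm' n]|no]; [right|left].
  by exists m, m'.
exists m => x; have [m' mm' xm'] := above x.
by case: (eqVneq m m') => [->//|n]; case: no; exists m'.
Qed.

Lemma ends_cases (C : fposet) (c : C) : (exists t : C, forall c, ple c t) \/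
  (exists t : C, forall c, ple t c) \/ two_max C /\ two_max (op C).
Proof.
case: (top_or_two c) => [t|h]; first by left.
by case: (@top_or_two (op C) c) => [t|h']; auto.
Qed.

Lemma ends_or (C D : fposet) (c : C) (d : D) : ends C D \/ ends D C.
Proof.
case: (ends_cases c) => [t|[t|[h1 h2]]]; first by left; apply: Or31.
  by left; apply: Or32.
case: (ends_cases d) => [t|[t|[h3 h4]]]; first by right; apply: Or31.
  by right; apply: Or32.
by left; apply: Or33.
Qed.

Lemma ends_iso (C D : fposet) (c : C) : iso C D -> ends C D.
Proof.
move=> [f [[g fK gK] fm]].
have gm x y : ple (g x) (g y) = ple x y by rewrite fm !gK.
case: (ends_cases c) => [t|[t|[h1 h2]]]; [exact: Or31|exact: Or32|].
case: (ends_cases (f c)) => [[t tt]|[[t tt]|[h3 h4]]]; last exact: Or33.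
  by apply: Or31; exists (g t) => x; rewrite -(fK x) gm.
by apply: Or32; exists (g t) => x; rewrite -(fK x) gm.
Qed.

(** * Matching [A] with [B] along an isomorphism of the exponents *)

Section Transfer.
Variables (P C D : fposet) (r : C -> P -> P) (s : D -> P -> P) (c0 : C) (d0 : D).
Hypothesis RS : biroot r s.
Let Hr : root r := bi_r RS.
Let Hs : root s := bi_s RS.
Let SR := biroot_sym RS.
Local Notation A := (fixr r).
Local Notation B := (fixr s).
Local Notation E := (bfix r s).
Implicit Types (a b : P).
Variable io : C -> D.
Hypotheses (ib : bijective io) (im : forall c c', ple c c' = ple (io c) (io c')).

Let ilt c c' : plt c c' = plt (io c) (io c').
Proof. by rewrite /plt -im (inj_eq (bij_inj ib)). Qed.

(** The wanted coordinates dominate those of [b], so [P] contains an element [g] having them. If the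
    step from [a] has type u, then [g] differs from [b] in one coordinate by a cover of [E] and
    [u_closed] applies; if it has type m, all coordinates move along covers of [A] and [m_closed]
    applies. *)
Lemma transfer_up a a' b : eval_fixed s r a -> cov A a a' -> injective (par_lab s r d0 c0 (a, a')) ->
  eval_fixed r s b -> up_inj r s c0 d0 b -> (forall c, r c b = s (io c) a) ->
  exists2 b', B b' & forall c, r c b' = s (io c) a'.
Proof.
move=> ea ca inj eb ub hb.
have cl : covp A (a, a') := ca.
have ea' := eval_up SR ea ca inj.
have [g gE] : exists g, forall c, r c g = s (io c) a'.
  exists (mk r b (fun c => s (io c) a')); apply: (mk_upP Hr (f := b)) => [c c' cc'||c].
  - by apply: (r_inc Hs); rewrite -im.
  - by move=> c; case: ea'.
  - by rewrite hb; apply: (r_mono Hs); apply: cov_le ca.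
exists g => //; case: (l_type d0 c0 SR ea cl (plexx a)) => [u|[m _]].
  have [_ [d1 [oth cE nB]]] := u_step SR ea ca u inj.
  have [jo K1 K2] := ib.
  have cE' : cov E (r (jo d1) b) (s d1 a') by rewrite hb K2 (eq_cov _ _ (bfixC r s)).
  apply: (u_closed (c0 := c0) (d0 := d0) RS eb ub cE').
    by rewrite (Ecov_sym c0 d0 RS cE') hb K2.
  move=> c; rewrite gE hb; case: eqP => [->|n]; first by rewrite K2.
  by rewrite oth //; apply/eqP => h; apply: n; rewrite -h K1.
have [_ _ cB ng] := m_step SR ea ca m inj.
apply: (m_closed (c0 := c0) (d0 := d0) RS eb ub).
- move=> c; rewrite gE hb.
  have cE : cov E (s (io c) a) (s (io c) a').
    have [k1 k2 k3 k4] := covP _ _ _ (cB (io c)).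
    apply/covP; split=> //; [| |by move=> z /andP[_ Bz]; apply: k4].
      by apply/andP; split; [case: ea|].
    by apply/andP; split; [case: ea'|].
  by rewrite (Ecov_sym c0 d0 RS cE).
- by move=> c; rewrite gE; apply: (fix_r Hs).
move=> c c' cc'; rewrite gE hb; apply: ng; apply/covP; split=> //.
  by rewrite -ilt; apply: cov_lt cc'.
have [jo K1 K2] := ib.
move=> z _; rewrite -(K2 z) -!im => k1 k2.
by case: (cov_mid cc' isT k1 k2) => ->; auto.
Qed.
End Transfer.

Section M1.
Variables (P C D : fposet) (r : C -> P -> P) (s : D -> P -> P) (c0 : C) (d0 : D).
Hypothesis RS : biroot r s.
Let Hr : root r := bi_r RS.
Let Hs : root s := bi_s RS.
Let RO := biroot_op RS.
Local Notation A := (fixr r).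
Local Notation B := (fixr s).
Local Notation E := (bfix r s).
Implicit Types (a b : P).
Variable io : C -> D.
Hypotheses (ib : bijective io) (im : forall c c', ple c c' = ple (io c) (io c')).
Variable e : P.
Hypotheses (Ee : E e) (Ac : connected (sub_poset A)).
Hypotheses (gA : forall a, A a -> regular s r d0 c0 a) (gB : forall b, B b -> regular r s c0 d0 b).

Lemma transfer a : A a -> exists2 b, B b & forall c, r c b = s (io c) a.
Proof.
have [Ae Be] : A e /\ B e by apply/andP.
suff : A a -> A a /\ exists2 b, B b & forall c, r c b = s (io c) a by move=> h /h[].
apply: (sub_conn_ind (Q := fun a => A a /\ exists2 b, B b & forall c, r c b = s (io c) a) Ac (x := e)) => //.
- by split=> //; exists e => // c; rewrite !fixE.
- move=> y z [Ay [b Bb hb]] cyz; split; first exact: cov_r cyz.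
  have [ey uy _] := gA Ay; have [eb ub _] := gB Bb.
  have inj := uy (y, z) cyz (plexx y).
  exact: (transfer_up RS ib im ey cyz inj eb ub hb).
move=> y z [Ay [b Bb hb]] czy; split; first exact: cov_l czy.
have [ey _ dy] := gA Ay; have [eb _ db] := gB Bb.
have cl : covp A (z, y) := czy.
have inj := dy (z, y) cl (plexx y).
have [||||b' Bb' hb'] := @transfer_up (op P) (op C) (op D) r s c0 d0 RO io ib _ y z b ey _ _ eb _ hb.
- by move=> c c'; apply: im.
- by rewrite cov_op.
- by move=> c c'; rewrite !(par_lab_op d0 c0 Hs Hr _ cl); apply: inj.
- exact/(up_inj_op c0 d0 RS).
by exists b'.
Qed.
End M1.

Lemma iso_fix (P C D : fposet) (r : C -> P -> P) (s : D -> P -> P) (c0 : C) (d0 : D) (e : P) :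
  biroot r s -> bfix r s e -> connected (sub_poset (fixr r)) -> connected (sub_poset (fixr s)) ->
  iso C D -> iso (sub_poset (fixr r)) (sub_poset (fixr s)).
Proof.
move=> RS Ee Ac Bc iCD; have Hr := bi_r RS; have Hs := bi_s RS; have SR := biroot_sym RS.
have Ee' : bfix s r e by rewrite -(bfixC r s).
have gA := all_regular d0 c0 SR Ee' Ac (ends_iso d0 (iso_sym iCD)).
have gB := all_regular c0 d0 RS Ee Bc (ends_iso c0 iCD).
have [f [[g fK gK] fm]] := iCD.
have gm x y : ple x y = ple (g x) (g y) by rewrite fm !gK.
apply: (@iso_rel (sub_poset (fixr r)) (sub_poset (fixr s)) (fun x y => forall c, r c (val y) = s (f c) (val x))).
- move=> x; have [b Bb hb] := transfer RS (Bijective fK gK) fm Ee Ac gA gB (valP x).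
  by exists (exist (fun z => is_true (fixr s z)) b Bb).
- move=> y; have [b Bb hb] := transfer SR (Bijective gK fK) gm Ee' Bc gB gA (valP y).
  by exists (exist (fun z => is_true (fixr r z)) b Bb) => c; rewrite /= hb fK.
move=> x x' y y' h h'; apply/idP/idP => k.
  by apply: (r_ext Hr) => c; rewrite h h'; apply: (r_mono Hs).
apply: (r_ext Hs) => d; rewrite -(gK d) -h -h'; exact: (r_mono Hr).
Qed.

(** * Longest chains *)

Section Chains.
Variable P : fposet.
Implicit Types (x y : P) (p : seq P) (S : pred P).

Lemma cov_path S x y : S x -> S y -> ple x y -> exists2 p, path (cov S) x p & last x p = y.
Proof.
move=> Sx Sy xy; apply: (cov_ind_up (Q := fun y => exists2 p, path (cov S) x p & last x p = y) Sx) xy => //.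
  by exists [::].
move=> u v _ [p pp <-] cv; exists (rcons p v); last by rewrite last_rcons.
by rewrite rcons_path pp.
Qed.

Lemma path_lt S x p : path (cov S) x p -> p = [::] \/ plt x (last x p).
Proof.
elim: p x => [|y p IH] x /=; [by left|move=> /andP[c pp]; right].
case: (IH y pp) => [->|h]; first exact: cov_lt c.
exact: plt_trans (cov_lt c) h.
Qed.

Lemma cov_path1 S x y p : cov S x y -> path (cov S) x p -> last x p = y -> size p = 1.
Proof.
move=> c; case: p => [|z p] /= => [_ e|/andP[cz pp] e]; first by case: (cov_neq c).
case: (path_lt pp) => [->//|lt]; rewrite e in lt.
case: (cov_mid c (cov_r cz) (cov_le cz) (pltW lt)) => h; first by case: (cov_neq cz).
by move: lt; rewrite h pltxx.
Qed.

Lemma size_path S x p : path (cov S) x p -> size p <= #|P|.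
Proof.
move=> pp; have srt : sorted (@plt P) (x :: p) by apply: sub_path pp => a b; apply: cov_lt.
have u := sorted_uniq (@plt_trans P) (@pltxx P) srt.
by apply: leq_trans (max_card (mem (x :: p))); rewrite (card_uniqP u) /= ltnW.
Qed.
End Chains.

Section RootChains.
Variables (P C : fposet) (r : C -> P -> P) (c0 : C).
Hypothesis Hr : root r.
Local Notation A := (fixr r).
Implicit Types (f g : P) (p : seq P).

(** Each cover of [P] advances exactly one coordinate by one cover of [A]. *)
Lemma path_count f p : path (cov predT) f p -> exists2 k : C -> nat, size p = \sum_c k c &
  forall c, exists q, [/\ path (cov A) (r c f) q, last (r c f) q = r c (last f p) & size q = k c].
Proof.
elim: p f => [|g p IH] f /=.
  by move=> _; exists (fun=> 0); [rewrite big1|move=> c; exists [::]].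
case/andP => cfg /IH[k sk hk].
have [cc oth] := lab_cov c0 Hr (p := (f, g)) cfg; set c1 := lab r c0 (f, g) in cc oth.
exists (fun c => (c == c1) + k c).
  rewrite big_split /= -sk (bigD1 c1) //= eqxx big1 ?addn0 // => c /negbTE -> //.
move=> c; have [q [h1 h2 h3]] := hk c; case: (eqVneq c c1) => [e|n].
  exists (r c g :: q); split=> //=; last by rewrite h3.
  by rewrite h1 andbT e.
have e : r c f = r c g by apply: oth.
by exists q; rewrite e.
Qed.

(** Refine each cover of [A] to a chain of [P] between the constants: every one of the coordinates
    has to make exactly one step. *)
Lemma path_lift a p : path (cov A) a p -> exists2 p', path (cov predT) a p' &
  last a p' = last a p /\ size p' = #|C| * size p.
Proof.
elim: p a => [|y p IH] a /=; first by move=> _; exists [::]; rewrite ?muln0.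
case/andP => ca /IH[p2 pp2 [l2 s2]].
have [p1 pp1 l1] := cov_path (S := predT) isT isT (cov_le ca).
have [k sk hk] := path_count pp1.
have k1 c : k c = 1.
  have [q [h1 h2 <-]] := hk c; rewrite l1 !fixE ?(cov_l ca) ?(cov_r ca) // in h1 h2.
  exact: cov_path1 ca h1 h2.
exists (p1 ++ p2); first by rewrite cat_path pp1 l1.
split; first by rewrite last_cat l1.
rewrite size_cat s2 mulnS sk; congr (_ + _).
by rewrite (eq_bigr (fun=> 1)) // sum1_card.
Qed.

(* Chains of P split along the coordinates into chains of A, and a chain of A of length m lifts
   to one of length #|C| * m; so every coordinate of [f] starts a longest chain of A. *)
Lemma longest_fix f p : connected C -> path (cov predT) f p ->
  (forall g q, path (cov predT) g q -> size q <= size p) -> fixr r f.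
Proof.
move=> Cc pp mx; have [k sk hk] := path_count pp.
have C0 : 0 < #|C| by apply/card_gt0P; exists c0.
have bound a q : path (cov A) a q -> #|C| * size q <= size p.
  by move=> /path_lift[p' pp' [_ <-]]; apply: mx pp'.
have [m km] : exists m, forall c, k c = m.
  have [cs hcs] : exists cs, forall c, k c <= k cs.
    by have [cs _ h] := @arg_maxnP C c0 predT k isT; exists cs => c; apply: h.
  exists (k cs) => c; apply/eqP; rewrite eqn_leq hcs /= leqNgt; apply/negP => lt.
  have [q [h1 _ h3]] := hk cs; have := bound _ _ h1; rewrite h3 sk leqNgt => /negP; apply.
  rewrite -sum_nat_const (bigD1 c) //= [X in _ < X](bigD1 c) //= -addSn leq_add //.
  by apply: leq_sum => c' _; apply: hcs.
have sp : size p = #|C| * m by rewrite sk (eq_bigr (fun=> m)) // sum_nat_const.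
apply: (fixr_const c0 Hr Cc) => c c' cc'.
have [q [h1 _ h3]] := hk c'.
(* A chain from [r c f] to [r c' f], put in front of a longest chain starting at [r c' f], has to be
   empty. *)
have [q1 pq1 l1] := cov_path (fix_r Hr c f) (fix_r Hr c' f) (r_inc Hr f cc').
have h : path (cov A) (r c f) (q1 ++ q) by rewrite cat_path pq1 l1.
have := bound _ _ h; rewrite size_cat h3 km sp mulnDr -{2}[_ * m]add0n leq_add2r leqn0 muln_eq0.
by rewrite -leqn0 leqNgt C0 /= => /nilP e; rewrite -l1 e.
Qed.
End RootChains.

Lemma bfix_ex (P C D : fposet) (r : C -> P -> P) (s : D -> P -> P) (c0 : C) (d0 : D) (x : P) :
  root r -> root s -> connected C -> connected D -> exists e, bfix r s e.
Proof.
move=> Hr Hs Cc Dc.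
pose Q n := [exists f : P, [exists p : n.-tuple P, path (cov predT) f p]].
have Q0 : exists n, Q n.
  by exists 0; apply/existsP; exists x; apply/existsP; exists [tuple].
have Qb n : Q n -> n <= #|P|.
  by case/existsP => f /existsP[p pp]; rewrite -(size_tuple p); apply: size_path pp.
case: (ex_maxnP Q0 Qb) => n /existsP[f /existsP[p pp]] mx.
have mx' (g : P) q : path (cov predT) g q -> size q <= size p.
  move=> pq; rewrite size_tuple; apply: mx; apply/existsP; exists g; apply/existsP.
  by exists (in_tuple q).
by exists f; apply/andP; split; [apply: (longest_fix c0 Hr Cc pp)|apply: (longest_fix d0 Hs Dc pp)].
Qed.

(** * Exponentials of finite posets *)

Lemma cmp_sym (P : fposet) : symmetric (@cmp P).
Proof. by move=> x y; rewrite /cmp orbC. Qed.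

Lemma same_sym (P : fposet) (x y : P) : same_comp x y -> same_comp y x.
Proof. by rewrite /same_comp (sym_connect_sym (@cmp_sym P)). Qed.

Lemma same_trans (P : fposet) (y x z : P) : same_comp x y -> same_comp y z -> same_comp x z.
Proof. exact: connect_trans. Qed.

Lemma same_ind (P : fposet) (Q : P -> Prop) (x y : P) : same_comp x y -> Q x ->
  (forall u v, Q u -> cmp u v -> Q v) -> Q y.
Proof.
move=> /connectP[p pp ->] Qx h; elim: p x pp Qx => //= z p IH x /andP[xz pp] Qx.
by apply: IH pp _; apply: h xz.
Qed.

Lemma same_map (P Q : fposet) (f : P -> Q) (x y : P) : (forall u v, ple u v -> ple (f u) (f v)) ->
  same_comp x y -> same_comp (f x) (f y).
Proof.
move=> m h; apply: (same_ind (Q := fun y => same_comp (f x) (f y)) h); first exact: connect0.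
move=> u v k uv; apply: same_trans k _; apply: connect1.
by case/orP: uv => /m l; rewrite /cmp l ?orbT.
Qed.

Lemma connected_iso (P Q : fposet) : iso P Q -> connected P -> connected Q.
Proof.
move=> [f [[g fK gK] fm]] Pc x y; rewrite -(gK x) -(gK y).
by apply: same_map (Pc _ _) => u v; rewrite fm.
Qed.

Lemma nonempty_iso (P Q : fposet) : iso P Q -> nonempty P -> nonempty Q.
Proof. by move=> [f _] [x _]; exists (f x). Qed.

Section SubRoot.
Variables (P C : fposet) (r : C -> P -> P) (S : pred P).
Hypothesis Hr : root r.
Hypothesis Sc : forall x y, S x -> cmp x y -> S y.
Hypothesis Sr : forall c x, S x -> S (r c x).
Definition sroot (c : C) (x : sub_poset S) : sub_poset S := insubd x (r c (val x)).

Lemma sub_same (x y : sub_poset S) : same_comp (val x) (val y) -> same_comp x y.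
Proof.
move=> h; suff [Sy k] : exists Sy : S (val y), same_comp x (exist (fun z => is_true (S z)) (val y) Sy).
  by rewrite (_ : y = exist _ (val y) Sy) //; apply: val_inj.
apply: (same_ind (Q := fun y => exists Sy : S y, same_comp x (exist (fun z => is_true (S z)) y Sy)) h).
  by exists (valP x); rewrite (_ : exist _ _ _ = x) ?[same_comp _ _]connect0 //; apply: val_inj.
move=> u v [Su ku] uv; exists (Sc Su uv); apply: same_trans ku _; exact: connect1.
Qed.

Lemma srootE c x : val (sroot c x) = r c (val x).
Proof. by rewrite /sroot val_insubd Sr //; apply: valP. Qed.

Lemma sroot_root : root sroot.
Proof.
have lift (f g : P) : S f -> ple f g || ple g f -> S g by move=> Sf; apply: Sc.
split.
- by move=> c f g h; rewrite /ple /= /sub_le !srootE; apply: (r_mono Hr).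
- by move=> c c' f; apply: val_inj; rewrite !srootE (r_abs Hr).
- by move=> c c' f h; rewrite /ple /= /sub_le !srootE; apply: (r_inc Hr).
- move=> f g h; apply: (r_ext Hr) => c; have := h c; by rewrite /ple /= /sub_le !srootE.
- move=> f a am fx h.
  have [|||g hg] := r_up Hr (f := val f) (a := fun c => val (a c)).
  + by move=> c c' /am.
  + by move=> c c'; rewrite -srootE fx.
  + by move=> c; have := h c; rewrite /ple /= /sub_le srootE.
  have Sg : S g.
    apply: (lift (val f)); first exact: valP.
    apply/orP; left; apply: (r_ext Hr) => c; rewrite hg; have := h c.
    by rewrite /ple /= /sub_le srootE.
  by exists (exist (fun z => is_true (S z)) g Sg) => c; apply: val_inj; rewrite srootE hg.
move=> f a am fx h.
have [|||g hg] := r_dn Hr (f := val f) (a := fun c => val (a c)).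
+ by move=> c c' /am.
+ by move=> c c'; rewrite -srootE fx.
+ by move=> c; have := h c; rewrite /ple /= /sub_le srootE.
have Sg : S g.
  apply: (lift (val f)); first exact: valP.
  apply/orP; right; apply: (r_ext Hr) => c; rewrite hg; have := h c.
  by rewrite /ple /= /sub_le srootE.
by exists (exist (fun z => is_true (S z)) g Sg) => c; apply: val_inj; rewrite srootE hg.
Qed.
End SubRoot.

Section Transport.
Variables (P Q D : fposet) (s : D -> Q -> Q) (f : P -> Q) (g : Q -> P).
Hypotheses (Hs : root s) (fK : cancel f g) (gK : cancel g f).
Hypothesis fm : forall x y, ple x y = ple (f x) (f y).
Definition troot (d : D) (x : P) : P := g (s d (f x)).
Let gm x y : ple (g x) (g y) = ple x y. Proof. by rewrite fm !gK. Qed.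

Lemma troot_root : root troot.
Proof.
split.
- by move=> c x y h; rewrite gm; apply: (r_mono Hs); rewrite -fm.
- by move=> c c' x; rewrite /troot gK (r_abs Hs).
- by move=> c c' x h; rewrite gm; apply: (r_inc Hs).
- by move=> x y h; rewrite fm; apply: (r_ext Hs) => c; have := h c; rewrite gm.
- move=> x a am fx h; have [|||y hy] := r_up Hs (f := f x) (a := fun c => f (a c)).
  + by move=> c c' /am; rewrite fm.
  + by move=> c c'; rewrite -[in RHS](fx c c') gK.
  + by move=> c; have := h c; rewrite fm gK.
  by exists (g y) => c; rewrite /troot gK hy fK.
move=> x a am fx h; have [|||y hy] := r_dn Hs (f := f x) (a := fun c => f (a c)).
+ by move=> c c' /am; rewrite fm.
+ by move=> c c'; rewrite -[in RHS](fx c c') gK.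
+ by move=> c; have := h c; rewrite fm gK.
by exists (g y) => c; rewrite /troot gK hy fK.
Qed.

Lemma troot_fix : iso (sub_poset (fixr troot)) (sub_poset (fixr s)).
Proof.
have fx x : fixr troot x = fixr s (f x).
  apply/fixP/fixP => h c; first by rewrite -[in RHS](h c) gK.
  by rewrite /troot h fK.
apply: (@iso_rel (sub_poset (fixr troot)) (sub_poset (fixr s)) (fun x y => f (val x) = val y)).
- move=> x; have h : fixr s (f (val x)) by rewrite -fx; apply: valP.
  by exists (exist (fun z => is_true (fixr s z)) _ h).
- move=> y; have h : fixr troot (g (val y)) by rewrite fx gK; apply: valP.
  by exists (exist (fun z => is_true (fixr troot z)) _ h); rewrite /= gK.
by move=> x x' y y' h h'; rewrite /ple /= /sub_le fm h h'.
Qed.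
End Transport.

Section ExpRoot.
Variables (A C : fposet).
Local Notation Q := (exp_poset A C).

Lemma expf_mono (f : C -> A) : (forall c c', ple c c' -> ple (f c) (f c')) -> monob [ffun c => f c].
Proof.
by move=> h; apply/forallP => c; apply/forallP => c'; apply/implyP => cc'; rewrite !ffunE; apply: h.
Qed.
Definition expf (f : C -> A) (h : forall c c', ple c c' -> ple (f c) (f c')) : Q :=
  exist (fun f : {ffun C -> A} => is_true (monob f)) _ (expf_mono h).
Lemma expfE f h c : val (@expf f h) c = f c. Proof. by rewrite /= ffunE. Qed.

Definition econst (x : A) : Q := expf (fun c c' (_ : ple c c') => plexx x).
Lemma econstE x c : val (econst x) c = x. Proof. exact: expfE. Qed.
Lemma econst_le x y : ple x y -> ple (econst x) (econst y).
Proof. by move=> h; apply/expP => c; rewrite !econstE. Qed.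
Lemma econst_val (F : Q) c : (forall c', val F c' = val F c) -> F = econst (val F c).
Proof. by move=> h; apply: exp_ext => c'; rewrite econstE. Qed.

Definition eroot (c : C) (F : Q) : Q := econst (val F c).
Lemma eroot_root : root eroot.
Proof.
(* The element with coordinates [a] is the diagonal, with value [val (a c) c] at [c]. *)
have diag (a : C -> Q) : (forall c c', ple c c' -> ple (a c) (a c')) ->
    (forall c c', eroot c' (a c) = a c) -> exists G, forall c, eroot c G = a c.
  move=> am fx.
  have m c c' : ple c c' -> ple (val (a c) c) (val (a c') c').
    by move=> h; apply: (ple_tr (exp_mono _ h)); apply/expP/am.
  by exists (expf m) => c; rewrite /eroot expfE -[RHS](fx c c).
split.
- by move=> c F G /expP h; apply: econst_le.
- by move=> c c' F; rewrite /eroot econstE.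
- by move=> c c' F h; apply/econst_le/exp_mono.
- by move=> F G h; apply/expP => c; move/expP: (h c) => /(_ c); rewrite !econstE.
- by move=> F a am fx _; apply: diag.
- by move=> F a am fx _; apply: diag.
Qed.

Lemma in_C_cmp (F G : Q) : in_C F -> cmp F G -> in_C G.
Proof.
move=> /existsP[g /andP[dg h]] k; apply/existsP; exists g; rewrite dg /=.
by apply: same_trans h; apply: connect1; rewrite cmp_sym.
Qed.
Lemma in_C_same (F G : Q) : in_C F -> same_comp F G -> in_C G.
Proof. by move=> h k; apply: (same_ind (Q := fun G => in_C G) k h) => u v; apply: in_C_cmp. Qed.

Lemma in_C_const x : in_C (econst x).
Proof.
apply/existsP; exists (econst x); rewrite [same_comp _ _]connect0 andbT.
by apply/forallP => c; apply/forallP => c'; rewrite !econstE eqxx implybT.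
Qed.

Lemma in_CP (c0 : C) (F : Q) : connected C -> in_C F -> exists x, same_comp F (econst x).
Proof.
move=> Cc /existsP[g /andP[/forallP dg h]]; exists (val g c0).
rewrite -econst_val // => c; have /forallP/(_ c0)/implyP/(_ (Cc c c0))/eqP := dg c; by [].
Qed.

Definition croot : C -> C_poset A C -> C_poset A C := sroot eroot (S := @in_C A C).
Lemma crootE c F : val (croot c F) = econst (val (val F) c).
Proof. by apply: srootE => k x _; apply: in_C_const. Qed.
Lemma croot_root : root croot.
Proof.
by apply: sroot_root; [exact: eroot_root|exact: in_C_cmp|move=> c x _; apply: in_C_const].
Qed.

Lemma croot_fix (c0 : C) : iso (sub_poset (fixr croot)) A.
Proof.
apply: (@iso_rel (sub_poset (fixr croot)) A (fun x a => forall c, val (val (val x)) c = a)).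
- move=> x; exists (val (val (val x)) c0) => c.
  have /fixP/(_ c0) h := valP x.
  by rewrite -[in LHS]h crootE econstE.
- move=> a; have fx : fixr croot (exist (fun z => is_true (in_C z)) (econst a) (in_C_const a)).
    by apply/fixP => c; apply: val_inj; rewrite crootE /= econstE.
  by exists (exist (fun z => is_true (fixr croot z)) _ fx) => c; rewrite /= econstE.
move=> x x' a a' h h'; apply/idP/idP => [/expP/(_ c0)|k]; first by rewrite h h'.
by apply/expP => c; rewrite h h'.
Qed.

Lemma C_nonempty : nonempty A -> nonempty (C_poset A C).
Proof. by case=> a _; exists (exist (fun z => is_true (in_C z)) (econst a) (in_C_const a)). Qed.

Lemma C_connected (c0 : C) : connected A -> connected C -> connected (C_poset A C).
Proof.
move=> Ac Cc F G; apply: sub_same; first exact: in_C_cmp.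
have [a ha] := in_CP c0 Cc (valP F); have [b hb] := in_CP c0 Cc (valP G).
apply: same_trans ha _; apply: same_trans (same_sym hb).
exact: same_map econst_le (Ac a b).
Qed.
End ExpRoot.

(** * [B] as an exponential of [E] for non-isomorphic exponents *)

Section EStep.
Variables (P C D : fposet) (r : C -> P -> P) (s : D -> P -> P) (c0 : C) (d0 : D).
Hypothesis RS : biroot r s.
Let Hr : root r := bi_r RS.
Let Hs : root s := bi_s RS.
Local Notation A := (fixr r).
Local Notation B := (fixr s).
Local Notation E := (bfix r s).
Implicit Types (b g y : P).

(** Such a cover has type m, and its label map from [C] to [D] is an isomorphism. *)
Lemma iso_of_m e y : cov E e y -> cov A e y -> iso C D.
Proof.
move=> cE cA; have cp : covp A (e, y) := cA; have /andP[Ae Be] := cov_l cE.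
have [_ inj'] := Ecov_m c0 d0 RS cE cA.
case: (A_types c0 d0 RS Ae Be cp (plexx e)) => [[d [u _]]|[inj refl surj _]].
  by case: (inj_not_const RS cp u inj').
apply: (iso_rel (R := fun c d => xlab r s d0 (e, y) c = d)) => [c|//|c c' d d' <- <-].
  by exists (xlab r s d0 (e, y) c).
by apply/idP/idP => [|/refl //]; apply: (dl_le c0 d0 Hr Hs).
Qed.

Hypothesis nCD : ~ iso C D.

Lemma E_step_up b g y c1 : eval_fixed r s b -> up_inj r s c0 d0 b -> cov E (r c1 b) y ->
  (forall c, r c g = if c == c1 then y else r c b) -> B g.
Proof.
move=> eb ub cE gE; apply: (u_closed RS eb ub cE) => //.
by apply/negP => /(iso_of_m cE).
Qed.
End EStep.

Section M2.
Variables (P C D : fposet) (r : C -> P -> P) (s : D -> P -> P) (c0 : C) (d0 : D).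
Hypothesis RS : biroot r s.
Let Hr : root r := bi_r RS.
Let RO := biroot_op RS.
Local Notation B := (fixr s).
Local Notation E := (bfix r s).
Local Notation EP := (sub_poset (bfix r s)).
Implicit Types (b g y : P).
Hypothesis nCD : ~ iso C D.
Variable e : P.
Hypotheses (Ee : E e) (Bc : connected (sub_poset B)).
Hypothesis gB : forall b, B b -> regular r s c0 d0 b.

Lemma iso_op (X Y : fposet) : iso (op X) (op Y) -> iso X Y.
Proof. by move=> [f [fb fm]]; exists f; split=> // x y; apply: (fm y x). Qed.

Lemma E_step_dn b g y c1 : B b -> cov E y (r c1 b) ->
  (forall c, r c g = if c == c1 then y else r c b) -> B g.
Proof.
move=> Bb cE gE; have [eb _ db] := gB Bb.
apply: (@E_step_up (op P) (op C) (op D) r s c0 d0 RO _ b g y c1 eb) => //.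
- by move=> /iso_op.
- exact/(up_inj_op c0 d0 RS).
by rewrite cov_op.
Qed.

(** The map [c] to [r c x]; the dependent pairs carry the proof, from regularity of [x], that each
    value lies in [E]. *)
Definition bmap (x : sub_poset B) : exp_poset EP C :=
  expf (fun c c' (h : ple c c') => (r_inc Hr (val x) h :
    @ple EP (exist (fun z => is_true (E z)) (r c (val x)) (let: And3 ev0 _ _ := gB (valP x) in eval_fixed_E RS c ev0))
      (exist (fun z => is_true (E z)) (r c' (val x)) (let: And3 ev0 _ _ := gB (valP x) in eval_fixed_E RS c' ev0)))).

Lemma bmapE x c : val (val (bmap x) c) = r c (val x).
Proof. by rewrite expfE. Qed.

Lemma bmap_mono x x' : ple x x' -> ple (bmap x) (bmap x').
Proof. by move=> h; apply/expP => c; rewrite /ple /= /sub_le !bmapE; apply: (r_mono Hr). Qed.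

Let eB : sub_poset B := exist (fun z => is_true (B z)) e (proj2 (andP Ee)).
Let eE : EP := exist (fun z => is_true (E z)) e Ee.

Lemma bmap_e : bmap eB = econst C eE.
Proof.
apply: exp_ext => c; apply: val_inj; rewrite bmapE econstE /= fixE //.
by case/andP: Ee.
Qed.

Lemma bmap_in_C x : in_C (bmap x).
Proof.
apply: (in_C_same (in_C_const C eE)); rewrite -bmap_e.
exact: same_map bmap_mono (Bc eB x).
Qed.

Lemma ecov_ex (F F' : exp_poset EP C) : cov predT F F' ->
  exists c1, cov E (val (val F c1)) (val (val F' c1)) /\ forall c, c != c1 -> val F c = val F' c.
Proof.
move=> /(cov_lab_ex (eroot_root EP C))[c1 [cc oth]]; exists c1; split; last first.
  by move=> c /oth h; have := congr1 (fun G : exp_poset EP C => val G c) h; rewrite !econstE.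
have [_ _ lt mid] := covP _ _ _ cc.
apply/covP; split; [exact: valP|exact: valP| |].
  have h : ple (val F c1) (val F' c1) by have /expP/(_ c1) := pltW lt; rewrite !econstE.
  rewrite /plt (h : ple (val (val F c1)) (val (val F' c1))) andbT.
  apply/eqP => k; case: (plt_neq lt); congr (econst C _); exact: val_inj.
move=> z Ez h1 h2; pose zz : EP := exist (fun z => is_true (E z)) z Ez.
have fz : fixr (@eroot EP C) (econst C zz).
  by apply/fixP => c; rewrite /eroot econstE.
have k1 : ple (eroot c1 F) (econst C zz) by apply: econst_le.
have k2 : ple (econst C zz) (eroot c1 F') by apply: econst_le.
case: (mid _ fz k1 k2) => h; [left|right];
by have := congr1 (fun G : exp_poset EP C => val (val G c1)) h; rewrite !econstE.
Qed.

Let Q (F : exp_poset EP C) := exists2 b, B b & forall c, val (val F c) = r c b.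

Let Q_up F F' : cov predT F F' -> Q F -> Q F'.
Proof.
move=> cF [b Bb hb]; have [c1 [cE oth]] := ecov_ex cF.
have [g gE] : exists g, forall c, r c g = val (val F' c).
  exists (mk r b (fun c => val (val F' c))); apply: (mk_upP Hr (f := b)) => [c c' h||c].
  - exact: (exp_mono F' h).
  - by move=> c; case/andP: (valP (val F' c)).
  - by rewrite -hb; have /expP := cov_le cF; apply.
exists g => //; have [eb ub _] := gB Bb.
rewrite hb in cE; apply: (E_step_up RS nCD eb ub cE) => c; rewrite gE.
by case: eqP => [->//|/eqP n]; rewrite -oth // hb.
Qed.

Let Q_dn F F' : cov predT F F' -> Q F' -> Q F.
Proof.
move=> cF [b Bb hb]; have [c1 [cE oth]] := ecov_ex cF.
have [g gE] : exists g, forall c, r c g = val (val F c).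
  exists (mk r b (fun c => val (val F c))); apply: (mk_dnP Hr (f := b)) => [c c' h||c].
  - exact: (exp_mono F h).
  - by move=> c; case/andP: (valP (val F c)).
  - by rewrite -hb; have /expP := cov_le cF; apply.
exists g => //; rewrite hb in cE; apply: (E_step_dn Bb cE) => c; rewrite gE.
by case: eqP => [->//|/eqP n]; rewrite oth // hb.
Qed.

(** A map in the component of a constant is reached from it through covers, each changing one value
    by a cover of [E]; such changes keep it represented by a point of [B]. Connectedness passes from
    [B] to [E] because evaluation at [c0] maps [B] to [E] and fixes [E]. *)
Lemma iso_exp : connected C -> iso (sub_poset B) (C_poset EP C) /\ connected EP.
Proof.
move=> Cc; split.
  apply: (@iso_rel (sub_poset B) (C_poset EP C) (fun x F => forall c, val (val (val F) c) = r c (val x))).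
  - by move=> x; exists (exist (fun z => is_true (in_C z)) _ (bmap_in_C x)) => c; rewrite -[RHS]bmapE.
  - move=> F; have [a ha] := in_CP c0 Cc (valP F).
    have Qa : Q (econst C a).
      have /andP[Aa Ba] := valP a; exists (val a) => // c.
      by rewrite econstE fixE.
    have [b Bb hb] : Q (val F).
      apply: (same_ind (same_sym ha) Qa) => u v Qu /orP[h|h].
        apply: (cov_ind_up (S := predT) (Q := Q)) h => // y z _ Qy cyz; exact: Q_up Qy.
      apply: (cov_ind_dn (S := predT) (Q := Q)) h => // y z _ Qy cyz; exact: Q_dn Qy.
    by exists (exist (fun z => is_true (B z)) b Bb).
  move=> x x' F F' h h'; apply/idP/idP => [k|/expP k].
    by apply/expP => c; rewrite /ple /= /sub_le h h'; apply: (r_mono Hr).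
  by apply: (r_ext Hr) => c; rewrite -h -h'; apply: k.
move=> x y.
have /andP[_ Bx] := valP x; have /andP[_ By] := valP y.
have := same_map (f := fun z => val (bmap z) c0) _ (Bc (exist (fun z => is_true (B z)) _ Bx) (exist (fun z => is_true (B z)) _ By)).
have -> : val (bmap (exist (fun z => is_true (B z)) _ Bx)) c0 = x.
  by apply: val_inj; rewrite bmapE /= fixE //; case/andP: (valP x).
have -> : val (bmap (exist (fun z => is_true (B z)) _ By)) c0 = y.
  by apply: val_inj; rewrite bmapE /= fixE //; case/andP: (valP y).
by apply => u v /bmap_mono/expP.
Qed.
End M2.

(** * Functoriality, currying and products *)

Notation sub_intro S x h := (exist (fun z => is_true (S z)) x h).

(** A monotone map sends components into components, and for connected [T] every component concerned
    contains a constant. *)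
Lemma in_C_map (P T P' T' : fposet) (phi : exp_poset P T -> exp_poset P' T') (t0 : T) F :
  connected T -> (forall F G, ple F G -> ple (phi F) (phi G)) -> (forall a, in_C (phi (econst T a))) ->
  in_C F -> in_C (phi F).
Proof.
move=> Tc m h /(in_CP t0 Tc)[a ha]; apply: in_C_same (h a) _.
exact: same_map m (same_sym ha).
Qed.

Section Precomp.
Variables (A C C' : fposet) (h : C' -> C).
Hypothesis hm : forall c c', ple c c' -> ple (h c) (h c').
Definition epre (F : exp_poset A C) : exp_poset A C' :=
  expf (fun c c' cc' => exp_mono F (hm cc')).
Lemma epreE F c : val (epre F) c = val F (h c). Proof. exact: expfE. Qed.
Lemma epre_mono F G : ple F G -> ple (epre F) (epre G).
Proof. by move=> /expP k; apply/expP => c; rewrite !epreE. Qed.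
Lemma epre_in_C (c0 : C) F : connected C -> in_C F -> in_C (epre F).
Proof.
move=> Cc; apply: (in_C_map c0 Cc epre_mono) => a.
rewrite (_ : epre _ = econst C' a) ?in_C_const //.
by apply: exp_ext => c; rewrite epreE !econstE.
Qed.
End Precomp.

Section Postcomp.
Variables (A A' C : fposet) (h : A -> A').
Hypothesis hm : forall c c', ple c c' -> ple (h c) (h c').
Definition epost (F : exp_poset A C) : exp_poset A' C :=
  expf (fun c c' cc' => hm (exp_mono F cc')).
Lemma epostE F c : val (epost F) c = h (val F c). Proof. exact: expfE. Qed.
Lemma epost_mono F G : ple F G -> ple (epost F) (epost G).
Proof. by move=> /expP k; apply/expP => c; rewrite !epostE; apply: hm. Qed.
Lemma epost_in_C (c0 : C) F : connected C -> in_C F -> in_C (epost F).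
Proof.
move=> Cc; apply: (in_C_map c0 Cc epost_mono) => a.
rewrite (_ : epost _ = econst C (h a)) ?in_C_const //.
by apply: exp_ext => c; rewrite epostE !econstE.
Qed.
End Postcomp.

Lemma C_iso_l (A A' C : fposet) (c0 : C) : connected C -> iso A A' ->
  iso (C_poset A C) (C_poset A' C).
Proof.
move=> Cc [f [[g fK gK] fm]].
have gm x y : ple (g x) (g y) = ple x y by rewrite fm !gK.
have f1 x y : ple x y -> ple (f x) (f y) by rewrite fm.
have g1 x y : ple x y -> ple (g x) (g y) by rewrite gm.
apply: (@iso_rel (C_poset A C) (C_poset A' C) (fun F G => forall c, f (val (val F) c) = val (val G) c)).
- move=> F; exists (sub_intro (@in_C A' C) _ (epost_in_C f1 c0 Cc (valP F))) => c.
  by rewrite -[RHS]/(val (epost f1 (val F)) c) epostE.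
- move=> G; exists (sub_intro (@in_C A C) _ (epost_in_C g1 c0 Cc (valP G))) => c.
  exact: etrans (congr1 f (epostE g1 (val G) c)) (gK _).
by move=> F F' G G' h h'; apply/expP/expP => k c; [rewrite -(h c) -(h' c) -fm|rewrite fm (h c) (h' c)]; apply: k.
Qed.

Lemma C_iso_r (A C C' : fposet) (c0 : C) : connected C -> iso C C' ->
  iso (C_poset A C) (C_poset A C').
Proof.
move=> Cc iC; have Cc' := connected_iso iC Cc; case: iC => f [[g fK gK] fm].
have gm x y : ple (g x) (g y) = ple x y by rewrite fm !gK.
have f1 x y : ple x y -> ple (f x) (f y) by rewrite fm.
have g1 x y : ple x y -> ple (g x) (g y) by rewrite gm.
apply: (@iso_rel (C_poset A C) (C_poset A C') (fun F G => forall c, val (val F) c = val (val G) (f c))).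
- move=> F; exists (sub_intro (@in_C A C') _ (epre_in_C g1 c0 Cc (valP F))) => c.
  by rewrite -[RHS]/(val (epre g1 (val F)) (f c)) epreE fK.
- move=> G; exists (sub_intro (@in_C A C) _ (epre_in_C f1 (f c0) Cc' (valP G))) => c.
  by rewrite -[LHS]/(val (epre f1 (val G)) c) epreE.
move=> F F' G G' h h'; apply/expP/expP => k c; last by rewrite h h'; apply: k.
by rewrite -(gK c) -h -h'; apply: k.
Qed.

Lemma C_single (A C : fposet) (c0 : C) : (forall c, c = c0) -> iso A (C_poset A C).
Proof.
move=> one; apply: (@iso_rel A (C_poset A C) (fun a F => val (val F) c0 = a)).
- move=> a; exists (sub_intro (@in_C A C) _ (in_C_const C a)).
  by rewrite -[LHS]/(val (econst C a) c0) econstE.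
- by move=> F; exists (val (val F) c0).
move=> a a' F F' <- <-; apply/idP/idP => [k|/expP/(_ c0) //].
by apply/expP => c; rewrite (one c).
Qed.

Section Curry.
Variables (A C1 C2 : fposet) (c1 : C1) (c2 : C2).
Hypotheses (Cc1 : connected C1) (Cc2 : connected C2).
Local Notation CC := (prod_poset C1 C2).

Lemma prod_connected : connected CC.
Proof.
move=> [x y] [x' y']; apply: (same_trans (y := (x', y) : CC)).
  by apply: (same_map (Q := CC) (f := fun x => (x, y)) _ (Cc1 x x')) => u v h; apply/andP; rewrite /= h plexx.
by apply: (same_map (Q := CC) (f := fun y => (x', y)) _ (Cc2 y y')) => u v h; apply/andP; rewrite /= h plexx.
Qed.

Let pair1 (y : C2) x x' : @ple C1 x x' -> @ple CC (x, y) (x', y).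
Proof. by move=> h; apply/andP; rewrite /= h plexx. Qed.
Let pair2 (x : C1) y y' : @ple C2 y y' -> @ple CC (x, y) (x, y').
Proof. by move=> h; apply/andP; rewrite /= h plexx. Qed.
Let fst_mono (u v : CC) : ple u v -> ple u.1 v.1. Proof. by case/andP. Qed.

Definition slice (F : C_poset A CC) (y : C2) : C_poset A C1 :=
  sub_intro (@in_C A C1) _ (epre_in_C (pair1 y) ((c1, c2) : CC) prod_connected (valP F)).
Lemma sliceE F y x : val (val (slice F y)) x = val (val F) (x, y).
Proof. exact: epreE. Qed.
Lemma slice_mono F y y' : ple y y' -> ple (slice F y) (slice F y').
Proof. by move=> h; apply/expP => x; rewrite !sliceE; apply: exp_mono; apply: pair2. Qed.
Definition curry F : exp_poset (C_poset A C1) C2 := expf (slice_mono F).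
Lemma curryE F y x : val (val (val (curry F) y)) x = val (val F) (x, y).
Proof. by rewrite expfE sliceE. Qed.
Lemma curry_mono F G : ple F G -> ple (curry F) (curry G).
Proof. by move=> /expP h; apply/expP => y; apply/expP => x; rewrite !curryE. Qed.

Lemma curry_in_C F : in_C (curry F).
Proof.
have [a ha] := in_CP ((c1, c2) : CC) prod_connected (valP F).
pose F0 : C_poset A CC := sub_intro (@in_C A CC) _ (in_C_const CC a).
(* The path to a constant has to run inside [C_poset A CC], where [curry] is defined. *)
have h : same_comp F0 F by apply: sub_same; [exact: in_C_cmp|exact: same_sym].
apply: in_C_same (same_map curry_mono h).
pose a1 : C_poset A C1 := sub_intro (@in_C A C1) _ (in_C_const C1 a).
rewrite (_ : curry F0 = econst C2 a1) ?in_C_const //.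
apply: exp_ext => y; apply: val_inj; apply: exp_ext => x.
by rewrite curryE econstE -[LHS]/(val (econst CC a) _) -[RHS]/(val (econst C1 a) _) !econstE.
Qed.

Lemma uncurry_proof (G : exp_poset (C_poset A C1) C2) (u v : CC) : ple u v ->
  ple (val (val (val G u.2)) u.1) (val (val (val G v.2)) v.1).
Proof.
case/andP => h1 h2; apply: (ple_tr (exp_mono _ h1)).
by have /expP := exp_mono G h2; apply.
Qed.
Definition uncurry G : exp_poset A CC := expf (uncurry_proof G).
Lemma uncurryE G u : val (uncurry G) u = val (val (val G u.2)) u.1. Proof. exact: expfE. Qed.
Lemma uncurry_mono G G' : ple G G' -> ple (uncurry G) (uncurry G').
Proof. by move=> /expP h; apply/expP => u; rewrite !uncurryE; have /expP := h u.2; apply. Qed.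
Lemma uncurry_in_C G : in_C G -> in_C (uncurry G).
Proof.
apply: (in_C_map c2 Cc2 uncurry_mono) => g.
rewrite (_ : uncurry _ = epre fst_mono (val g)); first by apply: (epre_in_C _ c1) => //; apply: valP.
by apply: exp_ext => u; rewrite uncurryE econstE epreE.
Qed.

Lemma C_curry : iso (C_poset A CC) (C_poset (C_poset A C1) C2).
Proof.
apply: (@iso_rel (C_poset A CC) (C_poset (C_poset A C1) C2)
  (fun F G => forall x y, val (val F) (x, y) = val (val (val (val G) y)) x)).
- move=> F; exists (sub_intro (@in_C (C_poset A C1) C2) _ (curry_in_C F)) => x y.
  by rewrite -[RHS]/(val (val (val (curry F) y)) x) curryE.
- move=> G; exists (sub_intro (@in_C A CC) _ (uncurry_in_C (valP G))) => x y.
  by rewrite -[LHS]/(val (uncurry (val G)) (x, y)) uncurryE.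
move=> F F' G G' h h'; apply/expP/expP => k.
  by move=> y; apply/expP => x; rewrite -h -h'; apply: k.
by case=> x y; rewrite h h'; have /expP := k y; apply.
Qed.
End Curry.

Lemma prod_swap (X Y : fposet) : iso (prod_poset X Y) (prod_poset Y X).
Proof.
exists (fun p => (p.2, p.1)); split; first by exists (fun p => (p.2, p.1)) => -[].
by case=> x y [x' y']; apply: andbC.
Qed.

Lemma prod_assoc (X Y Z : fposet) :
  iso (prod_poset X (prod_poset Y Z)) (prod_poset (prod_poset X Y) Z).
Proof.
exists (fun p => ((p.1, p.2.1), p.2.2)); split.
  by exists (fun p => (p.1.1, (p.1.2, p.2))) => [[x [y z]]|[[x y] z]].
by case=> x [y z] [x' [y' z']]; apply: andbA.
Qed.

Lemma prod_iso (X X' Y Y' : fposet) : iso X X' -> iso Y Y' ->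
  iso (prod_poset X Y) (prod_poset X' Y').
Proof.
move=> [f [[g fK gK] fm]] [h [[k hK kK] hm]].
exists (fun p => (f p.1, h p.2)); split.
  by exists (fun p => (g p.1, k p.2)) => [[x y]|[x y]] /=; rewrite ?fK ?gK ?hK ?kK.
by case=> x y [x' y']; congr (_ && _); [apply: fm|apply: hm].
Qed.

Definition one : fposet.
Proof.
refine (@FPoset unit (fun _ _ => true) _ _ _) => //.
by move=> [] [].
Defined.

Lemma one_connected : connected one. Proof. by move=> [] []; apply: connect0. Qed.
Lemma one_nonempty : nonempty one. Proof. by exists (tt : one). Qed.

Lemma prod_one (X : fposet) : iso X (prod_poset X one).
Proof.
exists (fun x => (x, tt : one)); split; first by exists fst => [|[x []]].
by move=> x y; rewrite /ple /= /prod_le /= andbT.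
Qed.

Lemma one_prod (X : fposet) : iso X (prod_poset one X).
Proof. exact: iso_trans (prod_one X) (prod_swap X one). Qed.

Lemma iso_one (X : fposet) (x0 : X) : (forall x, x = x0) -> iso X one.
Proof.
move=> h; apply: (iso_rel (R := fun (x : X) (_ : one) => True)) => [x|y|x x' y y' _ _].
- by exists (tt : one).
- by exists x0.
by rewrite (h x) (h x') plexx.
Qed.

Lemma prod_factors (C X Y : fposet) : nonempty C -> connected C -> iso C (prod_poset X Y) ->
  (nonempty X /\ connected X) /\ (nonempty Y /\ connected Y).
Proof.
move=> Cn Cc i; have := connected_iso i Cc; have [[x y] _] := nonempty_iso i Cn.
move=> Pc; split; split.
- by exists x.
- move=> u v; have := same_map (f := fun p : prod_poset X Y => p.1) _ (Pc (u, y) (v, y)).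
  by apply=> a b /andP[].
- by exists y.
move=> u v; have := same_map (f := fun p : prod_poset X Y => p.2) _ (Pc (x, u) (x, v)).
by apply=> a b /andP[].
Qed.

(** * Common refinement *)

Lemma transported_root (A B C D : fposet) (d0 : D) : factor C -> factor D ->
  iso (C_poset A C) (C_poset B D) ->
  exists s : D -> C_poset A C -> C_poset A C,
    biroot (@croot A C) s /\ iso (sub_poset (fixr s)) B.
Proof.
move=> fC fD [f [[g fK gK] fm]]; exists (troot (@croot B D) f g); split.
  split=> //; first exact: croot_root.
  exact: troot_root (croot_root B D) fK gK fm.
exact: iso_trans (troot_fix _ fK gK fm) (croot_fix B d0).
Qed.

Lemma factor_cancel (A B C D : fposet) : nonempty A -> connected A -> connected B ->
  factor C -> factor D -> iso C D -> iso (C_poset A C) (C_poset B D) -> iso A B.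
Proof.
move=> An Ac Bc fC fD iCD i.
have [Cc _ [c0 _]] := fC; have [Dc _ [d0 _]] := fD.
have [s [RS iB]] := transported_root d0 fC fD i.
have iA := croot_fix A c0; have [x _] := C_nonempty C An.
have [e Ee] := bfix_ex c0 d0 x (bi_r RS) (bi_s RS) Cc Dc.
have k := iso_fix c0 d0 RS Ee (connected_iso (iso_sym iA) Ac) (connected_iso (iso_sym iB) Bc) iCD.
exact: iso_trans (iso_sym iA) (iso_trans k iB).
Qed.

Lemma factor_split (A B C D : fposet) : nonempty A -> connected A -> connected B ->
  factor C -> factor D -> ~ iso C D -> ends C D -> iso (C_poset A C) (C_poset B D) ->
  exists E, [/\ nonempty E, connected E, iso A (C_poset E D) & iso B (C_poset E C)].
Proof.
move=> An Ac Bc fC fD nCD en i.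
have [Cc _ [c0 _]] := fC; have [Dc _ [d0 _]] := fD.
have [s [RS iB]] := transported_root d0 fC fD i.
have [x _] := C_nonempty C An.
have [e Ee] := bfix_ex c0 d0 x (bi_r RS) (bi_s RS) Cc Dc.
have Bc' := connected_iso (iso_sym iB) Bc.
have gB := all_regular c0 d0 RS Ee Bc' en.
have [iE Ec] := iso_exp RS nCD Ee Bc' gB Cc.
have En : nonempty (sub_poset (bfix (@croot A C) s)).
  by exists (sub_intro (bfix (@croot A C) s) e Ee).
have iBE := iso_trans (iso_sym iB) iE.
exists (sub_poset (bfix (@croot A C) s)); split=> //.
set EP := sub_poset _ in iBE Ec En *.
apply: (factor_cancel An Ac _ fC fC (iso_refl C)); first exact: C_connected.
(* With [B] replaced by the exponential of [EP] by [C], the exponents [C] and [D] are exchanged by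
   currying, so that [C] is outermost on both sides and cancels. *)
apply: iso_trans i _; apply: iso_trans (C_iso_l d0 Dc iBE) _.
apply: iso_trans (iso_sym (C_curry EP c0 d0 Cc Dc)) _.
apply: iso_trans (C_curry EP d0 c0 Dc Cc).
by apply: C_iso_r (prod_swap C D); [exact: (c0, d0)|exact: prod_connected].
Qed.

Definition refinement (A B C D : fposet) : Prop :=
  exists E X Y Z : fposet,
    [/\ nonempty E /\ connected E, nonempty X /\ connected X,
        nonempty Y /\ connected Y, nonempty Z /\ connected Z &
        [/\ iso A (C_poset E X), iso B (C_poset E Y),
            iso C (prod_poset Y Z) & iso D (prod_poset X Z)]].

Lemma refinement_sym (A B C D : fposet) : refinement B A D C -> refinement A B C D.
Proof.
by move=> [E [X [Y [Z [hE hX hY hZ [i1 i2 i3 i4]]]]]]; exists E, Y, X, Z.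
Qed.

Lemma refinement_single (A B C D : fposet) (c : C) : (forall k, k = c) ->
  nonempty B -> connected B -> nonempty D -> connected D ->
  iso (C_poset A C) (C_poset B D) -> refinement A B C D.
Proof.
move=> one_c Bn Bc Dn Dc i.
have o := conj one_nonempty one_connected.
exists B, D, one, one; split=> //; split.
- exact: iso_trans (C_single A one_c) i.
- by apply: (C_single B (c0 := tt : one)) => -[].
- exact: iso_trans (iso_one one_c) (prod_one one).
- exact: prod_one.
Qed.

Lemma iso_card (P Q : fposet) : iso P Q -> #|P| = #|Q|.
Proof. by move=> [f [fb _]]; apply: bij_eq_card fb. Qed.

Lemma card_prod_poset (P Q : fposet) : #|prod_poset P Q| = #|P| * #|Q|.
Proof. exact: card_prod. Qed.

Lemma nonempty_card (P : fposet) : nonempty P -> 0 < #|P|.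
Proof. by case=> x _; apply/card_gt0P; exists x. Qed.

Definition solved (n : nat) : Prop := forall A B C D : fposet, #|C| + #|D| < n ->
  nonempty A -> connected A -> nonempty B -> connected B ->
  nonempty C -> connected C -> nonempty D -> connected D ->
  iso (C_poset A C) (C_poset B D) -> refinement A B C D.

(** With [C] split as [C1] times [C2], first refine the exponential of [A] by [C1] and [B] with
    exponents [C2] and [D]. This splits [C2] as [Y1] times [Z1], [D] as [X1] times [Z1], and gives
    an isomorphism between the exponentials of [A] by [C1] and of [E1] by [X1], to be refined next.
    The exponents stay small enough because [X1] is a factor of [D]. *)
Lemma refinement_decomp (A B C D : fposet) : solved (#|C| + #|D|) ->
  nonempty A -> connected A -> nonempty B -> connected B ->
  nonempty C -> connected C -> nonempty D -> connected D ->
  iso (C_poset A C) (C_poset B D) -> ~ indec C -> refinement A B C D.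
Proof.
move=> IH An Ac Bn Bc Cn Cc Dn Dc i nind.
have [C1 [C2 [iC n1 n2]]] : exists C1 C2, [/\ iso C (prod_poset C1 C2), #|C1| <> 1 & #|C2| <> 1].
  apply: NNPP => h; apply: nind => X Y k; apply: NNPP => h'; apply: h.
  by exists X, Y; split=> // e; apply: h'; [left|right].
have [[C1n C1c] [C2n C2c]] := prod_factors Cn Cc iC.
have cC := iso_card iC; rewrite card_prod_poset in cC.
have p1 := nonempty_card C1n; have p2 := nonempty_card C2n; have pD := nonempty_card Dn.
have [lt1 lt2] : #|C1| < #|C| /\ #|C2| < #|C|.
  rewrite cC; split; first by rewrite -{1}[#|C1|]muln1 ltn_pmul2l // ltn_neqAle p2 eq_sym andbT; apply/eqP.
  by rewrite -{1}[#|C2|]mul1n ltn_pmul2r // ltn_neqAle p1 eq_sym andbT; apply/eqP.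
have [[c1 _] [c2 _]] := (C1n, C2n).
have i1 : iso (C_poset (C_poset A C1) C2) (C_poset B D).
  apply: iso_trans i; apply: iso_sym.
  have [c _] := Cn; exact: iso_trans (C_iso_r A c Cc iC) (C_curry A c1 c2 C1c C2c).
have [|E1 [X1 [Y1 [Z1 [[E1n E1c] [X1n X1c] [Y1n Y1c] [Z1n Z1c] [a1 a2 a3 a4]]]]]] :=
  IH (C_poset A C1) B C2 D _ (C_nonempty C1 An) (C_connected c1 Ac C1c) Bn Bc C2n C2c Dn Dc i1.
  by rewrite ltn_add2r.
have leX : #|X1| <= #|D|.
  by rewrite (iso_card a4) card_prod_poset leq_pmulr // nonempty_card.
have [|E [X [Y [Z [[En Ec] [Xn Xc] [Yn Yc] [Zn Zc] [b1 b2 b3 b4]]]]]] :=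
  IH A E1 C1 X1 _ An Ac E1n E1c C1n C1c X1n X1c a1.
  by apply: leq_ltn_trans (leq_add (leqnn _) leX) _; rewrite ltn_add2r.
have [[y _] [y1 _]] := (Yn, Y1n); have [[z _] [z1 _]] := (Zn, Z1n).
exists E, X, (prod_poset Y Y1), (prod_poset Z Z1); split=> //.
- by split; [exists (y, y1)|apply: prod_connected].
- by split; [exists (z, z1)|apply: prod_connected].
split=> //.
- apply: iso_trans a2 _; apply: iso_trans (C_iso_l y1 Y1c b2) _.
  exact: iso_sym (C_curry E y y1 Yc Y1c).
- apply: iso_trans iC _; apply: iso_trans (prod_iso b3 a3) _.
  apply: iso_trans (prod_assoc (prod_poset Y Z) Y1 Z1) _.
  apply: iso_trans (iso_sym (prod_assoc (prod_poset Y Y1) Z Z1)) => //.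
  apply: prod_iso (iso_refl _); apply: iso_trans (iso_sym (prod_assoc Y Z Y1)) _.
  apply: iso_trans (prod_assoc Y Y1 Z); exact: prod_iso (iso_refl _) (prod_swap _ _).
apply: iso_trans a4 _; apply: iso_trans (prod_iso b4 (iso_refl _)) _.
exact: iso_sym (prod_assoc _ _ _).
Qed.

Lemma solved_all n : solved n.
Proof.
elim: n => // n IH A B C D; rewrite ltnS => le_n An Ac Bn Bc Cn Cc Dn Dc i.
have IH1 : solved (#|C| + #|D|) by move=> A' B' C' D' lt; apply: IH; apply: leq_trans le_n.
have IH2 : solved (#|D| + #|C|) by rewrite addnC.
have big (Q : fposet) (q : Q) : (forall k, k = q) \/ exists c c' : Q, c != c'.
  case: (classic (forall k, k = q)) => [h|/not_all_ex_not[k n']]; [by left|right].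
  by exists k, q; apply/eqP.
have [[c _] [d _]] := (Cn, Dn).
case: (big C c) => [h|bC]; first exact: (refinement_single h).
case: (big D d) => [h|bD].
  by apply/refinement_sym/(refinement_single h) => //; apply: iso_sym.
case: (classic (indec C)) => iC; last exact: refinement_decomp.
case: (classic (indec D)) => iD; last by apply/refinement_sym/refinement_decomp => //; apply: iso_sym.
have fC : factor C by []; have fD : factor D by [].
have o := conj one_nonempty one_connected.
case: (classic (iso C D)) => iCD.
  (* The whole exponent is the common factor, and cancellation identifies the bases. *)
  exists A, one, one, C; split=> //; split.
  - by apply: (C_single A (c0 := tt : one)) => -[].
  - apply: iso_trans (iso_sym (factor_cancel An Ac Bc fC fD iCD i)) _.
    by apply: (C_single A (c0 := tt : one)) => -[].
  - exact: one_prod.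
  - exact: iso_trans (iso_sym iCD) (one_prod C).
have [E [En Ec iA iB]] :
    exists E, [/\ nonempty E, connected E, iso A (C_poset E D) & iso B (C_poset E C)].
  case: (ends_or c d) => h; first exact: factor_split h i.
  have [|E [En Ec iB iA]] := factor_split Bn Bc Ac fD fC _ h (iso_sym i).
    by move=> /iso_sym.
  by exists E.
(* Non-isomorphic indecomposable exponents share only the trivial factor. *)
by exists E, D, C, one; split=> //; split=> //; apply: prod_one.
Qed.

Theorem theorem4 (A B C D : fposet) :
  nonempty A -> connected A -> nonempty B -> connected B ->
  nonempty C -> connected C -> nonempty D -> connected D ->
  iso (C_poset A C) (C_poset B D) ->
  exists E X Y Z : fposet,
    [/\ nonempty E /\ connected E, nonempty X /\ connected X,
        nonempty Y /\ connected Y, nonempty Z /\ connected Z &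
        [/\ iso A (C_poset E X), iso B (C_poset E Y),
            iso C (prod_poset Y Z) & iso D (prod_poset X Z)]].
Proof.
move=> An Ac Bn Bc Cn Cc Dn Dc i.
exact: (solved_all (ltnSn (#|C| + #|D|)) An Ac Bn Bc Cn Cc Dn Dc i).
Qed.
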